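(* Let $n\ge 2$, $\alpha>1$, and let $\Phi:\mathbb{R}^n\to\mathbb{R}$ be a strictly convex, even, $\alpha$-homogeneous function $$\Phi(x)=\frac1\alpha |x|^\alpha\phi^\alpha(\varphi),\qquad \varphi=\frac{x}{|x|}\in\mathbb{S}^{n-1},$$ where $\phi:\mathbb{S}^{n-1}\to(0,\infty)$; assume that $\Phi$ is three times continuously differentiable on $\mathbb{R}^n\setminus\{0\}$ with $\det D^2\Phi(x)>0$ for all $x\ne 0$. Consider the probability measures $$\mu=\frac{e^{-\Phi}dx}{\int_{\mathbb{R}^n}e^{-\Phi}dx}\ \text{ on }\mathbb{R}^n,\qquad \nu=\frac{\phi^{-n}d\varphi}{\int_{\mathbb{S}^{n-1}}\phi^{-n}d\varphi}\ \text{ on }\mathbb{S}^{n-1}.$$ For a constant $C_\alpha>0$ consider the inequality $$(A)\qquad \mathrm{Var}_\mu f\le C_\alpha\int_{\mathbb{R}^n}\langle (D^2\Phi)^{-1}\nabla f,\nabla f\rangle\,d\mu\quad\text{for all even } f \text{ on } \mathbb{R}^n,$$ and for a constant $C_\nu>0$ the inequality $$(B)\qquad \mathrm{Var}_\nu g\le C_\nu\int_{\mathbb{S}^{n-1}}\langle \phi (D^2\phi)^{-1}\nabla_{\mathbb{S}^{n-1}}g,\nabla_{\mathbb{S}^{n-1}}g\rangle\,d\nu\quad\text{for all even } g \text{ on } \mathbb{S}^{n-1}.$$ (1) If (A) holds for some value $1-\frac1\alpha\le C_\alpha\le 1$, then (B) holds with $$C_\nu=\frac{C_\alpha^2}{(n-\alpha)C_\alpha+\alpha-1}.$$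 (2) If (B) holds with some constant $C_\nu$, then (A) holds with the constant $\max\bigl(1-\frac1\alpha,\ nC_\nu\bigr)$ in place of $C_\alpha$. In particular, (A) holds with $C_\alpha=1-\frac1\alpha$ if and only if (B) holds with $C_\nu=\frac1n\bigl(1-\frac1\alpha\bigr)$.
   Context: $\mathrm{Var}_m f=\int f^2dm-(\int f\,dm)^2$. $d\varphi$ is the $(n-1)$-dimensional Hausdorff measure on $\mathbb{S}^{n-1}$; $\nabla_{\mathbb{S}^{n-1}}$, $\nabla^2_{\mathbb{S}^{n-1}}$ are the spherical gradient and Hessian. On $\mathbb{R}^n$, $D^2$ is the Euclidean Hessian; for a function $\phi$ on $\mathbb{S}^{n-1}$, $D^2\phi=\phi\cdot I+\nabla^2_{\mathbb{S}^{n-1}}\phi$, an operator on the tangent spaces of the sphere. A function is even if $f(-x)=f(x)$. Test functions are continuously differentiable; on $\mathbb{R}^n$ they are in addition in $L^2(\mu)$, and the right-hand side of (A) is allowed to be $+\infty$. *)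

(* Defs.v *)
From mathcomp Require Import all_boot all_order all_algebra.
From mathcomp Require Import all_classical all_reals all_analysis.

Set Implicit Arguments.
Unset Strict Implicit.
Unset Printing Implicit Defensive.
Import Order.TTheory GRing.Theory Num.Theory numFieldNormedType.Exports.

Local Open Scope classical_set_scope.
Local Open Scope ring_scope.

Section Euclidean.
Context {R : realType} {n : nat}.
Implicit Types (x y u v : 'rV[R]_n) (f g : 'rV[R]_n -> R).

Definition dot x y : R := \sum_(i < n) x 0 i * y 0 i.

(* The norm `|x| of 'rV[R]_n in the library is the sup norm. *)
Definition enorm x : R := Num.sqrt (dot x x).

Definition sphere : set 'rV[R]_n := [set u | enorm u = 1].

Definition even f := forall x, f (- x) = f x.

Definition strictly_convex f := forall x y (t : R),
  x != y -> 0 < t < 1 -> f (t *: x + (1 - t) *: y) < t * f x + (1 - t) * f y.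

Definition partial (i : 'I_n) f : 'rV[R]_n -> R := fun x => 'D_(delta_mx 0 i) f x.

Definition grad f x : 'rV[R]_n := \row_i partial i f x.

Definition hess f x : 'M[R]_n := \matrix_(i, j) partial i (partial j f) x.

(* k times continuously differentiable on the open set U *)
Fixpoint Ck (k : nat) (U : set 'rV[R]_n) f : Prop :=
  if k is k'.+1 then
    (forall x, U x -> differentiable f x) /\
    (forall i, Ck k' U (partial i f))
  else forall x, U x -> {for x, continuous f}.

End Euclidean.

Arguments sphere : clear implicits.

(* Functions on the sphere are restrictions of functions g : 'rV[R]_n -> R; only
   their values on the sphere matter.  Calculus on the sphere goes through the
   degree 0 homogeneous extension g \o radial, defined off the origin. *)
Section Sphere.
Context {R : realType} {n : nat}.
Implicit Types (x u v : 'rV[R]_n) (g phi : 'rV[R]_n -> R).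

Definition radial x : 'rV[R]_n := (enorm x)^-1 *: x.

Definition even_sphere g := forall u, sphere R n u -> g (- u) = g u.

Definition C1_sphere g := Ck 1 [set x | x != 0] (g \o radial).

(* At u in the sphere, the differential of g along a tangent vector v is
   'D_v (g \o radial) u; as g \o radial is constant along rays, its Euclidean
   gradient at u is tangent to the sphere, hence is the Riemannian gradient. *)
Definition sgrad g u : 'rV[R]_n := grad (g \o radial) u.

(* Operators on the tangent space u^\perp (acting on row vectors, on the right)
   are represented by the matrices A with u *m A = 0 and A *m u^T = 0;
   the identity operator is represented by the orthogonal projection. *)
Definition tproj u : 'M[R]_n := 1%:M - u^T *m u.

Definition tinv u (A : 'M[R]_n) : 'M[R]_n := invmx (A + u^T *m u) - u^T *m u.

(* Riemannian Hessian v |-> nabla_v (sgrad phi), the Levi-Civita connection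
   of the sphere being the tangential part of the Euclidean derivative *)
Definition shess phi u : 'M[R]_n :=
  tproj u *m
  (\matrix_(i, j) partial i (fun x => sgrad phi (radial x) 0 j) u) *m
  tproj u.

Definition D2 phi u : 'M[R]_n := phi u *: tproj u + shess phi u.

Lemma tinvP u (A : 'M[R]_n) : sphere R n u ->
  u *m A = 0 -> A *m u^T = 0 -> A + u^T *m u \in unitmx ->
  [/\ u *m tinv u A = 0, tinv u A *m u^T = 0,
      A *m tinv u A = tproj u & tinv u A *m A = tproj u].
Proof.
move=> su uA Au Bu; set B := A + u^T *m u in Bu *.
have uu : u *m u^T = 1%:M.
  apply/rowP => i; rewrite ord1 !mxE -[RHS](expr1n R 2) -su sqr_sqrtr.
    by apply: eq_bigr => k _; rewrite mxE.
  by apply: sumr_ge0 => k _; rewrite -expr2 sqr_ge0.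
have uB : u *m B = u by rewrite mulmxDr uA add0r mulmxA uu mul1mx.
have Bu' : B *m u^T = u^T by rewrite mulmxDl Au add0r -mulmxA uu mulmx1.
have uV : u *m invmx B = u by rewrite -[in LHS]uB mulmxK.
have Vu : invmx B *m u^T = u^T by rewrite -[in LHS]Bu' mulKmx.
have AE : A = B - u^T *m u by rewrite addrK.
split; rewrite /tinv -/B.
- by rewrite mulmxBr uV mulmxA uu mul1mx subrr.
- by rewrite mulmxBl Vu -mulmxA uu mulmx1 subrr.
- by rewrite mulmxBr mulmxA Au mul0mx subr0 AE mulmxBl mulmxV// -mulmxA uV.
- by rewrite mulmxBl -(mulmxA u^T) uA mulmx0 subr0 AE mulmxBr mulVmx// mulmxA Vu.
Qed.

End Sphere.

(* Measures on R^n are given as set functions; they are meant to be evaluated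
   on, and integrated against, Borel sets only. *)
Definition borelRn (R : realType) (n : nat) :=
  g_sigma_algebraType (@open 'rV[R]_n).

Section Measures.
Context {R : realType}.
Local Open Scope ereal_scope.

(* n-fold product of the one-dimensional Lebesgue measure *)
Fixpoint lebesgueRn (n : nat) : set (borelRn R n) -> \bar R :=
  if n is m.+1 return set (borelRn R n) -> \bar R then
    fun A => (@lebesgue_measure R \x @lebesgueRn m)
               [set p | A (row_mx (p.1%:M : 'rV[R]_1) (p.2 : 'rV[R]_m))]
  else fun A => \d_((0%R : 'rV[R]_0) : borelRn R 0) A.

Definition ediam n (E : set 'rV[R]_n) : \bar R :=
  ereal_sup (0 |` [set (enorm (x - y))%:E | x in E & y in E]).

Definition hausdorff_delta n (s : nat) (delta : R) (A : set 'rV[R]_n) : \bar R :=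
  ereal_inf [set \sum_(k <oo) ediam (E k) ^+ s | E in
    [set E : (set 'rV[R]_n)^nat |
      A `<=` \bigcup_k E k /\ forall k, ediam (E k) <= delta%:E]].

(* Without the customary normalizing constant, which cancels in nu below.
   Meant for s > 0 only, as 0 ^+ 0 = 1. *)
Definition hausdorff n (s : nat) (A : set (borelRn R n)) : \bar R :=
  ereal_sup [set hausdorff_delta s delta A | delta in [set d : R | (0 < d)%R]].


(* normalized restriction to D of the measure with density w w.r.t. m *)
Definition density_prob n (m : set (borelRn R n) -> \bar R) (D : set (borelRn R n))
    (w : 'rV[R]_n -> R) (A : set (borelRn R n)) : \bar R :=
  (\int[m]_(x in A `&` D) (w x)%:E) / (\int[m]_(x in D) (w x)%:E).

Definition mu n (Phi : 'rV[R]_n -> R) : set (borelRn R n) -> \bar R :=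
  density_prob (@lebesgueRn n) setT (fun x => expR (- Phi x)).

Definition nu n (phi : 'rV[R]_n -> R) : set (borelRn R n) -> \bar R :=
  density_prob (hausdorff n.-1) (sphere R n) (fun u => (phi u ^- n)%R).

Definition Var n (m : set (borelRn R n) -> \bar R) (D : set 'rV[R]_n)
    (f : 'rV[R]_n -> R) : \bar R :=
  \int[m]_(x in D) (f x ^+ 2)%:E - (\int[m]_(x in D) (f x)%:E) ^+ 2.

Definition ineqA n (Phi : 'rV[R]_n -> R) (C : R) :=
  forall f : 'rV[R]_n -> R, even f -> Ck 1 setT f ->
    \int[mu Phi]_x (f x ^+ 2)%:E < +oo ->
    Var (mu Phi) setT f <=
      C%:E * \int[mu Phi]_x
        (dot (grad f x *m invmx (hess Phi x)) (grad f x))%:E.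

Definition ineqB n (phi : 'rV[R]_n -> R) (C : R) :=
  forall g : 'rV[R]_n -> R, even_sphere g -> C1_sphere g ->
    Var (nu phi) (sphere R n) g <=
      C%:E * \int[nu phi]_(u in sphere R n)
        (phi u * dot (sgrad g u *m tinv u (D2 phi u)) (sgrad g u))%:E.

End Measures.

(* Main.v *)
Require Import Defs.
From mathcomp Require Import all_boot all_order all_algebra.
From mathcomp Require Import all_classical all_reals all_analysis.
From HB Require Import structures.
From mathcomp Require Import measurable_realfun ring lra zify.
Import Order.TTheory GRing.Theory Num.Theory numFieldNormedType.Exports.
Local Open Scope classical_set_scope.
Local Open Scope ring_scope.
Set Implicit Arguments. Unset Strict Implicit. Unset Printing Implicit Defensive.

(** Every point of [R^n] other than 0 is [t *: theta u] with [t > 0], [u] on the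
    sphere and [theta u = u / phi u], and on this ray [Phi] is [t ^ al / al].  Hence
    under [mu] the coordinates [t] and [u] are independent: [u] has law [nu] and [t]
    has the density [t ^ (n - 1) * exp (- t ^ al / al)] up to a factor
    ([polar_law]).  The integrand of (A) splits accordingly ([energy_polar]): with
    [F t] the restriction of [f] to the sphere of radius [t] of the gauge, it is
      [t ^ (2 - al) / (al - 1) * (dF / dt) ^ 2 + t ^ (- al) * E (F t)],
    where [E] is the integrand of (B).  Two facts are behind this splitting.  By
    Euler's identities the Hessian of [Phi] sends the direction [x] to [al - 1]
    times the gradient of [Phi], so that the inverse form is block diagonal with
    respect to that gradient and to the covectors which vanish on [x]
    ([invhess_decomp]).  And [D2 phi u] is the Hessian of the gauge at [u], that is,
    the Hessian of [Phi] corrected by a rank one term, so that its inverse on the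
    tangent space is the restriction of the inverse Hessian ([D2_gauge],
    [tinv_form]).

    For (1), the inequality (A) is applied to the homogeneous function
    [t ^ q * g u], where [g] has mean 0 and [q = (al - 1) / C].  The moments of the
    radial law satisfy [M (2 q) = (n + 2 q - al) * M (2 q - al)], and (A) becomes
    [(n + 2 q - al) * Var g <= C * (q ^ 2 / (al - 1) * Var g + int E g]), which is
    (B) for [g] since [C * q = al - 1] ([ineqB_of_ineqA]).  The choice of [q] is the
    one which minimizes the resulting constant.  As this function need not be
    continuously differentiable at 0, it is cut off near 0.

    For (2), a one-dimensional inequality on each ray controls the radial
    oscillation: for the radial law,
      [int (k t - k t0) ^ 2 <= 1 / al * int t ^ (2 - al) * (k' t) ^ 2],
    where [t0 ^ al = n] ([poincare_interval]).  It is a weighted Hardy inequality with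
    an explicit primitive, hence valid on every interval around [t0].  The average [g]
    of [f] over the radii is then a function on the sphere, to which (B) applies;
    by the Cauchy-Schwarz inequality for the weights [t ^ al] and [t ^ (- al)],
    the integral of [E g] is at most the [al]-th moment of the radial law, which is
    [n], times the mean of [t ^ (- al) * E (F t)].  Since
    [1 / al = (1 - 1 / al) / (al - 1)], both parts are bounded by
    [max (1 - 1 / al) (n * C_nu)] times the two summands of the integrand of (A)
    ([ray_inequality]).  No differentiation under an improper integral and no spectral
    theory enter if the radii are first restricted to a compact interval, which is
    exhausted at the end by dominated convergence ([ineqA_of_ineqB]).

    The decomposition of [mu] rests on the comparison of two measures on the sphere:
    the Hausdorff measure in the definition of [nu] and the cone measure given by
    Lebesgue measure in [R^n].  Both are invariant under reflections, so that the
    mass of a ball centred on the sphere depends on its radius alone, and a theorem of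
    Christensen says that two such measures are proportional ([measure_uniform],
    [hausdorff_cone]).  That the Hausdorff measure of the sphere is neither zero nor
    infinite, and additive on Borel sets, is proved on the way. *)

(** * Borel sets and Lebesgue measure on R^n *)

Section Borel.
Context {R : realType}.

Lemma measurable_openRn n (U : set 'rV[R]_n) :
  open U -> measurable (U : set (borelRn R n)).
Proof. exact: sub_sigma_algebra. Qed.

Lemma measurable_closedRn n (F : set 'rV[R]_n) :
  closed F -> measurable (F : set (borelRn R n)).
Proof.
move=> cF; rewrite -(setCK F); apply: measurableC.
by apply: measurable_openRn; exact: closed_openC.
Qed.

(** Rational boxes form a countable basis, so that the Borel sets are generated by
    the coordinates. *)
Lemma rational_box n (U : set 'rV[R]_n) x : open U -> U x ->
  exists qk : 'rV[rat]_n * nat,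
    (forall i, `|x 0 i - ratr (qk.1 0 i)| < qk.2.+1%:R^-1) /\
    [set y : 'rV[R]_n | forall i, `|y 0 i - ratr (qk.1 0 i)| < qk.2.+1%:R^-1] `<=` U.
Proof.
move=> oU Ux.
have /nbhs_ballP[e /= e0 eU] : nbhs x U by exact: open_nbhs_nbhs.
have [k ke] : exists k, k.+1%:R^-1 < e / 2.
  have e20 : 0 < e / 2 by rewrite divr_gt0.
  by have [k _ /(_ _ (leqnn _))] := near_infty_natSinv_lt (PosNum e20); exists k.
have k0 : 0 < k.+1%:R^-1 :> R by rewrite invr_gt0.
have qP i : exists q : rat, `|x 0 i - ratr q| < k.+1%:R^-1.
  have /rat_in_itvoo[q] : x 0 i - k.+1%:R^-1 < x 0 i by rewrite ltrBlDr ltrDl.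
  rewrite in_itv/= => /andP[q1 q2]; exists q.
  by move: q1 q2; rewrite ltr_norml; move: (k.+1%:R^-1) (ratr q : R) => c r ? ?; apply/andP; split; lra.
have {}qP i := cid (qP i).
exists (\row_i sval (qP i), k) => /=; split=> [i|y /= yq].
  by rewrite mxE; case: (qP i).
apply: eU; split=> // i j; rewrite ord1 /ball /=.
have := yq j; rewrite mxE; case: (qP j) => q /= xq yq'.
rewrite (_ : x 0 j - y 0 j = (x 0 j - ratr q) - (y 0 j - ratr q)); last by ring.
apply: (le_lt_trans (ler_normB _ _)).
move: ke xq yq'; move: (k.+1%:R^-1) => c ? ? ?; lra.
Qed.

Lemma measurable_fun_toRn d (T : measurableType d) n (D : set T)
    (f : T -> borelRn R n) : measurable D ->
  (forall i, measurable_fun D (fun x => (f x : 'rV[R]_n) 0 i)) ->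
  measurable_fun D f.
Proof.
move=> mD mf; apply: (@measurability _ _ T (borelRn R n) D f (@open 'rV[R]_n)) => // _ [U oU <-].
pose P (qk : 'rV[rat]_n * nat) :=
  [set y : 'rV[R]_n | forall i, `|y 0 i - ratr (qk.1 0 i)| < qk.2.+1%:R^-1].
rewrite (_ : f @^-1` U = \bigcup_(qk in [set qk | P qk `<=` U])
   \bigcap_(i in [set: 'I_n])
     [set x | `|(f x : 'rV[R]_n) 0 i - ratr (qk.1 0 i)| < qk.2.+1%:R^-1]).
  rewrite setI_bigcupr bigcup_mkcond; apply: countable_bigcupT_measurable => //.
  move=> qk; case: ifPn => // _.
  have [->|/set0P[i0 _]] := eqVneq [set: 'I_n] set0.
    by rewrite bigcap_set0 setIT.
  rewrite -bigcapIr; last by exists i0.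
  apply: fin_bigcap_measurable; first exact: finite_finset.
  move=> i _.
  have mg : measurable_fun D (fun x => `|(f x : 'rV[R]_n) 0 i - ratr (qk.1 0 i)|).
    by apply: measurableT_comp => //; apply: measurable_funB.
  rewrite -[X in _ `&` X]/((fun x => `|(f x : 'rV[R]_n) 0 i - ratr (qk.1 0 i)|) @^-1` [set r | r < qk.2.+1%:R^-1]).
  apply: mg => //.
  by rewrite -set_itvNyo.
apply/seteqP; split=> x /=.
  move=> Ux; have [qk [h1 h2]] := rational_box oU Ux.
  by exists qk => // i _ /=.
by move=> [qk /= qkU h]; apply: qkU => i; exact: h.
Qed.

Lemma continuous_measurableRn n (U : set 'rV[R]_n) (f : 'rV[R]_n -> R) :
  open U -> (forall x, U x -> {for x, continuous f}) ->
  measurable_fun (U : set (borelRn R n)) (f : borelRn R n -> R).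
Proof.
move=> oU cf; apply: (measurability _ (RGenOpens.measurableE R)).
move=> _ [_ [a [b ->]] <-]; apply: measurable_openRn.
rewrite openE => x [Ux fx]; apply: filterI; first exact: open_nbhs_nbhs.
by apply: cf => //; apply: open_nbhs_nbhs; split => //; exact: interval_open.
Qed.

Lemma continuousT_measurableRn n (f : 'rV[R]_n -> R) : continuous f ->
  measurable_fun [set: borelRn R n] (f : borelRn R n -> R).
Proof. by move=> cf; apply: (@continuous_measurableRn n [set: 'rV[R]_n]) => [|x _]; [exact: (@openT 'rV[R]_n)|exact: cf]. Qed.

Lemma measurable_coordRn n (i : 'I_n) :
  measurable_fun setT (fun x : borelRn R n => (x : 'rV[R]_n) 0 i).
Proof. by apply: continuousT_measurableRn; exact: (@coord_continuous R 1 n 0 i).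
Qed.

End Borel.

Section Density.
Context d (T : measurableType d) (R : realType).
Local Open Scope ereal_scope.

Lemma measurable_preimageT d' (T' : measurableType d') (f : T -> T') A :
  measurable_fun setT f -> measurable A -> measurable (f @^-1` A).
Proof. by move=> mf mA; rewrite -[X in measurable X]setTI; exact: mf. Qed.

Lemma pushforward_measure d' (T' : measurableType d') (m : {measure set T -> \bar R})
    (f : T -> T') : measurable_fun setT f ->
  exists m' : {measure set T' -> \bar R}, forall A, m' A = m (f @^-1` A).
Proof.
move=> mf.
have h0 : pushforward m f set0 = 0 by rewrite /pushforward preimage_set0 measure0.
pose M : {measure set T' -> \bar R} := [the {measure set T' -> \bar R} of pushforward m f].
by exists (M mf).
Qed.

Lemma sigma_finite_ex (m : {measure set T -> \bar R}) : sigma_finite setT m ->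
  exists m' : {sigma_finite_measure set T -> \bar R},
    (m' : set T -> \bar R) = (m : set T -> \bar R).
Proof.
move=> sm.
pose mx1 := @isSFinite.Build d T R (m : set T -> \bar R) (sfinite_measure_sigma_finite sm).
pose mx2 := @isSigmaFinite.Build d T R (m : set T -> \bar R) sm.
pose M : {sigma_finite_measure set T -> \bar R} := HB.pack (Measure.sort m) mx1 mx2.
by exists M.
Qed.

Lemma density_measure (m : {measure set T -> \bar R}) (w : T -> R) :
  measurable_fun setT w -> (forall x, 0 <= w x)%R ->
  exists m' : {measure set T -> \bar R},
    forall A, m' A = \int[m]_(x in A) (w x)%:E.
Proof.
move=> mw w0.
pose M A := \int[m]_(x in A) (w x)%:E.
have M0 : M set0 = 0 by rewrite /M integral_set0.
have Mge0 A : 0 <= M A by apply: integral_ge0 => x _; rewrite lee_fin.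
have Msa : semi_sigma_additive M.
  move=> F mF tF mUF; rewrite /M.
  rewrite ge0_integral_bigcup//; last 2 first.
  - by apply: measurable_funTS; exact/measurable_EFinP.
  - by move=> x _; rewrite lee_fin.
  by apply: is_cvg_ereal_nneg_natsum_cond => n _ _; apply: integral_ge0 => x _; rewrite lee_fin.
pose mx := isMeasure.Build _ _ _ M M0 Mge0 Msa.
pose M' : {measure set T -> \bar R} := HB.pack M mx.
by exists M'.
Qed.

Import HBNNSimple.

Lemma integral_density_measure (m m' : {measure set T -> \bar R}) (w : T -> R) :
  measurable_fun setT w -> (forall x, 0 <= w x)%R ->
  (forall A, measurable A -> m' A = \int[m]_(x in A) (w x)%:E) ->
  forall D f, measurable D -> measurable_fun D f -> (forall x, D x -> 0 <= f x) ->
  \int[m']_(x in D) f x = \int[m]_(x in D) (f x * (w x)%:E).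
Proof.
move=> mw w0 m'E D f mD mf f0.
pose f_ := nnsfun_approx mD mf.
have mfw n : measurable_fun D (fun x => (f_ n x)%:E * (w x)%:E).
  apply: emeasurable_funM; last by apply: measurable_funTS; exact/measurable_EFinP.
  by apply/measurable_EFinP; exact: measurable_funTS.
transitivity (limn (fun n => \int[m']_(x in D) (f_ n x)%:E)).
  rewrite -monotone_convergence//.
  - by apply: eq_integral => x /[!inE] xD; apply/esym/cvg_lim => //=; exact: cvg_nnsfun_approx.
  - by move=> n; apply/measurable_EFinP; exact: measurable_funTS.
  - by move=> n x _; rewrite lee_fin.
  - by move=> x _ a b ab; rewrite lee_fin; exact/lefP/nd_nnsfun_approx.
rewrite [X in limn X](_ : _ = (fun n => \int[m]_(x in D) ((f_ n x)%:E * (w x)%:E))).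
  rewrite -monotone_convergence//.
  - apply: eq_integral => x /[!inE] xD; apply/cvg_lim => //=.
    by apply: cvgeZr => //; exact: cvg_nnsfun_approx.
  - by move=> n x _; rewrite mule_ge0// lee_fin.
  - move=> x _ a b ab; apply: lee_wpmul2r => //.
      by rewrite lee_fin.
    by rewrite lee_fin; exact/lefP/nd_nnsfun_approx.
apply/funext => n; set g := f_ n.
have mpre r : measurable (g @^-1` [set r]) by [].
under eq_integral do rewrite fimfunE -fsumEFin//.
rewrite ge0_integral_fsum//; last 2 first.
  - by move=> r; apply/measurable_EFinP; apply: measurable_funTS; exact: measurable_funM.
  - by move=> r x _; rewrite EFinM nnfun_muleindic_ge0.
under [RHS]eq_integral => x _.
  rewrite fimfunE -fsumEFin// ge0_mule_fsuml; last first.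
    by move=> r; rewrite EFinM nnfun_muleindic_ge0.
  over.
have mi r : measurable_fun D (fun x => (r * \1_(g @^-1` [set r]) x)%:E).
  by apply/measurable_EFinP; apply: measurable_funTS; exact: measurable_funM.
rewrite [RHS]ge0_integral_fsum//; last 2 first.
  - by move=> r; apply: emeasurable_funM => //; apply: measurable_funTS; exact/measurable_EFinP.
  - move=> r x _; apply: mule_ge0; last by rewrite lee_fin.
    by rewrite EFinM nnfun_muleindic_ge0.
apply: eq_fsbigr => r _; rewrite integralZl_indic_nnsfun// integral_indic//.
have [r0|r0] := ltP r 0%R.
  rewrite preimage_nnfun0// set0I measure0 mule0.
  by rewrite integral0_eq// => x _; rewrite indic0 mulr0 mul0e.
rewrite m'E; last exact: measurableI.
rewrite setIC integral_mkcondr.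
under [RHS]eq_integral do rewrite EFinM -muleA.
rewrite [RHS]ge0_integralZl//; last 2 first.
  - apply: emeasurable_funM; last by apply: measurable_funTS; exact/measurable_EFinP.
    by apply/measurable_EFinP; apply: measurable_funTS.
  - by move=> x _; rewrite mule_ge0// lee_fin.
congr (_ * _); apply: eq_integral => x _.
by rewrite patchE indicE; case: ifPn => _; rewrite ?mul1e ?mul0e.
Qed.

End Density.

Section Lebesgue.
Context {R : realType}.
Local Notation lambda := (@lebesgue_measure R).

(** The identification of [R * R^n] with [R^n.+1] through which Lebesgue measure is
    defined by recursion. *)
Definition cons_row n (p : R * borelRn R n) : borelRn R n.+1 :=
  row_mx (p.1%:M : 'rV[R]_1) (p.2 : 'rV[R]_n).

Lemma cons_rowEl n (p : R * borelRn R n) : (cons_row p : 'rV[R]_n.+1) 0 ord0 = p.1.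
Proof.
rewrite /cons_row (_ : ord0 = lshift n (ord0 : 'I_1)); last exact/val_inj.
by rewrite [LHS]row_mxEl mxE eqxx mulr1n.
Qed.

Lemma cons_rowEr n (p : R * borelRn R n) i :
  (cons_row p : 'rV[R]_n.+1) 0 (lift ord0 i) = (p.2 : 'rV[R]_n) 0 i.
Proof.
rewrite /cons_row (_ : lift ord0 i = rshift 1 i); last exact/val_inj.
by rewrite [LHS]row_mxEr.
Qed.

Lemma measurable_cons_row n : measurable_fun setT (@cons_row n).
Proof.
apply: measurable_fun_toRn => // i; case: (unliftP ord0 i) => [j|] ->.
  under eq_fun do rewrite cons_rowEr.
  exact: (@measurableT_comp _ _ _ _ _ _ (fun y : borelRn R n => (y : 'rV[R]_n) 0 j) _ snd (measurable_coordRn j)).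
under eq_fun do rewrite cons_rowEl.
exact: measurable_fst.
Qed.

Definition box n (k : R) : set (borelRn R n) :=
  [set x | forall i, `|(x : 'rV[R]_n) 0 i| <= k].
Arguments box : clear implicits.

Lemma measurable_box n k : measurable (box n k).
Proof.
rewrite (_ : box n k = \bigcap_(i in [set: 'I_n]) [set x | `|(x : 'rV[R]_n) 0 i| <= k]); last first.
  by apply/seteqP; split=> x /= h; [move=> i _; exact: h|move=> i; exact: h].
apply: fin_bigcap_measurable; first exact: finite_finset.
move=> i _; rewrite -[X in measurable X]setTI.
rewrite -[X in _ `&` X]/((fun x : borelRn R n => `|(x : 'rV[R]_n) 0 i|) @^-1` [set r | r <= k]).
apply: measurableT_comp => //; last by rewrite -set_itvNyc.
exact: measurable_coordRn.
Qed.

Lemma preimage_cons_row_box n k :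
  @cons_row n @^-1` box n.+1 k = `[- k, k]%classic `*` box n k.
Proof.
apply/seteqP; split=> -[a y] /= h.
  split=> [|i] /=; first by have := h ord0; rewrite cons_rowEl in_itv/= ler_norml.
  by have := h (lift ord0 i); rewrite cons_rowEr.
move: h => [/=]; rewrite in_itv/= -ler_norml => ak yk i.
by case: (unliftP ord0 i) => [j|] ->; rewrite ?cons_rowEr ?cons_rowEl.
Qed.

Lemma box_sigma_finite n (m : {measure set (borelRn R n) -> \bar R}) :
  (forall k, m (box n k) < +oo)%E -> sigma_finite setT m.
Proof.
move=> mb; exists (fun k => box n k%:R); last first.
  by move=> k; split => //; exact: measurable_box.
apply/seteqP; split=> // x _.
pose K := \sum_i `|(x : 'rV[R]_n) 0 i|.
have [k Kk] : exists k : nat, K < k%:R by exists (Num.bound K); apply: archi_boundP; exact: sumr_ge0.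
exists k => // i; apply: (le_trans _ (ltW Kk)).
by rewrite /K (bigD1 i)//= lerDl sumr_ge0.
Qed.

(** A product of measures is well behaved only for sigma-finite factors, hence the
    induction on [n] carries the finite mass of boxes along. *)
Lemma lebesgueRn_ex n : exists2 m : {sigma_finite_measure set (borelRn R n) -> \bar R},
  (m : set (borelRn R n) -> \bar R) = @lebesgueRn R n & forall k, (m (box n k) < +oo)%E.
Proof.
elim: n => [|n [m mE mb]].
  exists [the {sigma_finite_measure set (borelRn R 0) -> \bar R} of \d_((0%R : 'rV[R]_0) : borelRn R 0)] => //.
  by move=> k /=; rewrite diracE ltry.
have [m' m'E] := pushforward_measure [the {measure set _ -> \bar R} of (lambda \x m)%E] (@measurable_cons_row n).
have m'b k : (m' (box n.+1 k) < +oo)%E.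
  rewrite m'E preimage_cons_row_box/= product_measure1E//; last exact: measurable_box.
  rewrite -[X in (X * _)%E]/(lambda `[- k, k]%classic).
  rewrite lebesgue_measure_itv/=; case: ifP => kk; rewrite ?mul0e// lte_mul_pinfty//.
  by move: kk; rewrite lte_fin -EFinB lee_fin subr_ge0 => /ltW.
have [M ME] := sigma_finite_ex (box_sigma_finite m'b).
exists M; last by move=> k; rewrite ME.
by rewrite ME; apply/funext => A; rewrite m'E/= mE.
Qed.

Definition leb n : {sigma_finite_measure set (borelRn R n) -> \bar R} :=
  projT1 (cid2 (lebesgueRn_ex n)).

Lemma lebE n : (leb n : set (borelRn R n) -> \bar R) = @lebesgueRn R n.
Proof. by rewrite /leb; case: cid2. Qed.

Lemma leb_box n k : (leb n (box n k) < +oo)%E.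
Proof. by rewrite /leb; case: cid2. Qed.

Lemma leb_cons n (A : set (borelRn R n.+1)) :
  leb n.+1 A = (\int[lambda]_a leb n [set y | A (cons_row (a, y))])%E.
Proof.
rewrite !lebE/= /product_measure1; apply: eq_integral => a _ /=.
by congr lebesgueRn; apply/seteqP; split=> y; rewrite /xsection/= inE.
Qed.

Lemma leb_consX n (A : set R) (B : set (borelRn R n)) : measurable A -> measurable B ->
  leb n.+1 [set x | A ((x : 'rV[R]_n.+1) 0 ord0) /\ B (\row_j (x : 'rV[R]_n.+1) 0 (lift ord0 j))]
  = (lambda A * leb n B)%E.
Proof.
move=> mA mB; rewrite -(product_measure1E lambda (leb n) mA mB) leb_cons /product_measure1.
apply: eq_integral => a _ /=; congr (leb n _); apply/seteqP; split=> y; rewrite /xsection/= !inE/= cons_rowEl.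
  by move=> [Aa]; rewrite (_ : \row_j _ = y)//; apply/rowP => j; rewrite mxE cons_rowEr.
by move=> [Aa By]; split => //; rewrite (_ : \row_j _ = y)//; apply/rowP => j; rewrite mxE cons_rowEr.
Qed.

Lemma integral_lebesgue_affine (r b : R) (f : R -> \bar R) : 0 < r ->
  measurable_fun setT f -> (forall x, 0 <= f x)%E ->
  (\int[lambda]_x f (r * x + b)%R = (r^-1)%:E * \int[lambda]_x f x)%E.
Proof.
move=> r0 mf f0.
pose g (x : measurableTypeR R) : measurableTypeR R := r * x + b.
have mg : measurable_fun setT g.
  by apply: measurable_funD => //; exact: mulrl_measurable.
have [m mE] := pushforward_measure lambda mg.
have r0' : 0 <= r by exact: ltW.
have lE A : measurable A -> lambda A = mscale (NngNum r0') m A.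
  apply: (@lebesgue_measure_unique R (mscale (NngNum r0') m)) => _ [[x y] _ <-] /=.
  rewrite /mscale/= mE (_ : _ @^-1` _ = `](x - b) / r, (y - b) / r]%classic).
    rewrite [in LHS]lebesgue_measure_itv/= [in RHS]lebesgue_measure_itv/= !lte_fin ltr_pM2r ?invr_gt0// ltrD2r.
    case: ifP => _; rewrite ?mule0// -!EFinB -EFinM; congr EFin; field.
    by rewrite gt_eqF.
  apply/seteqP; split=> z; rewrite /= !in_itv/= ltr_pdivrMr// ler_pdivlMr// /g;
    by rewrite ltrBlDr lerBrDr mulrC.
rewrite [in RHS](eq_measure_integral (mscale (NngNum r0') m)); last first.
  by move=> A mA _; apply: lE.
rewrite ge0_integral_mscale//= muleA -EFinM mulVf ?gt_eqF// mul1e.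
transitivity (\int[pushforward lambda g]_x f x)%E.
  by rewrite ge0_integral_pushforward// preimage_setT.
by apply: eq_measure_integral => A mA _; rewrite mE.
Qed.

Lemma measurable_affine n r v :
  measurable_fun setT (fun x : borelRn R n => (r *: (x : 'rV[R]_n) + v) : borelRn R n).
Proof.
apply: measurable_fun_toRn => // i; under eq_fun do rewrite !mxE.
apply: measurable_funD => //; apply: measurable_funM => //.
exact: measurable_coordRn.
Qed.

(** By induction on the dimension, from the change of variables on the line and
    Tonelli's theorem. *)
Lemma leb_affine n (r : R) (v : 'rV[R]_n) (A : set (borelRn R n)) : 0 < r -> measurable A ->
  leb n [set x | A (r *: (x : 'rV[R]_n) + v)] = ((r ^- n)%:E * leb n A)%E.
Proof.
move=> r0; elim: n => [|n IH] in v A *.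
  move=> mA; rewrite expr0 invr1 mul1e; congr (leb 0 _).
  by apply/seteqP; split=> x /=; rewrite [_ + _](thinmx0 _) [x](thinmx0 _).
move=> mA.
have mAa a : measurable [set y | A (cons_row (a, y))].
  have := measurable_xsection a (measurable_preimageT (@measurable_cons_row n) mA).
  congr measurable; apply/seteqP.
  by split=> y; rewrite /xsection/= inE.
rewrite !leb_cons.
pose F a := leb n [set y | A (cons_row (a, y))].
have mF : measurable_fun setT F.
  have := measurable_fun_xsection (leb n) (measurable_preimageT (@measurable_cons_row n) mA).
  congr measurable_fun; apply/funext => a /=; rewrite /F.
  by congr (leb n _); apply/seteqP; split=> y; rewrite /xsection/= inE.
transitivity (\int[lambda]_a ((r ^- n)%:E * F (r * a + v 0 ord0)%R))%E.
  apply: eq_integral => a _.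
  pose v' := \row_j v 0 (lift ord0 j).
  rewrite -(IH v')//; congr (leb n _); apply/seteqP.
  have E (y : 'rV[R]_n) : r *: (cons_row (a, y) : 'rV[R]_n.+1) + v =
      cons_row (r * a + v 0 ord0, r *: y + v').
    apply/rowP => i; case: (unliftP ord0 i) => [j|] ->.
      by rewrite cons_rowEr 2!mxE cons_rowEr !mxE.
    by rewrite cons_rowEl 2!mxE cons_rowEl.
  by split=> y /=; rewrite E.
rewrite ge0_integralZl//; last 2 first.
- apply: (@measurableT_comp _ _ _ _ _ _ F _ (fun x : R => r * x + v 0 ord0)) => //.
  by apply: measurable_funD => //; exact: mulrl_measurable.
- by rewrite lee_fin invr_ge0 exprn_ge0// ltW.
rewrite integral_lebesgue_affine// muleA -EFinM; congr (_%:E * _)%E.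
by rewrite exprS invfM mulrC.
Qed.

End Lebesgue.
Arguments box {R} n k _.

(** * The Euclidean norm and reflections *)

Section EuclideanNorm.
Context {R : realType} {n : nat}.
Implicit Types x y u v w : 'rV[R]_n.

Lemma dotC x y : dot x y = dot y x.
Proof. by apply: eq_bigr => i _; rewrite mulrC. Qed.

Lemma dotDl x y u : dot (x + y) u = dot x u + dot y u.
Proof. by rewrite /dot -big_split/=; apply: eq_bigr => i _; rewrite mxE mulrDl. Qed.

Lemma dotZl k x u : dot (k *: x) u = k * dot x u.
Proof. by rewrite /dot mulr_sumr; apply: eq_bigr => i _; rewrite mxE mulrA. Qed.

Lemma dotNl x u : dot (- x) u = - dot x u.
Proof. by rewrite -scaleN1r dotZl mulN1r. Qed.

Lemma dotBl x y u : dot (x - y) u = dot x u - dot y u.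
Proof. by rewrite dotDl dotNl. Qed.

Lemma dotDr x y u : dot u (x + y) = dot u x + dot u y.
Proof. by rewrite dotC dotDl ![dot _ u]dotC. Qed.

Lemma dotZr k x u : dot u (k *: x) = k * dot u x.
Proof. by rewrite dotC dotZl dotC. Qed.

Lemma dotNr x u : dot u (- x) = - dot u x.
Proof. by rewrite dotC dotNl dotC. Qed.

Lemma dotBr x y u : dot u (x - y) = dot u x - dot u y.
Proof. by rewrite dotDr dotNr. Qed.

Lemma dot_ge0 x : 0 <= dot x x.
Proof. by apply: sumr_ge0 => i _; rewrite -expr2 sqr_ge0. Qed.

Lemma dot_eq0 x : (dot x x == 0) = (x == 0).
Proof.
apply/idP/eqP => [|->]; last first.
  by rewrite /dot big1// => i _; rewrite mxE mul0r.
rewrite psumr_eq0; last by move=> i _; rewrite -expr2 sqr_ge0.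
move=> /allP h; apply/rowP => i; rewrite mxE.
by have := h i (mem_index_enum _); rewrite /= mulf_eq0 orbb => /eqP.
Qed.

Lemma enorm_ge0 x : 0 <= enorm x.
Proof. exact: sqrtr_ge0. Qed.

Lemma enorm_sqr x : enorm x ^+ 2 = dot x x.
Proof. by rewrite sqr_sqrtr// dot_ge0. Qed.

Lemma enorm_eq0 x : (enorm x == 0) = (x == 0).
Proof. by rewrite -sqrf_eq0 enorm_sqr dot_eq0. Qed.

Lemma enorm_gt0 x : (0 < enorm x) = (x != 0).
Proof. by rewrite lt_def enorm_eq0 enorm_ge0 andbT. Qed.

Lemma enorm0 : enorm (0 : 'rV[R]_n) = 0.
Proof. by apply/eqP; rewrite enorm_eq0. Qed.

Lemma enormZ k x : enorm (k *: x) = `|k| * enorm x.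
Proof.
by rewrite /enorm dotZl dotZr mulrA -expr2 sqrtrM ?sqr_ge0// sqrtr_sqr.
Qed.

Lemma enormN x : enorm (- x) = enorm x.
Proof. by rewrite -scaleN1r enormZ normrN1 mul1r. Qed.

Lemma enormBC x y : enorm (x - y) = enorm (y - x).
Proof. by rewrite -enormN opprB. Qed.

Lemma dot_le_enorm x y : dot x y <= enorm x * enorm y.
Proof.
have [->|y0] := eqVneq y 0.
  by rewrite enorm0 mulr0 -(scale0r 0) dotZr mul0r.
have [->|x0] := eqVneq x 0.
  by rewrite enorm0 mul0r -(scale0r 0) dotZl mul0r.
have a0 : 0 < enorm x by rewrite enorm_gt0.
have b0 : 0 < enorm y by rewrite enorm_gt0.
have := dot_ge0 (enorm y *: x - enorm x *: y).
rewrite dotBl !dotBr !dotZl !dotZr -!enorm_sqr (dotC y x).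
set a := enorm x in a0 *; set b := enorm y in b0 *; set c := dot x y => h.
have h2 : 0 <= (a * b) * (a * b - c) by nra.
by move: h2; rewrite pmulr_rge0 ?mulr_gt0// subr_ge0.
Qed.

Lemma enormD x y : enorm (x + y) <= enorm x + enorm y.
Proof.
rewrite -ler_sqr ?nnegrE ?addr_ge0 ?enorm_ge0// enorm_sqr dotDl !dotDr (dotC y x).
rewrite -!enorm_sqr sqrrD; have := dot_le_enorm x y; lra.
Qed.

Lemma ler_enormB x y : enorm x <= enorm y + enorm (x - y).
Proof. by apply: le_trans (enormD _ _); rewrite addrC subrK. Qed.

Lemma coord_le_enorm x i : `|x 0 i| <= enorm x.
Proof.
rewrite -ler_sqr ?nnegrE ?enorm_ge0// enorm_sqr real_normK ?num_real//.
rewrite /dot (bigD1 i)//= expr2 lerDl; apply: sumr_ge0 => j _.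
by rewrite -expr2 sqr_ge0.
Qed.

Lemma enorm_le_coord x (k : R) : (forall i, `|x 0 i| <= k) -> enorm x <= n%:R * k.
Proof.
move=> xk.
have [n0|n0] := posnP n.
  have -> : x = 0 by apply/rowP => i; have := ltn_ord i; rewrite [X in (_ < X)%N]n0.
  by rewrite enorm0 [X in X%:R]n0 mul0r.
have k0 : 0 <= k by apply: le_trans (xk (Ordinal n0)).
rewrite -ler_sqr ?nnegrE ?enorm_ge0 ?mulr_ge0// enorm_sqr.
apply: (@le_trans _ _ (\sum_(i < n) k ^+ 2)).
  apply: ler_sum => i _; rewrite -expr2 -real_normK ?num_real//.
  by rewrite ler_sqr ?nnegrE//; exact: xk.
rewrite sumr_const card_ord -[leLHS]mulr_natl exprMn; apply: ler_wpM2r; first exact: sqr_ge0.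
by rewrite expr2 ler_peMr// ler1n.
Qed.

Lemma continuous_dot (T : topologicalType) (f g : T -> 'rV[R]_n) t :
  {for t, continuous f} -> {for t, continuous g} ->
  {for t, continuous (fun s => dot (f s) (g s))}.
Proof.
move=> cf cg; rewrite /dot.
apply: cvg_big => [|i _]; first exact: add_continuous.
apply: cvgM.
  by apply: (cvg_comp f (fun x : 'rV[R]_n => x 0 i)); [exact: cf|exact: coord_continuous].
by apply: (cvg_comp g (fun x : 'rV[R]_n => x 0 i)); [exact: cg|exact: coord_continuous].
Qed.

Lemma continuous_enorm : continuous (@enorm R n).
Proof.
move=> x; apply: (cvg_comp (fun x => dot x x) Num.sqrt); last exact: sqrt_continuous.
by apply: (@continuous_dot 'rV[R]_n id id); apply: cvg_id.
Qed.

Definition eball x r : set (borelRn R n) := [set y | enorm (x - (y : 'rV[R]_n)) < r].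

Lemma open_eball x r : open (eball x r : set 'rV[R]_n).
Proof.
rewrite -[eball x r]/((fun y : 'rV[R]_n => enorm (x - y)) @^-1` [set t | t < r]).
apply: open_comp => [y _|]; last exact: open_lt.
apply: (@continuous_comp _ _ _ (fun y => x - y) (@enorm R n)); last exact: continuous_enorm.
by apply: continuousB; [exact: cst_continuous|exact: cvg_id].
Qed.

Lemma measurable_eball x r : measurable (eball x r).
Proof. by apply: measurable_openRn; exact: open_eball. Qed.

Lemma measurable_enorm : measurable_fun setT (@enorm R n : borelRn R n -> R).
Proof. by apply: continuousT_measurableRn; exact: continuous_enorm. Qed.

Lemma open_eballP (U : set 'rV[R]_n) x : open U -> U x ->
  exists k, eball x (k.+1%:R^-1) `<=` U.
Proof.
move=> oU Ux; have /nbhs_ballP[e /= e0 eU] : nbhs x U by exact: open_nbhs_nbhs.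
have [k _ /(_ _ (leqnn _)) ke] := near_infty_natSinv_lt (PosNum e0).
exists k => y /= xy; apply: eU; split => // i j.
rewrite ord1 /ball /=; apply: le_lt_trans (lt_trans xy ke).
by apply: le_trans (coord_le_enorm (x - y) j); rewrite !mxE.
Qed.

(** The Householder reflection in the hyperplane orthogonal to [w]. *)
Definition reflect_row w x : 'rV[R]_n := x - (2 * dot x w / dot w w) *: w.

Lemma reflectB w x y : reflect_row w (x - y) = reflect_row w x - reflect_row w y.
Proof.
by rewrite /reflect_row dotBl mulrBr mulrBl scalerBl; apply/rowP => i; rewrite !mxE; ring.
Qed.

Lemma reflectZ w k x : reflect_row w (k *: x) = k *: reflect_row w x.
Proof. by rewrite /reflect_row dotZl scalerBr scalerA; congr (_ - _ *: _); ring. Qed.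

Lemma dot_reflect w x : w != 0 -> dot (reflect_row w x) (reflect_row w x) = dot x x.
Proof.
rewrite -dot_eq0 => w0; rewrite /reflect_row !(dotBl, dotBr, dotZl, dotZr) (dotC w x).
by field.
Qed.

Lemma enorm_reflect w x : w != 0 -> enorm (reflect_row w x) = enorm x.
Proof. by move=> w0; rewrite /enorm dot_reflect. Qed.

Lemma reflectK w : w != 0 -> involutive (reflect_row w).
Proof.
rewrite -dot_eq0 => w0 x; rewrite /reflect_row dotBl dotZl -addrA -opprD -scalerDl.
rewrite [X in X *: _](_ : _ = 0) ?scale0r ?subr0//.
by field.
Qed.

(** Reflections act transitively on each sphere, hence they suffice to compare balls
    with different centres. *)
Lemma reflect_swap u v : enorm u = enorm v -> u != v -> reflect_row (u - v) u = v.
Proof.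
rewrite /reflect_row => uv; rewrite -subr_eq0 -dot_eq0 => uv0.
have E : dot u u = dot v v by rewrite -!enorm_sqr uv.
have -> : 2 * dot u (u - v) = dot (u - v) (u - v).
  by rewrite !(dotBl, dotBr) (dotC v u) E; ring.
by rewrite divff// scale1r opprB addrCA subrr addr0.
Qed.

Lemma measurable_reflect w :
  measurable_fun setT (reflect_row w : borelRn R n -> borelRn R n).
Proof.
apply: measurable_fun_toRn => // i; under eq_fun do rewrite !mxE.
apply: measurable_funB; first exact: measurable_coordRn.
apply: measurable_funM => //; apply: measurable_funM => //; apply: measurable_funM => //.
rewrite /dot; apply: measurable_sum => j; apply: measurable_funM => //.
exact: measurable_coordRn.
Qed.

Lemma preimage_reflect_eball w x r : w != 0 ->
  reflect_row w @^-1` eball x r = eball (reflect_row w x) r.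
Proof.
move=> w0; apply/seteqP; split=> y; rewrite /eball/= -(enorm_reflect _ w0) reflectB reflectK//.
Qed.

End EuclideanNorm.

(** * Measures for which the mass of a ball depends on its radius alone *)

Section Inner.
Context {R : realType} {n : nat}.
Variables (D : set (borelRn R n)) (mD : measurable D).
Local Open Scope ereal_scope.

(** Open sets are exhausted by these sets as [r] decreases to 0; unlike [D `&` U]
    they contain only points whose whole [r]-ball lies in [U]. *)
Definition inner (U : set (borelRn R n)) (r : R) : set (borelRn R n) :=
  D `&` [set x | eball (x : 'rV[R]_n) r `<=` U].

Lemma measurable_inner U r : measurable (inner U r).
Proof.
apply: measurableI => //; apply: measurable_closedRn.
rewrite -(setCK [set x | _]); apply: open_closedC.
rewrite (_ : ~` [set x | _] = \bigcup_(y in ~` U) eball y r); last first.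
  apply/seteqP; split=> x /=.
    by move=> /existsNP[y /not_implyP[xy Uy]]; exists y => //; rewrite /eball/= enormBC.
  by move=> [y Uy xy] h; apply: Uy; apply: h; rewrite /eball/= enormBC.
by apply: bigcup_open => y _; exact: open_eball.
Qed.

Lemma measure_conull (m : {measure set (borelRn R n) -> \bar R}) A : m (~` D) = 0 ->
  measurable A -> m (D `&` A) = m A.
Proof.
move=> mD0 mA.
have N : m (A `\` D) = 0.
  apply: (@subset_measure0 _ _ _ m _ (~` D)) => //; first exact: measurableD.
  exact: measurableC.
transitivity (m (A `\` D) + m (A `&` D)); last exact/esym/measureDI.
by rewrite N add0e setIC.
Qed.

Lemma inner_cvg (m : {measure set (borelRn R n) -> \bar R}) (U : set 'rV[R]_n) :
  m (~` D) = 0 -> open U -> m (inner U (k.+1%:R^-1)%R) @[k --> \oo] --> m U.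
Proof.
move=> mD0 oU; have mU : measurable (U : set (borelRn R n)) by exact: measurable_openRn.
rewrite -(measure_conull mD0 mU).
rewrite (_ : D `&` U = \bigcup_k (inner U (k.+1%:R^-1)%R)); last first.
  apply/seteqP; split=> x /=.
    by move=> [Dx Ux]; have [k kU] := open_eballP oU Ux; exists k.
  move=> [k _ [Dx kU]]; split => //; apply: kU; rewrite /eball/= subrr enorm0.
  by rewrite invr_gt0.
apply: (@nondecreasing_cvg_mu _ _ _ m (fun k => inner U (k.+1%:R^-1)%R)) => //; first by move=> k; exact: measurable_inner.
  by apply: bigcupT_measurable => k; exact: measurable_inner.
apply/nondecreasing_seqP => k; apply/subsetPset => x [Dx kU]; split => //.
move=> y xy; apply: kU; rewrite /eball/=; apply: (lt_le_trans xy).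
by rewrite lef_pV2 ?posrE// ler_nat.
Qed.

Lemma inner_le (m : {measure set (borelRn R n) -> \bar R}) (U : set 'rV[R]_n) (r : R) : (0 < r)%R ->
  open U -> m (inner U r) <= m U.
Proof.
move=> r0 oU; apply: le_measure; rewrite ?inE; [exact: measurable_inner|exact: measurable_openRn|].
by move=> x [_]; apply; rewrite /eball/= subrr enorm0.
Qed.

End Inner.

Section Uniform.
Context {R : realType} {n : nat}.
Variables (m1 m2 : {sigma_finite_measure set (borelRn R n) -> \bar R}).
Variables (D : set (borelRn R n)) (h1 h2 : R -> R).
Hypotheses (mD : measurable D) (D1 : m1 (~` D) = 0%E) (D2 : m2 (~` D) = 0%E).
Hypothesis hB1 : forall x (r : R), D x -> 0 < r -> m1 (eball x r) = (h1 r)%:E.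
Hypothesis hB2 : forall x (r : R), D x -> 0 < r -> m2 (eball x r) = (h2 r)%:E.
Hypotheses (h1_gt0 : forall r : R, 0 < r -> 0 < h1 r) (h2_gt0 : forall r : R, 0 < r -> 0 < h2 r).
Local Open Scope ereal_scope.

(** Both sides compare the mass of the pairs [(x, y)] with [x] in [inner D U r], [y]
    in [D] and [|x - y| < r]: for fixed [x] all such [y] fill a ball, which lies in [U];
    for fixed [y] the [x] lie in a ball around [y]. *)
Lemma measure_inner_le U (r : R) : measurable U -> (0 < r)%R ->
  (h2 r)%:E * m1 (inner D U r) <= (h1 r)%:E * m2 U.
Proof.
move=> mU r0.
pose E : set (borelRn R n * borelRn R n) :=
  [set p | [/\ inner D U r p.1, D p.2 & enorm ((p.1 : 'rV[R]_n) - (p.2 : 'rV[R]_n)) < r]%R].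
have mE : measurable E.
  rewrite (_ : E = (inner D U r `*` D) `&` [set p | enorm ((p.1 : 'rV[R]_n) - (p.2 : 'rV[R]_n)) < r]%R); last first.
    by apply/seteqP; split=> p; [case=> ? ? ?; split|case=> -[? ?] ?; split].
  apply: measurableI; first by apply: measurableX => //; exact: (measurable_inner mD).
  rewrite -[X in measurable X]setTI.
  rewrite -[X in _ `&` X]/((fun p : borelRn R n * borelRn R n => enorm ((p.1 : 'rV[R]_n) - (p.2 : 'rV[R]_n))) @^-1` [set t | t < r]%R).
  have mf : measurable_fun setT (fun p : borelRn R n * borelRn R n => enorm ((p.1 : 'rV[R]_n) - (p.2 : 'rV[R]_n))).
    apply: (@measurableT_comp _ _ _ _ _ _ (@enorm R n : borelRn R n -> R) _ (fun p : borelRn R n * borelRn R n => (p.1 : 'rV[R]_n) - (p.2 : 'rV[R]_n) : borelRn R n)%R).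
      exact: measurable_enorm.
    apply: measurable_fun_toRn => // i; under eq_fun do rewrite !mxE.
    by apply: measurable_funB;
      apply: (@measurableT_comp _ _ _ _ _ _ (fun y : borelRn R n => (y : 'rV[R]_n) 0 i)%R) => //; exact: measurable_coordRn.
  by apply: mf => //; rewrite -set_itvNyo.
have F := @fubini_tonelli _ _ _ _ _ m1 m2 (fun p => (\1_E p)%:E).
have mE1 : measurable_fun setT (fun p => (\1_E p)%:E : \bar R) by apply/measurable_EFinP.
have {F} := F mE1 (fun p => ltac:(by rewrite lee_fin)).
rewrite (_ : \int[m1]_x _ = (h2 r)%:E * m1 (inner D U r)); last first.
  transitivity (\int[m1]_x ((h2 r)%:E * (\1_(inner D U r) x)%:E)).
    apply: eq_integral => x _; rewrite [in RHS]indicE; case: (boolP (x \in inner D U r)) => [/set_mem Ix|/negP Ix].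
      rewrite mule1 -(hB2 (proj1 Ix) r0) -(measure_conull mD D2 (measurable_eball x r)).
      rewrite -[X in _ = m2 X]setIT -(integral_indic _ measurableT); last first.
        by apply: measurableI => //; exact: measurable_eball.
      apply: eq_integral => y _; rewrite !indicE; congr (_ %:R%:E); congr nat_of_bool.
      by apply/idP/idP => /set_mem h; apply/mem_set; [case: h|case: h].
    rewrite mule0 integral0_eq// => y _; rewrite indicE memNset// => -[/= h _ _].
    by apply: Ix; apply/mem_set.
  rewrite ge0_integralZl//; last 2 first.
  - by apply/measurable_EFinP; apply: measurable_indic; exact: (measurable_inner mD).
  - by rewrite lee_fin ltW// h2_gt0.
  by rewrite integral_indic ?setIT//; exact: (measurable_inner mD).
move=> ->.
have -> : (h1 r)%:E * m2 U = \int[m2]_y ((h1 r)%:E * (\1_U y)%:E).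
  rewrite ge0_integralZl//; last 2 first.
  - by apply/measurable_EFinP.
  - by rewrite lee_fin ltW// h1_gt0.
  by rewrite integral_indic// setIT.
apply: ge0_le_integral => //.
- by move=> y _; apply: integral_ge0 => x _; rewrite lee_fin.
- by apply: (measurable_fun_fubini_tonelli_G (m1 := m1) (fun p => (\1_E p)%:E)) => // p; rewrite lee_fin.
- by apply: emeasurable_funM => //; apply/measurable_EFinP.
move=> y _.
have [Dy|Dy] := pselect (D y); last first.
  rewrite integral0_eq.
    by rewrite mule_ge0// ?lee_fin// ltW// h1_gt0.
  by move=> x _; rewrite indicE memNset// => -[_ /= ? _].
have [Uy|Uy] := pselect (U y); last first.
  rewrite integral0_eq.
    by rewrite mule_ge0// ?lee_fin// ltW// h1_gt0.
  by move=> x _; rewrite indicE memNset// => -[[_ /= h] _ xy]; apply: Uy; exact: h.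
rewrite [\1_U y]indicE mem_set// mule1 -(hB1 Dy r0) -[X in _ <= m1 X]setIT.
rewrite -[leRHS](integral_indic _ measurableT); last exact: measurable_eball.
apply: ge0_le_integral => //.
- by apply/measurable_EFinP; apply: measurableT_comp.
- by apply/measurable_EFinP; apply: measurable_indic; exact: measurable_eball.
move=> x _; rewrite lee_fin !indicE ler_nat.
case: (boolP ((x, y) \in E)) => // /set_mem[_ _ /= xy].
by rewrite mem_set// /eball/= enormBC.
Qed.

End Uniform.

Section Uniform2.
Context {R : realType} {n : nat}.
Variables (m1 m2 : {sigma_finite_measure set (borelRn R n) -> \bar R}).
Variables (D : set (borelRn R n)) (h1 h2 : R -> R).
Hypotheses (mD : measurable D) (D1 : m1 (~` D) = 0%E) (D2 : m2 (~` D) = 0%E).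
Hypothesis hB1 : forall x (r : R), D x -> 0 < r -> m1 (eball x r) = (h1 r)%:E.
Hypothesis hB2 : forall x (r : R), D x -> 0 < r -> m2 (eball x r) = (h2 r)%:E.
Hypotheses (h1_gt0 : forall r : R, 0 < r -> 0 < h1 r) (h2_gt0 : forall r : R, 0 < r -> 0 < h2 r).
Local Open Scope ereal_scope.

(** Apply [measure_inner_le] to [U] and, with the measures exchanged, to [V]: the
    masses of the balls cancel in the product of the two inequalities. *)
Lemma measure_ratio_open (U V : set 'rV[R]_n) : open U -> open V ->
  m1 U < +oo -> m2 U < +oo -> m1 V < +oo -> m2 V < +oo ->
  m1 U * m2 V = m1 V * m2 U.
Proof.
move=> oU oV U1 U2 V1 V2.
wlog suff main : U V oU oV U1 U2 V1 V2 / m1 U * m2 V <= m1 V * m2 U.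
  by apply/eqP; rewrite eq_le !main.
have fU1 : m1 U \is a fin_num by rewrite ge0_fin_numE.
have fV2 : m2 V \is a fin_num by rewrite ge0_fin_numE.
have lim : m1 (inner D U (k.+1%:R^-1)%R) * m2 (inner D V (k.+1%:R^-1)%R) @[k --> \oo] --> m1 U * m2 V.
  by apply: cvgeM; [exact: mule_def_fin|exact: (inner_cvg mD)|exact: (inner_cvg mD)].
rewrite -(cvg_lim _ lim)//; apply: lime_le; first by apply/cvg_ex; eexists; exact: lim.
near=> k; set r := (k.+1%:R^-1)%R.
have r0 : (0 < r)%R by rewrite invr_gt0.
have mU : measurable (U : set (borelRn R n)) by exact: measurable_openRn.
have mV : measurable (V : set (borelRn R n)) by exact: measurable_openRn.
have [A B] := (measure_inner_le mD D2 hB1 hB2 h1_gt0 h2_gt0 mU r0, measure_inner_le mD D1 hB2 hB1 h2_gt0 h1_gt0 mV r0).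
have := h1_gt0 r0; have := h2_gt0 r0; move: A B.
have : 0 <= m1 (inner D U r) by []; have : 0 <= m2 (inner D V r) by [].
have : 0 <= m2 U by []; have : 0 <= m1 V by [].
have fU2 : m2 U \is a fin_num by rewrite ge0_fin_numE.
have fV1 : m1 V \is a fin_num by rewrite ge0_fin_numE.
have fi1 : m1 (inner D U r) \is a fin_num.
  by rewrite ge0_fin_numE// (le_lt_trans (inner_le mD m1 r0 oU)).
have fi2 : m2 (inner D V r) \is a fin_num.
  by rewrite ge0_fin_numE// (le_lt_trans (inner_le mD m2 r0 oV)).
rewrite -(fineK fU2) -(fineK fV1) -(fineK fi1) -(fineK fi2).
move: (fine (m2 U)) (fine (m1 V)) (fine (m1 (inner D U r))) (fine (m2 (inner D V r))).
move: (h1 r) (h2 r) => a b u v p q; rewrite -!EFinM !lee_fin => v0 u0 q0 p0 h3 h4 b0 a0.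
have : (b * p * (a * q) <= a * u * (b * v))%R.
  by apply: ler_pM => //; apply: mulr_ge0 => //; exact: ltW.
rewrite (_ : b * p * (a * q) = (a * b) * (p * q))%R; last by ring.
rewrite (_ : a * u * (b * v) = (a * b) * (v * u))%R; last by ring.
by rewrite ler_pM2l// mulr_gt0.
Unshelve. all: by end_near. Qed.

Hypothesis D0 : D !=set0.

(** Christensen's theorem.  [measure_ratio_open] determines the ratio of the measures
    on bounded open sets, which form a pi-system generating the Borel sets. *)
Lemma measure_uniform : exists2 c : R, (0 < c)%R &
  forall A : set (borelRn R n), measurable A -> m1 A = c%:E * m2 A.
Proof.
have [x0 Dx0] := D0.
have h11 := h1_gt0 (@ltr01 R); have h21 := h2_gt0 (@ltr01 R).
have c0 : (0 < h1 1 / h2 1)%R by rewrite divr_gt0.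
exists (h1 1 / h2 1)%R => //.
have ratio (x y : \bar R) : x \is a fin_num -> y \is a fin_num ->
    x * (h2 1)%:E = (h1 1)%:E * y -> x = (h1 1 / h2 1)%:E * y.
  case: x => // x; case: y => // y _ _ [E]; congr EFin.
  by apply: (mulIf (lt0r_neq0 h21)); rewrite E mulrAC divfK ?gt_eqF.
pose k : {nonneg R} := NngNum (ltW c0).
suff H A : measurable A -> m1 A = mscale k m2 A by exact: H.
pose G : set (set (borelRn R n)) :=
  [set U | open (U : set 'rV[R]_n) /\ exists k : nat, U `<=` eball x0 k.+1%:R].
pose g k := eball x0 k.+1%:R.
have gU : \bigcup_k g k = setT.
  apply/seteqP; split=> // x _; exists (Num.bound (enorm ((x0 : 'rV[R]_n) - (x : 'rV[R]_n)))) => //.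
  rewrite /g /eball/=; apply: (lt_le_trans (archi_boundP _)); first exact: enorm_ge0.
  by rewrite ler_nat.
have Gfin U : G U -> m1 U < +oo /\ m2 U < +oo.
  move=> [oU [j Uj]].
  have mU : measurable U by exact: measurable_openRn.
  have j0 : (0 < j.+1%:R :> R)%R by [].
  split.
    rewrite (@le_lt_trans _ _ (m1 (eball x0 j.+1%:R)))//; last by rewrite hB1// ltry.
    by apply: le_measure; rewrite ?inE//; exact: measurable_eball.
  rewrite (@le_lt_trans _ _ (m2 (eball x0 j.+1%:R)))//; last by rewrite hB2// ltry.
  by apply: le_measure; rewrite ?inE//; exact: measurable_eball.
have Gg j : G (g j) by split; [exact: open_eball|exists j].
apply: (measure_unique G g) => //.
- apply/seteqP; split.
    apply: smallest_sub; first exact: smallest_sigma_algebra.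
    move=> U oU.
    have -> : U = \bigcup_k (U `&` g k) by rewrite -setI_bigcupr gU setIT.
    have [_ _ bigcupS] := @smallest_sigma_algebra _ setT G.
    apply: bigcupS => j; apply: sub_sigma_algebra; split.
      by apply: openI => //; exact: open_eball.
    by exists j => x [].
  apply: smallest_sub; first exact: sigma_algebra_measurable.
  by move=> U [oU _]; exact: measurable_openRn.
- move=> U V [oU [j Uj]] [oV _]; split; first exact: openI.
  by exists j => x [Ux _]; exact: Uj.
- move=> U GU; have [U1 U2] := Gfin _ GU.
  have [V1 V2] := Gfin _ (Gg 0%N).
  have := measure_ratio_open (proj1 GU) (proj1 (Gg 0%N)) U1 U2 V1 V2.
  rewrite /g hB1// hB2//.
  have fU1 : m1 U \is a fin_num by rewrite ge0_fin_numE.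
  have fU2 : m2 U \is a fin_num by rewrite ge0_fin_numE.
  move=> E; transitivity ((h1 1 / h2 1)%:E * m2 U); last by [].
  exact: ratio.
- by move=> j; exact: (proj1 (Gfin _ (Gg j))).
Qed.

End Uniform2.

Section LebesgueReflect.
Context {R : realType} (n : nat).
Local Notation leb := (@leb R).

Lemma leb_box_val (k : R) : 0 <= k -> leb n (box n k) = ((k *+ 2) ^+ n)%:E.
Proof.
move=> k0; elim: n => [|m IH].
  rewrite lebE expr0 /= diracE mem_set// => -[].
  by [].
have -> : box m.+1 k = [set x | `[- k, k]%classic ((x : 'rV[R]_m.+1) 0 ord0) /\
    box m k (\row_j (x : 'rV[R]_m.+1) 0 (lift ord0 j))].
  apply/seteqP; split=> x /=.
    move=> h; split; first by rewrite in_itv/= -ler_norml.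
    by move=> i; rewrite mxE.
  rewrite in_itv/= -ler_norml => -[h0 h] i; case: (unliftP ord0 i) => [j|] -> //.
  by have := h j; rewrite mxE.
rewrite leb_consX//; last exact: measurable_box.
rewrite IH lebesgue_measure_itv/= lte_fin; case: ifPn => [kk|].
  by rewrite -EFinB -EFinM exprS opprK mulr2n.
rewrite -leNgt => kk; have -> : k = 0 by apply/eqP; rewrite eq_le k0 andbT; lra.
by rewrite mul0e mul0rn expr0n.
Qed.

Lemma leb_translate (v : 'rV[R]_n) (A : set (borelRn R n)) : measurable A ->
  leb n [set x | A ((x : 'rV[R]_n) + v)] = leb n A.
Proof.
move=> mA; rewrite -[RHS]mul1e.
have := leb_affine v (@ltr01 R) mA; rewrite expr1n invr1 => <-.
by congr (leb n _); apply/seteqP; split=> x /=; rewrite scale1r.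
Qed.

Lemma leb_eball_translate (x : 'rV[R]_n) (r : R) :
  leb n (eball x r) = leb n (eball (0 : 'rV[R]_n) r).
Proof.
rewrite -(leb_translate (- x) (measurable_eball (0 : 'rV[R]_n) r)).
by congr (leb n _); apply/seteqP; split=> y; rewrite /eball/= sub0r opprB.
Qed.

Lemma leb_eball_fin (x : 'rV[R]_n) (r : R) : (leb n (eball x r) < +oo)%E.
Proof.
rewrite leb_eball_translate.
apply: (@le_lt_trans _ _ (leb n (box n r))); last exact: leb_box.
apply: le_measure; rewrite ?inE; [exact: measurable_eball|exact: measurable_box|].
move=> y; rewrite /eball/= sub0r enormN => yr i.
by apply: ltW; apply: le_lt_trans yr; exact: coord_le_enorm.
Qed.

Lemma leb_eball_gt0 (x : 'rV[R]_n) (r : R) : 0 < r -> (0 < leb n (eball x r))%E.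
Proof.
move=> r0; rewrite leb_eball_translate.
have k0 : 0 < r / n.+1%:R by rewrite divr_gt0.
apply: (@lt_le_trans _ _ (leb n (box n (r / n.+1%:R)))).
  by rewrite leb_box_val ?ltW// lte_fin exprn_gt0// pmulrn_rgt0.
apply: le_measure; rewrite ?inE; [exact: measurable_box|exact: measurable_eball|].
move=> y /enorm_le_coord yr; rewrite /eball/= sub0r enormN; apply: (le_lt_trans yr).
by rewrite mulrCA gtr_pMr// ltr_pdivrMr// mul1r ltr_nat.
Qed.

(** The image of Lebesgue measure gives balls the same mass as Lebesgue measure,
    since a reflection permutes balls and Lebesgue measure is translation invariant;
    by [measure_uniform] the two measures are proportional, and a centred ball shows
    that the factor is 1. *)
Lemma leb_reflect (w : 'rV[R]_n) (A : set (borelRn R n)) : w != 0 -> measurable A ->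
  leb n (reflect_row w @^-1` A) = leb n A.
Proof.
move=> w0 mA.
have [m mE] := pushforward_measure (leb n) (measurable_reflect w).
have mball x r : m (eball x r) = leb n (eball (0 : 'rV[R]_n) r).
  by rewrite mE preimage_reflect_eball//; exact: leb_eball_translate.
have sf : sigma_finite setT m.
  exists (fun k => eball (0 : 'rV[R]_n) k.+1%:R).
    apply/seteqP; split=> // x _; exists (Num.bound (enorm (0 - (x : 'rV[R]_n)))) => //.
    rewrite /eball/=; apply: (lt_le_trans (archi_boundP _)); first exact: enorm_ge0.
    by rewrite ler_nat.
  by move=> k; split; [exact: measurable_eball|rewrite mball leb_eball_fin].
have [M ME] := sigma_finite_ex sf.
pose h r := fine (leb n (eball (0 : 'rV[R]_n) r)).
have hE r : leb n (eball (0 : 'rV[R]_n) r) = (h r)%:E.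
  by rewrite fineK// ge0_fin_numE// leb_eball_fin.
have h0 r : 0 < r -> 0 < h r by move=> r0; rewrite -lte_fin -hE leb_eball_gt0.
have [|||||||c c0 H] := @measure_uniform R n M (leb n) setT h h measurableT.
- by rewrite setCT measure0.
- by rewrite setCT measure0.
- by move=> x r _ _; rewrite ME mball.
- by move=> x r _ _; rewrite leb_eball_translate.
- by [].
- by [].
- by exists 0.
have c1 : c = 1.
  have := H _ (measurable_eball (0 : 'rV[R]_n) 1); rewrite ME mball hE -EFinM => -[].
  by rewrite -[X in X = _]mul1r => /(mulIf (lt0r_neq0 (h0 _ ltr01)))/esym.
by have := H _ mA; rewrite ME mE c1 mul1e.
Qed.

End LebesgueReflect.

(** * Hausdorff measure *)

Section HausdorffOuter.
Context {R : realType} (n s : nat) (s_gt0 : (0 < s)%N).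
Local Open Scope ereal_scope.
Local Notation T := ('rV[R]_n).
Implicit Types (A B : set T) (x y : T).

Lemma le_expe (x y : \bar R) k : 0 <= x -> x <= y -> x ^+ k <= y ^+ k.
Proof.
move=> x0 xy; elim: k => [|k IH]; first by rewrite !expe0.
by rewrite !expeS lee_pmul// expe_ge0.
Qed.

Lemma ediam_ge0 A : 0 <= ediam A.
Proof. by apply: ereal_sup_ubound; left. Qed.

Lemma ediam_ub A x y : A x -> A y -> (enorm (x - y))%:E <= ediam A.
Proof. by move=> Ax Ay; apply: ereal_sup_ubound; right; exists x => //; exists y. Qed.

Lemma ediam_le A (d : \bar R) : 0 <= d ->
  (forall x y, A x -> A y -> (enorm (x - y))%:E <= d) -> ediam A <= d.
Proof. by move=> d0 h; apply: ge_ereal_sup => _ [->//|[x Ax [y Ay <-]]]; exact: h. Qed.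

Lemma le_ediam A B : A `<=` B -> ediam A <= ediam B.
Proof.
by move=> AB; apply: ediam_le => [|x y Ax Ay]; [exact: ediam_ge0|apply: ediam_ub; exact: AB].
Qed.

Lemma ediam0 : ediam (@set0 T) = 0.
Proof. by apply/eqP; rewrite eq_le ediam_ge0 andbT; apply: ediam_le. Qed.

(** The exponent [s] is positive in this section; so the empty set contributes 0 to a
    covering. *)
Definition diams A : \bar R := ediam A ^+ s.

Lemma diams_ge0 A : 0 <= diams A.
Proof. exact/expe_ge0/ediam_ge0. Qed.

Lemma diams0 : diams (@set0 T) = 0.
Proof. by rewrite /diams ediam0; case: s s_gt0 => // k _; rewrite expeS mul0e. Qed.

Lemma le_diams A B : A `<=` B -> diams A <= diams B.
Proof. by move=> AB; apply: le_expe; [exact: ediam_ge0|exact: le_ediam]. Qed.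

Lemma hausdorff_delta_ge0 (d : R) A : 0 <= hausdorff_delta s d A.
Proof.
apply: le_ereal_inf_tmp => _ [E _ <-]; apply: nneseries_ge0 => k _ _.
exact: (diams_ge0 (E k)).
Qed.

Lemma hausdorff_delta_le (d : R) A (E : (set T)^nat) :
  A `<=` \bigcup_k E k -> (forall k, ediam (E k) <= d%:E) ->
  hausdorff_delta s d A <= \sum_(k <oo) diams (E k).
Proof. by move=> AE Ed; apply: ereal_inf_lbound; exists E. Qed.

Lemma hausdorff_delta0 (d : R) : (0 < d)%R -> hausdorff_delta s d (@set0 T) = 0.
Proof.
move=> d0; apply/eqP; rewrite eq_le hausdorff_delta_ge0 andbT.
apply: (le_trans (hausdorff_delta_le (E := fun=> set0) _ _)) => //.
  by move=> k; rewrite ediam0 lee_fin ltW.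
by rewrite eseries0// => k _ _; exact: diams0.
Qed.

Lemma le_hausdorff_delta (d : R) A B : A `<=` B ->
  hausdorff_delta s d A <= hausdorff_delta s d B.
Proof.
move=> AB; apply: ereal_inf_le_tmp => _ [E [BE Ed] <-]; exists E => //.
by split => //; exact: subset_trans BE.
Qed.

Lemma hausdorff_delta_anti (d d' : R) A : (d <= d')%R ->
  hausdorff_delta s d' A <= hausdorff_delta s d A.
Proof.
move=> dd; apply: ereal_inf_le_tmp => _ [E [BE Ed] <-]; exists E => //.
by split => // k; rewrite (le_trans (Ed k))// lee_fin.
Qed.

(** Merge coverings of the [A k] that are optimal up to [e / 2 ^ k.+1]. *)
Lemma hausdorff_delta_bigcup (d : R) (A : (set T)^nat) : (0 < d)%R ->
  hausdorff_delta s d (\bigcup_k A k) <= \sum_(k <oo) hausdorff_delta s d (A k).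
Proof.
move=> d0; set H := hausdorff_delta s d.
have [[i ioo]|] := pselect (exists i, H (A i) = +oo).
  rewrite (eseries_pinfty _ _ ioo) ?leey// => k _.
  by rewrite -ltNye (lt_le_trans _ (hausdorff_delta_ge0 _ _)).
rewrite -forallNE => Aoo.
suff add2e (e : {posnum R}) : H (\bigcup_k A k) <= \sum_(i <oo) H (A i) + e%:num%:E.
  by apply/lee_addgt0Pr => _/posnumP[].
rewrite (le_trans _ (epsilon_trick _ _ _))//; last first.
  by move=> k; exact: hausdorff_delta_ge0.
pose P k (B : (set T)^nat) := [/\ A k `<=` \bigcup_j B j, (forall j, ediam (B j) <= d%:E) &
  \sum_(j <oo) diams (B j) <= H (A k) + (e%:num / (2 ^ k.+1)%:R)%:E].
have [G PG] : {G : ((set T)^nat)^nat & forall k, P k (G k)}.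
  apply: (@choice _ _ P) => k; rewrite /P.
  have en1 : (0 < e%:num / (2 ^ k.+1)%:R)%R by [].
  have Hf : H (A k) \is a fin_num.
    by rewrite ge0_fin_numE ?hausdorff_delta_ge0// ltey; apply/eqP; exact: Aoo.
  have [x [B [AB Bd] <- xS]] := lb_ereal_inf_adherent en1 Hf.
  by exists B; split => //; exact: ltW.
have mu_ge0 (x : nat * nat) : 0 <= (diams \o uncurry G) x by exact: diams_ge0.
apply: (@le_trans _ _ (\esum_(i in setT) (diams \o uncurry G) i)).
  have /card_esym/ppcard_eqP[f] := card_nat2.
  apply: (@le_trans _ _ (\sum_(k <oo) diams ((uncurry G \o f) k))).
    apply: hausdorff_delta_le => [t [i _ Ait]|k].
      have [/(_ _ Ait)[j _ Bt] _ _] := PG i.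
      by exists (f^-1%FUN (i, j)) => //=; rewrite invK ?inE.
    by rewrite /=; case: (f k) => i j /=; have [_ + _] := PG i; apply.
  rewrite -(esum_pred_image (diams \o uncurry G) _ xpredT) ?[fun=> _]set_true//.
  by rewrite image_eq.
rewrite (_ : esum _ _ = \sum_(i <oo) \sum_(j <oo ) diams (G i j)); last first.
  pose J : nat -> set (nat * nat) := fun i => [set (i, j) | j in setT].
  rewrite (_ : setT = \bigcup_k J k); last first.
    by rewrite predeqE => -[a b]; split => // _; exists a => //; exists b.
  rewrite esum_bigcupT /=; last 2 first.
    - apply/trivIsetP => i j _ _ ij.
      rewrite predeqE => -[k m] /=; split => //= -[] [_] _ [<-{k} _].
      by move=> [m' _] [] /esym/eqP; rewrite (negbTE ij).
    - by move=> /= [k m]; exact: diams_ge0.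
  rewrite -(image_id [set: nat]) -fun_true esum_pred_image//; last first.
    by move=> k _; apply: esum_ge0 => z _; exact: diams_ge0.
  apply: eq_eseriesr => /= j _.
  rewrite -(esum_pred_image (diams \o uncurry G) (pair j) predT)//=.
  - by congr esum; rewrite predeqE => -[a b]; split; move=> [i _ <-]; exists i.
  - by move=> k _; exact: diams_ge0.
  - by move=> ? ? _ _; exact: (@can_inj _ _ _ snd).
apply: lee_nneseries => [k _ _|k _].
  by apply: nneseries_ge0 => j _ _; exact: diams_ge0.
by have [] := PG k.
Qed.

Local Notation H := (@hausdorff R n s).

Lemma hausdorff_ub (d : R) A : (0 < d)%R -> hausdorff_delta s d A <= H A.
Proof. by move=> d0; apply: ereal_sup_ubound; exists d. Qed.

Lemma hausdorff_le A c : (forall d : R, (0 < d)%R -> hausdorff_delta s d A <= c) -> H A <= c.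
Proof. by move=> h; apply: ge_ereal_sup => _ [d d0 <-]; exact: h. Qed.

Lemma hausdorff_ge0 A : 0 <= H A.
Proof. exact: le_trans (hausdorff_delta_ge0 1 A) (hausdorff_ub _ ltr01). Qed.

Lemma hausdorff0 : H (@set0 T) = 0.
Proof.
apply/eqP; rewrite eq_le hausdorff_ge0 andbT; apply: hausdorff_le => d d0.
by rewrite hausdorff_delta0.
Qed.

Lemma le_hausdorff : {homo (H : set T -> \bar R) : A B / A `<=` B >-> A <= B}.
Proof.
move=> A B AB; apply: hausdorff_le => d d0.
exact: le_trans (le_hausdorff_delta d AB) (hausdorff_ub _ d0).
Qed.

Lemma hausdorff_sigma_subadditive : sigma_subadditive (H : set T -> \bar R).
Proof.
move=> A; apply: hausdorff_le => d d0.
apply: (le_trans (hausdorff_delta_bigcup A d0)).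
apply: lee_nneseries => [k _ _|k _]; first exact: hausdorff_delta_ge0.
exact: hausdorff_ub.
Qed.

Lemma hausdorff_outer_measure :
  exists m : {outer_measure set T -> \bar R}, (m : set T -> \bar R) = (H : set T -> \bar R).
Proof.
pose mx := @isOuterMeasure.Build R T (H : set T -> \bar R)
  hausdorff0 hausdorff_ge0 le_hausdorff hausdorff_sigma_subadditive.
pose M : {outer_measure set T -> \bar R} := HB.pack (H : set T -> \bar R) mx.
by exists M.
Qed.

(** A set of diameter at most [d] cannot meet both [A] and [B]. *)
Lemma hausdorff_delta_metric (d e : R) A B : (0 < d)%R -> (d < e)%R ->
  (forall x y, A x -> B y -> (e <= enorm (x - y))%R) ->
  hausdorff_delta s d A + hausdorff_delta s d B <= hausdorff_delta s d (A `|` B).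
Proof.
move=> d0 de AB; apply: le_ereal_inf_tmp => _ [E [ABE Ed] <-].
pose EA k := E k `&` A; pose EB k := E k `&` B.
have hA : hausdorff_delta s d A <= \sum_(k <oo) diams (EA k).
  apply: hausdorff_delta_le => [x Ax|k].
    by have [k _ Ek] := ABE x (or_introl Ax); exists k.
  by apply: le_trans (Ed k); apply: le_ediam => x [].
have hB : hausdorff_delta s d B <= \sum_(k <oo) diams (EB k).
  apply: hausdorff_delta_le => [x Ax|k].
    by have [k _ Ek] := ABE x (or_intror Ax); exists k.
  by apply: le_trans (Ed k); apply: le_ediam => x [].
apply: (le_trans (leeD hA hB)).
rewrite -nneseriesD; last 2 first.
- by move=> k _ _; exact: diams_ge0.
- by move=> k _ _; exact: diams_ge0.
apply: lee_nneseries => [k _ _|k _]; first by rewrite adde_ge0// diams_ge0.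
have [A0|/set0P[x [Ex Ax]]] := eqVneq (EA k) set0.
  by rewrite A0 diams0 add0e; apply: le_diams => x [].
rewrite (_ : EB k = set0) ?diams0 ?adde0; first by apply: le_diams => y [].
apply/seteqP; split=> y // -[Ey By].
have := le_trans (ediam_ub Ex Ey) (Ed k); rewrite lee_fin => xyd.
by have := lt_le_trans de (AB _ _ Ax By); rewrite ltNge xyd.
Qed.

(** The two sets need different meshes [d1] and [d2] before passing to the
    supremum; the smaller one serves for both. *)
Lemma hausdorff_metric (e : R) A B : (0 < e)%R ->
  (forall x y, A x -> B y -> (e <= enorm (x - y))%R) -> H A + H B <= H (A `|` B).
Proof.
move=> e0 AB; have [->|Hoo] := eqVneq (H (A `|` B)) +oo; first exact: leey.
have Hf : H (A `|` B) \is a fin_num by rewrite ge0_fin_numE ?hausdorff_ge0// ltey.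
have HfA : H A \is a fin_num.
  rewrite ge0_fin_numE ?hausdorff_ge0// (@le_lt_trans _ _ (H (A `|` B)))//; last by rewrite ltey.
  by apply: le_hausdorff => x; left.
have main (d1 d2 : R) : (0 < d1)%R -> (0 < d2)%R ->
    hausdorff_delta s d1 A + hausdorff_delta s d2 B <= H (A `|` B).
  move=> d10 d20; pose d := (Num.min (Num.min d1 d2) (e / 2))%R.
  have d0 : (0 < d)%R by rewrite !lt_min d10 d20 divr_gt0.
  have dd1 : (d <= d1)%R by rewrite !ge_min lexx.
  have dd2 : (d <= d2)%R by rewrite !ge_min lexx !orbT.
  have de : (d < e)%R by rewrite (@le_lt_trans _ _ (e / 2)%R) ?ge_min ?lexx ?orbT//; lra.
  apply: (le_trans (leeD (hausdorff_delta_anti A dd1) (hausdorff_delta_anti B dd2))).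
  exact: (le_trans (hausdorff_delta_metric d0 de AB)) (hausdorff_ub _ d0).
rewrite addeC -leeBrDr//; apply: hausdorff_le => d2 d20.
rewrite leeBrDr// addeC.
have fB : hausdorff_delta s d2 B \is a fin_num.
  rewrite ge0_fin_numE ?hausdorff_delta_ge0// (@le_lt_trans _ _ (H (A `|` B)))//; last by rewrite ltey.
  by apply: (le_trans (hausdorff_ub _ d20)); apply: le_hausdorff => x; right.
rewrite -leeBrDr//; apply: hausdorff_le => d1 d10.
by rewrite leeBrDr// main.
Qed.

Lemma hausdorffU A B : H (A `|` B) <= H A + H B.
Proof. by have [m <-] := hausdorff_outer_measure; exact: outer_measureU2. Qed.

(** Caratheodory's argument for metric outer measures.  Slices of [X] at distance
    between [u k.+1] and [u k] from the half-space are separated from each other when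
    their indices have the same parity, so that the sum of their measures is at most
    twice that of [X]; hence the tails of this sum vanish and the part of [X] near the
    half-space is negligible. *)
Lemma hausdorff_halfspace (i : 'I_n) (c : R) (X : set T) :
  H (X `&` [set x | (x 0 i <= c)%R]) + H (X `&` [set x | (c < x 0 i)%R]) <= H X.
Proof.
have [->|Hoo] := eqVneq (H X) +oo; first exact: leey.
pose u k : R := (k.+1%:R^-1)%R.
have u0 k : (0 < u k)%R by rewrite invr_gt0.
have u_lt k l : (k < l)%N -> (u l < u k)%R by move=> kl; rewrite ltf_pV2 ?posrE// ltr_nat.
have u_le k l : (k <= l)%N -> (u l <= u k)%R by move=> kl; rewrite lef_pV2 ?posrE// ler_nat.
pose D k := X `&` [set x : T | (c + u k.+1 <= x 0 i < c + u k)%R].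
pose A k := X `&` [set x : T | (c + u k <= x 0 i)%R].
set F := X `&` [set x : T | (x 0 i <= c)%R]; set G := X `&` [set x : T | (c < x 0 i)%R].
have sep (e : R) (x y : T) : (e <= y 0 i - x 0 i)%R -> (e <= enorm (x - y))%R.
  move=> h; apply: (le_trans h); rewrite enormBC; apply: le_trans (coord_le_enorm _ i).
  by rewrite !mxE ler_norm.
have FA k : H F + H (A k) <= H X.
  apply: (@le_trans _ _ (H (F `|` A k))); last by apply: le_hausdorff => x [[]|[]].
  apply: (hausdorff_metric (u0 k)) => x y [_ /= xc] [_ /= yc]; apply: sep; lra.
have GA k : H G <= H (A k) + \sum_(k <= j <oo) H (D j).
  pose E j := if (k <= j)%N then D j else set0.
  have -> : \sum_(k <= j <oo) H (D j) = \sum_(j <oo) H (E j).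
    rewrite eseries_cond eseries_mkcond; apply: eq_eseriesr => j _.
    by rewrite /E /=; case: ifP => // _; rewrite hausdorff0.
  apply: (@le_trans _ _ (H (A k `|` \bigcup_j E j))).
    apply: le_hausdorff => x [Xx /= xc].
    have [xk|xk] := leP (c + u k)%R (x 0%R i); first by left.
    right.
    have ex : exists j, (c + u j.+1 <= x 0 i)%R.
      have e0 : (0 < x 0 i - c)%R by rewrite subr_gt0.
      have [j _ /(_ j.+1 (leqnSn _)) ke] := near_infty_natSinv_lt (PosNum e0).
      by exists j; move: ke => /=; rewrite -/(u j.+1); lra.
    have [j jx jmin] := ex_minnP ex.
    have kj : (k <= j)%N.
      by rewrite leqNgt; apply/negP => jk; have := u_le _ _ jk; lra.
    exists j => //; rewrite /E kj; split => //=; rewrite jx/=.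
    case: j jx jmin kj => [|j] jx jmin kj.
      by move: kj xk; rewrite leqn0 => /eqP ->.
    by rewrite ltNge; apply/negP => /jmin; rewrite ltnn.
  by apply: (le_trans (hausdorffU _ _)); rewrite leeD2l//; exact: hausdorff_sigma_subadditive.
have ev b N : \sum_(0 <= j < N) H (D (j.*2 + b)%N) <= H (X `&` [set x : T | (N != 0%N) /\ (c + u (N.*2 + b)%N.-1 <= x 0 i)%R]).
  elim: N => [|N IH]; first by rewrite big_geq ?hausdorff_ge0.
  rewrite big_nat_recr//=; apply: (le_trans (leeD2r _ IH)).
  have e0 : (0 < u (N.*2 + b)%N.-1 - u (N.*2 + b)%N)%R \/ N = 0%N.
    case: N {IH} => [|N]; [by right|left].
    by rewrite subr_gt0; apply: u_lt; rewrite doubleS addSn.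
  apply: (@le_trans _ _ (H ((X `&` [set x : T | (N != 0%N) /\ (c + u (N.*2 + b)%N.-1 <= x 0 i)%R]) `|` D (N.*2 + b)%N))).
    case: e0 => [e0|N0].
      apply: (hausdorff_metric e0) => x y [_ /= [_ xc]] [_ /= /andP[_ yc]].
      by rewrite enormBC; apply: sep; lra.
    have -> : X `&` [set x : T | (N != 0%N) /\ (c + u (N.*2 + b)%N.-1 <= x 0 i)%R] = set0.
      by apply/seteqP; split=> x // [_ [/=]]; rewrite N0 eqxx.
    by rewrite hausdorff0 add0e set0U.
  apply: le_hausdorff => x [[Xx /= [N0 xc]]|[Xx /= /andP[xc _]]]; split => //; split => //.
    apply: le_trans xc; rewrite lerD2l; apply: u_le.
    by rewrite /= addSn (leq_trans (leq_pred _))// leqnSn.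
have evX b N : \sum_(0 <= j < N) H (D (j.*2 + b)%N) <= H X.
  by apply: (le_trans (ev b N)); apply: le_hausdorff => x [].
have sumD N : \sum_(0 <= j < N.*2) H (D j) =
    \sum_(0 <= j < N) H (D (j.*2 + 0)%N) + \sum_(0 <= j < N) H (D (j.*2 + 1)%N).
  elim: N => [|N IH]; first by rewrite !big_geq ?adde0.
  rewrite doubleS !big_nat_recr//= IH !addn0 addn1; set a := bigop _ _ _; set a' := bigop _ _ _.
  by rewrite -!addeA; congr (_ + _); rewrite addeCA.
have HXf : H X \is a fin_num by rewrite ge0_fin_numE ?hausdorff_ge0// ltey.
have sumfin : \sum_(j <oo) H (D j) < +oo.
  apply: (@le_lt_trans _ _ (H X + H X)); last first.
    by rewrite -ge0_fin_numE ?adde_ge0 ?hausdorff_ge0// fin_numD HXf.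
  apply: lime_le; first by apply: is_cvg_nneseries => *; exact: hausdorff_ge0.
  near=> N; apply: (@le_trans _ _ (\sum_(0 <= j < N.*2) H (D j))).
    apply: lee_sum_nneg_natr => // [j _ _|]; first exact: hausdorff_ge0.
    by rewrite -addnn leq_addr.
  by rewrite sumD leeD.
have tail := nneseries_tail_cvg sumfin (fun k _ => hausdorff_ge0 (D k)).
have lim : (H X + \sum_(k <= j <oo) H (D j)) @[k --> \oo] --> H X + 0.
  by apply: cvgeD => //; [exact: fin_num_adde_defr|exact: cvg_cst].
rewrite adde0 in lim; rewrite -(cvg_lim _ lim)//.
apply: lime_ge; first by apply/cvg_ex; eexists; exact: lim.
near=> k; apply: (le_trans (leeD2l _ (GA k))).
by rewrite addeA leeD2r.
Unshelve. all: by end_near. Qed.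

(** Half-spaces generate the Borel sets, so that [hausdorff_halfspace] makes all of
    them Caratheodory measurable. *)
Lemma hausdorff_measure : exists m : {measure set (borelRn R n) -> \bar R},
  (m : set (borelRn R n) -> \bar R) = H.
Proof.
have [m mE] := hausdorff_outer_measure.
have borel_cara (A : set (borelRn R n)) : measurable A -> m.-cara.-measurable A.
  move=> mA.
  have mid : measurable_fun (setT : set (caratheodory_type m)) (fun x : caratheodory_type m => x : borelRn R n).
    apply: measurable_fun_toRn => // i.
    apply: (measurability _ (measurable_realfun.RGenOInfty.measurableE R)).
    move=> _ [_ [c ->] <-]; rewrite setTI.
    rewrite -(setCK (_ @^-1` _)); apply: measurableC.
    apply: le_caratheodory_measurable => X.
    have -> : ~` ((fun x : caratheodory_type m => (x : T) 0 i)%R @^-1` `]c, +oo[) = [set x : T | (x 0 i <= c)%R].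
      by apply/seteqP; split=> x /=; rewrite in_itv/= andbT leNgt => /negP.
    have -> : ~` [set x : T | (x 0 i <= c)%R] = [set x : T | (c < x 0 i)%R].
      by apply/seteqP; split=> x /=; rewrite ltNge => /negP.
    by rewrite mE; exact: hausdorff_halfspace.
  by have := mid measurableT A mA; rewrite setTI.
have Hsa : semi_sigma_additive (H : set (borelRn R n) -> \bar R).
  move=> F mF tF mUF.
  have := @caratheodory_measure_sigma_additive R T m F
    (fun k => borel_cara _ (mF k)) tF (borel_cara _ mUF).
  by rewrite -mE.
pose mx := @isMeasure.Build _ (borelRn R n) R (H : set (borelRn R n) -> \bar R) hausdorff0 hausdorff_ge0 Hsa.
pose M : {measure set (borelRn R n) -> \bar R} := HB.pack (H : set (borelRn R n) -> \bar R) mx.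
by exists M.
Qed.

End HausdorffOuter.

(** * The Hausdorff measure of the sphere is a cone measure *)

Section SphereMeasure.
Context {R : realType} (n : nat) (n_gt0 : (0 < n)%N).
Local Notation T := ('rV[R]_n.+1).
Local Notation S := (sphere R n.+1 : set (borelRn R n.+1)).
Local Notation H := (@hausdorff R n.+1 n).
Local Notation leb_dim := (@leb R).
Local Notation leb := (@leb R n.+1).
Implicit Types (x y u v w : T).

Lemma sphere_neq0 u : S u -> u != 0.
Proof.
rewrite /sphere/= => u1; apply/eqP => u0; move: u1; rewrite u0 enorm0 => /eqP.
by rewrite eq_sym oner_eq0.
Qed.

Lemma enorm_radial x : x != 0 -> enorm (radial x) = 1.
Proof.
move=> x0; have e0 : 0 < enorm x by rewrite enorm_gt0.
by rewrite /radial enormZ gtr0_norm ?invr_gt0// mulVf// gt_eqF.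
Qed.

Lemma radial_sphere u : S u -> radial u = u.
Proof. by rewrite /sphere /radial/= => ->; rewrite invr1 scale1r. Qed.

(** An isometry preserves diameters, hence maps coverings to equivalent
    coverings. *)
Lemma hausdorff_reflect w (A : set (borelRn R n.+1)) : w != 0 ->
  H (reflect_row w @^-1` A) = H A.
Proof.
move=> w0.
suff main (B : set T) : (H (reflect_row w @^-1` B) <= H B)%E.
  apply/eqP; rewrite eq_le main/=.
  have := main (reflect_row w @^-1` A); congr (_ <= _)%E; congr H.
  by apply/seteqP; split=> x /=; rewrite reflectK.
apply: hausdorff_le => d d0.
apply: le_trans (hausdorff_ub n B d0).
apply: le_ereal_inf_tmp => _ [E [AE Ed] <-].
have dE (C : set T) : (ediam (reflect_row w @^-1` C) <= ediam C)%E.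
  apply: ediam_le => [|x y Bx By]; first exact: ediam_ge0.
  by rewrite -(enorm_reflect _ w0) reflectB; exact: ediam_ub.
apply: (le_trans (@hausdorff_delta_le R n.+1 n d _ (fun k => reflect_row w @^-1` E k) _ _)).
- by move=> x Ax; have [k _ Ek] := AE _ Ax; exists k.
- by move=> k; exact: le_trans (dE _) (Ed k).
- apply: lee_nneseries => k _; first by move=> _; exact: diams_ge0.
  by apply: le_expe; [exact: ediam_ge0|exact: dE].
Qed.

(** The radial projection carries Lebesgue measure on this shell to a measure on
    the sphere; a shell rather than a ball keeps the projection away from 0. *)
Definition shell : set (borelRn R n.+1) := [set x | 1 <= enorm (x : T) <= 2].

Lemma measurable_shell : measurable shell.
Proof.
rewrite -[X in measurable X]setTI.
rewrite (_ : shell = (@enorm R n.+1 : borelRn R n.+1 -> R) @^-1` `[1, 2]%classic).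
  by apply: measurable_enorm.
by apply/seteqP; split=> x; rewrite /shell/= in_itv.
Qed.

Lemma shell_neq0 x : shell x -> x != 0.
Proof.
rewrite /shell/= => /andP[h _]; apply/eqP => x0.
by move: h; rewrite x0 enorm0 ler10.
Qed.

Lemma measurable_inv_enorm : measurable_fun setT (fun x : borelRn R n.+1 => (enorm (x : T))^-1).
Proof.
rewrite (_ : (fun x => _) = (fun x : borelRn R n.+1 => enorm (x : T) `^ (-1))).
  apply: (@measurableT_comp _ _ _ _ _ _ (fun t : R => t `^ (-1)) _ (@enorm R n.+1 : borelRn R n.+1 -> R)).
    exact: measurable_powR.
  exact: measurable_enorm.
by apply/funext => x; rewrite powR_inv1// enorm_ge0.
Qed.

Lemma measurable_radial :
  measurable_fun setT (radial : borelRn R n.+1 -> borelRn R n.+1).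
Proof.
apply: measurable_fun_toRn => // i; under eq_fun do rewrite !mxE.
apply: measurable_funM; last exact: measurable_coordRn.
exact: measurable_inv_enorm.
Qed.

Lemma measurable_preimage_radial (A : set (borelRn R n.+1)) : measurable A ->
  measurable ((radial : borelRn R n.+1 -> borelRn R n.+1) @^-1` A).
Proof. by move=> mA; exact: (measurable_preimageT measurable_radial mA). Qed.

Lemma measurable_sphere : measurable S.
Proof.
rewrite -[X in measurable X]setTI.
rewrite -[X in _ `&` X]/((@enorm R n.+1 : borelRn R n.+1 -> R) @^-1` [set 1]).
by apply: measurable_enorm.
Qed.

Lemma shell_fin : (leb shell < +oo)%E.
Proof.
apply: (@le_lt_trans _ _ (leb (box n.+1 2))); last exact: leb_box.
apply: le_measure; rewrite ?inE; [exact: measurable_shell|exact: measurable_box|].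
by move=> x /andP[_ x2] i; apply: le_trans x2; exact: coord_le_enorm.
Qed.

Lemma cone_measure_ex : exists sigma : {sigma_finite_measure set (borelRn R n.+1) -> \bar R},
  forall A, sigma A = leb (radial @^-1` A `&` shell).
Proof.
have [m' m'E] := pushforward_measure
  [the {measure set _ -> \bar R} of mrestr leb measurable_shell] measurable_radial.
have fin : (m' setT < +oo)%E.
  by rewrite m'E preimage_setT /= /mrestr setTI; exact: shell_fin.
have sf : sigma_finite setT m'.
  exists (fun=> setT) => //; first by rewrite bigcup_const.
have [M ME] := sigma_finite_ex sf.
by exists M => A; rewrite ME m'E.
Qed.

(** The image of Lebesgue measure on the shell under the radial projection
    ([cone_measureE]), packed with its sigma-finiteness for Tonelli's theorem. *)
Definition cone_measure := projT1 (cid cone_measure_ex).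
Local Notation sigma := cone_measure.

Lemma cone_measureE A : sigma A = leb (radial @^-1` A `&` shell).
Proof. by rewrite /cone_measure; case: cid. Qed.

Lemma cone_measure_conull : sigma (~` S) = 0%E.
Proof.
rewrite cone_measureE (_ : _ `&` _ = set0) ?measure0//.
by apply/seteqP; split=> x // -[/= Sx /shell_neq0 x0]; apply: Sx; exact: enorm_radial.
Qed.

Lemma cone_measure_fin A : measurable A -> (sigma A < +oo)%E.
Proof.
move=> mA; rewrite cone_measureE (@le_lt_trans _ _ (leb shell))//; last exact: shell_fin.
apply: le_measure; rewrite ?inE; [|exact: measurable_shell|by move=> x []].
apply: measurableI; last exact: measurable_shell.
exact: measurable_preimage_radial.
Qed.

Lemma cone_measure_reflect w (A : set (borelRn R n.+1)) : w != 0 -> measurable A ->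
  sigma (reflect_row w @^-1` A) = sigma A.
Proof.
move=> w0 mA; rewrite !cone_measureE.
have mB : measurable ((radial : borelRn R n.+1 -> borelRn R n.+1) @^-1` A `&` shell).
  apply: measurableI; last exact: measurable_shell.
  exact: measurable_preimage_radial.
rewrite -(leb_reflect w0 mB); congr (leb _); apply/seteqP.
have E x : reflect_row w (radial x) = radial (reflect_row w x).
  by rewrite /radial reflectZ enorm_reflect.
by split=> x /=; rewrite E /shell/= enorm_reflect.
Qed.

(** Two points of the sphere are exchanged by a reflection. *)
Lemma eball_reflect_inv (m : set (borelRn R n.+1) -> \bar R) :
  (forall w (A : set (borelRn R n.+1)), w != 0 -> measurable A -> m (reflect_row w @^-1` A) = m A) ->
  forall u v (F : T -> set (borelRn R n.+1)), (forall w x, w != 0 -> reflect_row w @^-1` F x = F (reflect_row w x)) ->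
  (forall x, measurable (F x)) ->
  S u -> S v -> m (F u) = m (F v).
Proof.
move=> mT u v F FT mF Su Sv.
have [->//|uv] := eqVneq u v.
(* the reflection along [u - v] exchanges [u] and [v] *)
have w0 : u - v != 0 by rewrite subr_eq0.
rewrite -(mT _ _ w0 (mF u)) FT// reflect_swap//.
by rewrite Su Sv.
Qed.

(** The cone over a cap of the sphere contains a small ball around [3 / 2 *: u]. *)
Lemma cone_measure_eball_gt0 u (r : R) : S u -> 0 < r -> (0 < sigma (eball u r))%E.
Proof.
move=> Su r0.
pose e := Num.min 2^-1 (r / 2).
have e0 : 0 < e by rewrite lt_min invr_gt0 ltr0n divr_gt0.
have e1 : e <= 2^-1 by rewrite ge_min lexx.
have er : e <= r / 2 by rewrite ge_min lexx orbT.
(* the middle of the shell on the ray of [u] *)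
pose p : T := (3 / 2) *: u.
apply: (lt_le_trans (leb_eball_gt0 p e0)); rewrite cone_measureE.
apply: le_measure; rewrite ?inE; first exact: measurable_eball.
  apply: measurableI; last exact: measurable_shell.
  by apply: measurable_preimage_radial; exact: measurable_eball.
move=> x; rewrite /eball /shell/= => px.
have np : enorm p = 3 / 2.
  by rewrite /p enormZ (Su : enorm u = 1) mulr1 gtr0_norm// divr_gt0.
have h1 := ler_enormB p x; have h2 := ler_enormB x p.
rewrite enormBC in h2; rewrite np in h1 h2.
have x1 : 1 <= enorm x by lra.
split; last by rewrite x1/=; lra.
have x0 : 0 < enorm x by lra.
have E : u - radial x = (enorm x)^-1 *: ((enorm x - 3 / 2) *: u + (p - x)).
  rewrite /p /radial addrA -scalerDl subrK scalerBr scalerA mulVf ?scale1r//.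
  by rewrite gt_eqF.
rewrite E enormZ gtr0_norm ?invr_gt0// ltr_pdivrMl//.
apply: (le_lt_trans (enormD _ _)); rewrite enormZ (Su : enorm u = 1) mulr1.
have : `|enorm x - 3 / 2| <= enorm (p - x) by rewrite ler_norml; apply/andP; split; lra.
have : r <= enorm x * r by rewrite ler_peMl// ltW.
lra.
Qed.

Lemma measurable_cball u (d : R) :
  measurable ([set y | enorm (u - (y : T)) <= d]%R : set (borelRn R n.+1)).
Proof.
have mS : measurable ((@enorm R n.+1 : borelRn R n.+1 -> R) @^-1` `]-oo, d]).
  by apply: measurable_preimageT => //; exact: measurable_enorm.
have := measurable_preimageT (@measurable_affine R n.+1 (-1) u) mS.
congr measurable; apply/seteqP; split=> y; rewrite /= in_itv/= scaleN1r addrC//.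
Qed.

(** After a reflection [u] is a coordinate vector, and the part of the shell over the
    cap of radius [d] lies in a box with one side of length 4 and [n] sides of length
    [4 d]. *)
Lemma cone_measure_cball_le u (d : R) : S u -> 0 <= d ->
  (sigma [set y | enorm (u - (y : T)) <= d]%R <= (4 * (4 * d) ^+ n)%:E)%E.
Proof.
move=> Su d0.
pose F (x : T) : set (borelRn R n.+1) := [set y | enorm (x - (y : T)) <= d].
have mF x : measurable (F x) by exact: measurable_cball.
have FT w x : w != 0 -> reflect_row w @^-1` F x = F (reflect_row w x).
  by move=> w0; apply/seteqP; split=> y; rewrite /F/= -(enorm_reflect _ w0) reflectB reflectK.
pose e : T := delta_mx 0 ord0.
have e0 : e 0 ord0 = 1 by rewrite mxE !eqxx.
have ej j : e 0 (lift ord0 j) = 0 by rewrite mxE andbC.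
have Se : S e.
  rewrite /sphere/= /enorm /dot big_ord_recl/= e0 mulr1 big1 ?addr0 ?sqrtr1// => j _.
  by rewrite ej mulr0.
rewrite -/(F u) (eball_reflect_inv cone_measure_reflect FT mF Su Se) cone_measureE.
have -> : (4 * (4 * d) ^+ n)%:E = (lebesgue_measure (`[(-2)%R, 2%R]%classic : set R) * leb_dim n (box n (2 * d)))%E.
  rewrite lebesgue_measure_itv/= lte_fin ifT; last by lra.
  rewrite leb_box_val ?mulr_ge0// -EFinD -EFinM; congr (_ * _)%:E; first by ring.
  by rewrite -mulr_natr; congr (_ ^+ _); ring.
rewrite -leb_consX//; last exact: measurable_box.
apply: le_measure; rewrite ?inE.
- apply: measurableI; last exact: measurable_shell.
  by apply: measurable_preimage_radial; exact: mF.
- apply: measurableI.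
    rewrite -[X in measurable X]/((fun x : borelRn R n.+1 => (x : T) 0 ord0) @^-1` `[-2, 2]).
    by apply: measurable_preimageT; [exact: measurable_coordRn|].
  rewrite -[X in measurable X]/((fun x : borelRn R n.+1 => (\row_j (x : T) 0 (lift ord0 j)) : borelRn R n) @^-1` box n (2 * d)).
  apply: measurable_preimageT; last exact: measurable_box.
  by apply: measurable_fun_toRn => // j; under eq_fun do rewrite mxE; exact: measurable_coordRn.
move=> x [/= Fx /andP[x1 x2]].
have x0 : 0 < enorm x by lra.
split; first by rewrite in_itv/= -ler_norml; exact: le_trans (coord_le_enorm _ _) x2.
move=> j; rewrite mxE.
have := le_trans (coord_le_enorm (e - radial x) (lift ord0 j)) Fx.
rewrite !mxE -[X in X - _](ej j) mxE; set t := (X in `|X|).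
have -> : t = - ((enorm x)^-1 * x 0 (lift ord0 j)).
  by rewrite /t; have := ej j; rewrite mxE => ->; rewrite sub0r.
rewrite normrN normrM gtr0_norm ?invr_gt0// ler_pdivrMl// => h; apply: (le_trans h).
by rewrite ler_wpM2r.
Qed.

(** Every set of a covering lies in a cap whose radius is its diameter, so that
    [cone_measure_cball_le] bounds its cone measure by a multiple of its contribution
    to the Hausdorff measure.  This is what shows that the latter is not zero. *)
Lemma cone_measure_le_hausdorff (A : set (borelRn R n.+1)) : measurable A -> A `<=` S ->
  (sigma A <= (4 * 4 ^+ n)%:E * H A)%E.
Proof.
move=> mA AS.
have c0 : 0 < 4 * 4 ^+ n :> R by rewrite mulr_gt0// exprn_gt0.
apply: (@le_trans _ _ ((4 * 4 ^+ n)%:E * hausdorff_delta n 1 A)%E); last first.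
  by rewrite lee_pmul2l//; exact: hausdorff_ub.
rewrite -lee_pdivrMl//; apply: le_ereal_inf_tmp => _ [E [AE Ed] <-].
rewrite lee_pdivrMl// -nneseriesZl//; last by move=> k _; exact: diams_ge0.
pose P k (u : T) := A u /\ E k u.
pose F k : set (borelRn R n.+1) := if pselect (exists u, P k u) is left h
  then [set y | enorm (sval (cid h) - (y : T)) <= fine (ediam (E k))]%R else set0.
have mF k : measurable (F k) by rewrite /F; case: pselect => // h; exact: measurable_cball.
have fin k : ediam (E k) \is a fin_num.
  by rewrite ge0_fin_numE ?ediam_ge0// (le_lt_trans (Ed k))// ltry.
have sF k : (sigma (F k) <= (4 * 4 ^+ n)%:E * diams n (E k))%E.
  rewrite /F; case: pselect => [h|_]; last first.
    by rewrite measure0; apply: mule_ge0; [rewrite lee_fin ltW|exact: diams_ge0].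
  case: cid => u /= [Au Eu].
  apply: (le_trans (cone_measure_cball_le (AS _ Au) _)).
    by rewrite fine_ge0// ediam_ge0.
  by rewrite /diams -(fineK (fin k)) -EFin_expe -EFinM exprMn mulrA fineK.
apply: (@le_trans _ _ (\sum_(k <oo) sigma (F k))%E).
  apply: measure_sigma_subadditive => // x Ax.
  have [k _ Ek] := AE _ Ax; exists k => //; rewrite /F.
  case: pselect => [h|[]]; last by exists x.
  case: cid => u /= [Au Eu]; rewrite -lee_fin fineK//; exact: ediam_ub.
by apply: lee_nneseries => k _ //; move=> _; exact: measure_ge0.
Qed.

(** Where the [i]-th coordinate has a given sign and is bounded away from 0, it is
    a Lipschitz function of the other ones; a cell fixes [i], the sign, and the cube of
    mesh [1 / N] which contains the other coordinates.  There are of the order of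
    [N ^ n] cells. *)
Definition cell (N : nat) (c : 'I_n.+1 * bool * {ffun 'I_n -> 'I_N.*2.+1}) : set T :=
  [set u | [/\ S u, n.+2%:R^-1 < (-1) ^+ c.1.2 * u 0 c.1.1 &
     forall j, (c.2 j)%:R <= (u 0 (lift c.1.1 j) + 1) * N%:R < (c.2 j).+1%:R]].

Arguments cell : clear implicits.

Lemma cell_cover N u : S u -> exists c, cell N c u.
Proof.
move=> Su.
have [i ui] : exists i, n.+2%:R^-1 < `|u 0 i|.
  apply: contrapT => /forallNP h.
  have : enorm u <= n.+1%:R * n.+2%:R^-1.
    by apply: enorm_le_coord => i; rewrite leNgt; apply/negP; exact: h.
  by rewrite (Su : enorm u = 1) ler_pdivlMr// mul1r ler_nat ltnn.
pose k (j : 'I_n) := Num.trunc ((u 0 (lift i j) + 1) * N%:R).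
have uj j : 0 <= u 0 j + 1 <= 2.
  have := coord_le_enorm u j; rewrite (Su : enorm u = 1) ler_norml => /andP[? ?].
  by apply/andP; split; lra.
have kP j : (k j < N.*2.+1)%N.
  rewrite /k truncn_lt_nat; last by rewrite mulr_ge0//; case/andP: (uj (lift i j)).
  apply: (@le_lt_trans _ _ (2 * N%:R)).
    by rewrite ler_wpM2r//; case/andP: (uj (lift i j)).
  by rewrite -natrM mul2n ltr_nat.
exists ((i, u 0 i < 0), [ffun j => Ordinal (kP j)]); split => //=.
  apply: (lt_le_trans ui); case: ltP => ui0; first by rewrite expr1 mulN1r ltr0_norm.
  by rewrite expr0 mul1r ger0_norm.
move=> j; rewrite ffunE /=; apply: truncn_itv.
by rewrite mulr_ge0//; case/andP: (uj (lift i j)).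
Qed.

(** The squares of the coordinates sum to 1, so that the other coordinates control the
    difference of the squares of the [i]-th ones; the sum of the latter is bounded below
    because their signs agree. *)
Lemma cell_diam N c : (0 < N)%N ->
  (ediam (cell N c) <= (n.+1%:R * (n.+1%:R * n.+2%:R) / N%:R)%:E)%E.
Proof.
move=> N0; have N0' : 0 < N%:R :> R by rewrite ltr0n.
case: c => [[i b] k]; apply: ediam_le => [|u v].
  by rewrite lee_fin !mulr_ge0// invr_ge0 ltW.
move=> [Su ui uk] [Sv vi vk]; rewrite lee_fin -mulrA; apply: enorm_le_coord.
have uvj j : `|u 0 (lift i j) - v 0 (lift i j)| <= N%:R^-1.
  have /andP[a1 a2] := uk j; have /andP[b1 b2] := vk j.
  rewrite -(ler_pM2r N0') mulVf ?gt_eqF// -[X in _ * X]gtr0_norm// -normrM.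
  move: a1 a2 b1 b2; rewrite /= -natr1 mulrBl !mulrDl !mul1r => ? ? ? ?.
  by rewrite ler_norml; apply/andP; split; lra.
have n1 : N%:R^-1 <= n.+1%:R * n.+2%:R / N%:R :> R.
  have h : 1 <= n.+1%:R * n.+2%:R :> R by rewrite -natrM ler1n.
  by apply: ler_peMl => //; rewrite invr_ge0 ltW.
move=> l; rewrite !mxE; case: (unliftP i l) => [j|] ->.
  exact: le_trans (uvj j) n1.
have crd (w : T) j : S w -> `|w 0 j| <= 1.
  by move=> Sw; apply: le_trans (coord_le_enorm w j) _; rewrite (Sw : enorm w = 1).
have sq (w : T) : S w -> w 0 i ^+ 2 = 1 - \sum_(j < n) w 0 (lift i j) ^+ 2.
  move=> Sw; have := enorm_sqr w; rewrite (Sw : enorm w = 1) expr1n /dot => ->.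
  rewrite (bigD1_ord i)//= expr2 -addrA -sumrB big1 ?addr0// => j _.
  by rewrite expr2 subrr.
pose s : R := (-1) ^+ b.
have s2 : s * s = 1 by rewrite /s -expr2 sqrr_sign.
have E : (u 0 i - v 0 i) * (s * u 0 i + s * v 0 i) = s * \sum_(j < n) (v 0 (lift i j) ^+ 2 - u 0 (lift i j) ^+ 2).
  have -> : (u 0 i - v 0 i) * (s * u 0 i + s * v 0 i) = s * (u 0 i ^+ 2 - v 0 i ^+ 2) by ring.
  by rewrite (sq u)// (sq v)// sumrB; ring.
have B : `|\sum_(j < n) (v 0 (lift i j) ^+ 2 - u 0 (lift i j) ^+ 2)| <= n%:R * (2 / N%:R).
  apply: (le_trans (ler_norm_sum _ _ _)).
  apply: (@le_trans _ _ (\sum_(j < n) (2 / N%:R))); last by rewrite sumr_const card_ord -[leLHS]mulr_natl lexx.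
  apply: ler_sum => j _; rewrite subr_sqr normrM mulrC ler_pM//.
    by apply: (le_trans (ler_normD _ _)); have := crd v (lift i j) Sv; have := crd u (lift i j) Su; lra.
  by rewrite distrC.
have k0 : 0 < n.+2%:R^-1 :> R by rewrite invr_gt0.
have [uv0 uv1] : 0 <= s * u 0 i + s * v 0 i /\ 2 * n.+2%:R^-1 <= s * u 0 i + s * v 0 i.
  move: ui vi k0; rewrite /= -/s; move: (n.+2%:R^-1) (s * u 0 i) (s * v 0 i) => p q r ? ? ?.
  by split; lra.
have C : `|u 0 i - v 0 i| * (2 * n.+2%:R^-1) <= n%:R * (2 / N%:R).
  have s1 : `|s| = 1 by rewrite /s normr_sign.
  apply: le_trans B; set t := \sum_(j < n) _; rewrite -[`|t|]mul1r -[X in X * `|t|]s1 -normrM -E normrM ler_wpM2l// ger0_norm//.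
rewrite -(ler_pM2r (_ : 0 < 2 * n.+2%:R^-1)); last by rewrite mulr_gt0.
apply: (le_trans C).
rewrite [leRHS](_ : _ = n.+1%:R * (2 / N%:R) * (n.+2%:R * n.+2%:R^-1)); last first.
  by move: (n.+2%:R^-1 : R) (n.+2%:R : R) (n.+1%:R : R) (N%:R^-1 : R) => ? ? ? ?; ring.
by rewrite divff ?mulr1 ?pnatr_eq0// ler_wpM2r ?mulr_ge0 ?invr_ge0// ler_nat.
Qed.

(** There are of the order of [N ^ n] cells, each of diameter of the order of [1 / N]. *)
Lemma hausdorff_sphere_fin : (H S < +oo)%E.
Proof.
pose K : R := n.+1%:R * (n.+1%:R * n.+2%:R).
have K0 : 0 <= K by rewrite !mulr_ge0.
apply: (@le_lt_trans _ _ ((n.+1 * 2)%:R * (3 * K) ^+ n)%:E); last exact: ltry.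
apply: hausdorff_le => d d0.
(* the mesh for which all cells have diameter at most [d] *)
pose N := (Num.trunc (K / d)).+1.
have N0 : 0 < N%:R :> R by [].
have KN : K / N%:R <= d.
  by rewrite ler_pdivrMr// mulrC -ler_pdivrMr// ltW// truncnS_gt.
pose F : finType := ('I_n.+1 * bool * {ffun 'I_n -> 'I_N.*2.+1})%type.
pose E (p : nat) : set T := if insub p is Some q then cell N (enum_val (q : 'I_#|F|)) else set0.
have dE p : (ediam (E p) <= (K / N%:R)%:E)%E.
  rewrite /E; case: insubP => [q _ _|_]; first exact: cell_diam.
  by rewrite ediam0 lee_fin divr_ge0// ltW.
apply: (le_trans (@hausdorff_delta_le R n.+1 n d _ E _ _)).
- move=> u Su; have [c cu] := cell_cover N Su.
  exists (enum_rank c) => //; rewrite /E; case: insubP => [q _ qc|/negP[]//].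
  by rewrite (_ : q = enum_rank c) ?enum_rankK//; exact: val_inj.
- by move=> k; apply: (le_trans (dE k)); rewrite lee_fin.
rewrite (nneseries_split 0 #|F|); last by move=> k _; exact: diams_ge0.
rewrite [X in (_ + X)%E]eseries0 ?adde0; last first.
  move=> k Fk _; rewrite /E insubN ?diams0// -leqNgt; exact: Fk.
apply: (@le_trans _ _ (\sum_(0 <= k < 0 + #|F|) (((K / N%:R) ^+ n)%:E))%E).
  apply: lee_sum => k _; rewrite EFin_expe; apply: le_expe; last exact: dE.
  exact: ediam_ge0.
rewrite sumEFin lee_fin sumr_const_nat subn0 add0n /F !card_prod card_ord card_bool card_ffun !card_ord.
rewrite -[leLHS]mulr_natl natrM -mulrA ler_wpM2l// natrX -exprMn.
apply: lerXn2r; first by rewrite nnegrE mulr_ge0// divr_ge0// ltW.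
  by rewrite nnegrE mulr_ge0.
rewrite mulrA ler_pdivrMr// mulrAC ler_wpM2r//.
by rewrite -natrM ler_nat /N; lia.
Qed.

(** Both measures are invariant under reflections, hence uniform in the sense of
    [measure_uniform]. *)
Lemma hausdorff_cone : exists2 c : R, 0 < c &
  forall A : set (borelRn R n.+1), measurable A -> A `<=` S -> H A = (c%:E * sigma A)%E.
Proof.
have [m mE] := @hausdorff_measure R n.+1 n n_gt0.
pose M := [the {measure set _ -> \bar R} of mrestr m measurable_sphere].
have ME A : M A = H (A `&` S) by rewrite /M/= /mrestr mE.
have sf : sigma_finite setT M.
  exists (fun=> setT); first by rewrite bigcup_const.
  by move=> k; split => //; rewrite ME setTI; exact: hausdorff_sphere_fin.
have [M1 M1E] := sigma_finite_ex sf.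
pose e : T := delta_mx 0 ord0.
have Se : S e.
  rewrite /sphere/= /enorm /dot big_ord_recl/= mxE !eqxx mulr1 big1 ?addr0 ?sqrtr1// => j _.
  by rewrite mxE andbC mulr0.
pose h1 r := fine (H (eball e r `&` S)).
pose h2 r := fine (sigma (eball e r)).
have fin1 r : H (eball e r `&` S) \is a fin_num.
  rewrite ge0_fin_numE ?hausdorff_ge0//; apply: le_lt_trans hausdorff_sphere_fin.
  by apply: le_hausdorff => x [].
have fin2 r : sigma (eball e r) \is a fin_num.
  by rewrite ge0_fin_numE// cone_measure_fin//; exact: measurable_eball.
have h20 r : 0 < r -> 0 < h2 r.
  by move=> r0; rewrite -lte_fin fineK// cone_measure_eball_gt0.
have [|||||||c c0 cP] := @measure_uniform R n.+1 M1 sigma S h1 h2 measurable_sphere.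
- by rewrite M1E ME setICl hausdorff0.
- exact: cone_measure_conull.
- move=> x r Sx r0; rewrite M1E ME fineK//.
  have FT w (y : T) : w != 0 -> reflect_row w @^-1` (eball y r `&` S) = eball (reflect_row w y) r `&` S.
    move=> w0; rewrite preimage_setI preimage_reflect_eball//; congr (_ `&` _).
    by apply/seteqP; split=> z; rewrite /sphere/= enorm_reflect.
  have mF (y : T) : measurable (eball y r `&` S).
    by apply: measurableI; [exact: measurable_eball|exact: measurable_sphere].
  have HT w (A : set (borelRn R n.+1)) : w != 0 -> measurable A -> H (reflect_row w @^-1` A) = H A.
    by move=> w0 _; exact: hausdorff_reflect.
  exact: (eball_reflect_inv HT (F := fun y => eball y r `&` S) FT mF Sx Se).
- move=> x r Sx r0; rewrite fineK//.
  have sT w (A : set (borelRn R n.+1)) : w != 0 -> measurable A -> sigma (reflect_row w @^-1` A) = sigma A.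
    exact: cone_measure_reflect.
  apply: (@eball_reflect_inv sigma sT x e (fun y => eball y r) _ _ Sx Se).
    by move=> w y w0; rewrite preimage_reflect_eball.
  by move=> y; exact: measurable_eball.
- move=> r r0; rewrite -lte_fin fineK//.
  have mB : measurable (eball e r `&` S).
    by apply: measurableI; [exact: measurable_eball|exact: measurable_sphere].
  have := cone_measure_le_hausdorff mB (@subIsetr _ _ _).
  rewrite setIC (measure_conull measurable_sphere cone_measure_conull); last exact: measurable_eball.
  move=> h; rewrite lt_neqAle hausdorff_ge0 andbT eq_sym; apply/eqP => h0.
  by move: h; rewrite h0 mule0 leNgt cone_measure_eball_gt0.
- exact: h20.
- by exists e.
- exists c => // A mA AS; rewrite -cP// M1E ME; congr H.
  by apply/esym/setIidPl.
Qed.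

End SphereMeasure.

(** * Integration in polar coordinates *)

Section Polar.
Context {R : realType} (n : nat).
Local Notation T := ('rV[R]_n.+1).
Local Notation S := (sphere R n.+1 : set (borelRn R n.+1)).
Local Notation leb := (@leb R n.+1).
Local Notation sigma := (@cone_measure R n).
Local Notation lambda := (@lebesgue_measure R).

Lemma leb_set0 : leb [set (0 : T)] = 0%E.
Proof.
apply/eqP; rewrite eq_le measure_ge0 andbT.
have <- : leb (box n.+1 0) = 0%E by rewrite leb_box_val// mul0rn expr0n.
apply: le_measure; rewrite ?inE; [|exact: measurable_box|].
  by apply: measurable_closedRn; apply: accessible_closed_set1; apply: hausdorff_accessible; exact: norm_hausdorff.
by move=> x -> i; rewrite mxE normr0.
Qed.

Lemma integral_leb_scale (r : R) (f : borelRn R n.+1 -> \bar R) : 0 < r ->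
  measurable_fun setT f -> (forall x, 0 <= f x)%E ->
  (\int[leb]_x f (r *: (x : T)) = (r ^- n.+1)%:E * \int[leb]_x f x)%E.
Proof.
move=> r0 mf f0.
pose g (x : borelRn R n.+1) : borelRn R n.+1 := r *: (x : T).
have mg : measurable_fun setT g.
  have := @measurable_affine R n.+1 r 0.
  by congr measurable_fun; apply/funext => x; rewrite addr0.
have [m mE] := pushforward_measure leb mg.
have k0 : 0 <= r ^- n.+1 by rewrite invr_ge0 exprn_ge0// ltW.
transitivity (\int[pushforward leb g]_x f x)%E.
  by rewrite ge0_integral_pushforward// preimage_setT.
transitivity (\int[mscale (NngNum k0) leb]_x f x)%E; last by rewrite ge0_integral_mscale.
transitivity (\int[m]_x f x)%E; first by apply: eq_measure_integral => A mA _; rewrite mE.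
apply: eq_measure_integral => A mA _; rewrite mE.
rewrite [RHS](_ : _ = (r ^- n.+1)%:E * leb A)%E// -(leb_affine 0 r0 mA).
by congr (leb _); apply/seteqP; split=> x; rewrite /g/= addr0.
Qed.

Lemma integral_cone_measure (f : borelRn R n.+1 -> \bar R) :
  measurable_fun setT f -> (forall x, 0 <= f x)%E ->
  (\int[sigma]_u f u = \int[leb]_x (f (radial (x : T)) * (\1_(@shell R n) x)%:E))%E.
Proof.
move=> mf f0.
pose M := [the {measure set _ -> \bar R} of mrestr leb (@measurable_shell R n)].
transitivity (\int[pushforward M (radial : borelRn R n.+1 -> borelRn R n.+1)]_x f x)%E.
  have [m mE] := pushforward_measure M (@measurable_radial R n).
  transitivity (\int[m]_x f x)%E; last first.
    apply: eq_measure_integral => [|mr A mA _]; first exact: measurable_radial.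
    by rewrite mE.
  by apply: eq_measure_integral => A mA _; rewrite mE; exact: cone_measureE.
rewrite ge0_integral_pushforward//; last exact: measurable_radial.
rewrite preimage_setT (integral_density_measure (m := leb) (w := \1_(@shell R n)))//.
- by apply: measurable_indic; exact: measurable_shell.
- move=> A mA; rewrite /M/= /mrestr integral_indic//; last exact: measurable_shell.
  by rewrite setIC.
- by apply: measurableT_comp => //; exact: measurable_radial.
- by move=> x _; exact: f0.
Qed.

Lemma integral_lebesgue_scale (r : R) (f : R -> \bar R) : 0 < r ->
  measurable_fun setT f -> (forall x, 0 <= f x)%E ->
  (\int[lambda]_x f x = r%:E * \int[lambda]_x f (r * x)%R)%E.
Proof.
move=> r0 mf f0; have := integral_lebesgue_affine 0 r0 mf f0.
under eq_integral do rewrite addr0.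
by move=> ->; rewrite muleA -EFinM divff ?gt_eqF// mul1e.
Qed.

Lemma measurable_invr : measurable_fun setT (@GRing.inv R).
Proof.
rewrite (_ : @GRing.inv R = fun x : R => if x < 0 then - ((- x) `^ (-1)) else x `^ (-1)).
  apply: measurable_fun_ifT.
  - by apply: measurable_fun_ltr.
  - apply: measurableT_comp => //.
    by apply: (measurableT_comp (measurable_powR (-1))) => //; exact: measurableT_comp.
  - exact: measurable_powR.
apply/funext => x; case: ltP => x0; last by rewrite powR_inv1.
by rewrite powR_inv1 ?invrN ?opprK// oppr_ge0 ltW.
Qed.

(** The Jacobian of polar coordinates, cut off so that integrals over the radii
    are integrals over the whole line. *)
Definition ppow k (t : R) : R := if 0 < t then t ^+ k else 0.

Lemma ppow_ge0 k t : 0 <= ppow k t.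
Proof. by rewrite /ppow; case: ifP => // t0; rewrite exprn_ge0// ltW. Qed.

Lemma measurable_ppow k : measurable_fun setT (ppow k).
Proof.
by apply: measurable_fun_ifT => //; exact: measurable_fun_ltr.
Qed.

Lemma measurable_scale2 d (X : measurableType d) (f : X -> R) (g : X -> borelRn R n.+1) :
  measurable_fun setT f -> measurable_fun setT g ->
  measurable_fun setT (fun x => f x *: (g x : T) : borelRn R n.+1).
Proof.
move=> mf mg; apply: measurable_fun_toRn => // i.
under eq_fun do rewrite mxE.
apply: measurable_funM => //.
exact: (@measurableT_comp _ _ _ _ _ _ (fun y : borelRn R n.+1 => (y : T) 0 i) _ g (measurable_coordRn i)).
Qed.

(** An auxiliary weight in Tonelli's theorem: its integral over a ray for the measure
    [dt / t] does not depend on the ray ([ampZ]). *)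
Let amp (x : borelRn R n.+1) : R := \1_(@shell R n) x * enorm (x : T) ^+ n.+1.

Let amp_ge0 x : 0 <= amp x.
Proof. by rewrite /amp mulr_ge0// exprn_ge0// enorm_ge0. Qed.

Let measurable_amp : measurable_fun setT amp.
Proof.
apply: measurable_funM; first by apply: measurable_indic; exact: measurable_shell.
by apply: measurable_funX; exact: measurable_enorm.
Qed.

Let weight (t : R) : R := if 0 < t then t^-1 * (\1_`[1, 2]%classic t^-1 * t^-1 ^+ n.+1) else 0.

Let ampZ (t : R) (y : T) : 0 < t -> y != 0 ->
  enorm y * ((enorm y * t)^-1 * amp ((enorm y * t)^-1 *: y)) = weight t.
Proof.
move=> t0 y0; have e0 : 0 < enorm y by rewrite enorm_gt0.
rewrite /weight t0 /amp.
have -> : enorm ((enorm y * t)^-1 *: y) = t^-1.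
  rewrite enormZ ger0_norm ?invr_ge0 ?mulr_ge0 ?enorm_ge0// ?ltW//.
  by rewrite invfM mulrAC mulVf ?mul1r// gt_eqF.
have -> : \1_(@shell R n) ((enorm y * t)^-1 *: y) = \1_`[1, 2]%classic t^-1 :> R.
  rewrite !indicE; congr (_ %:R); congr nat_of_bool.
  have E : enorm ((enorm y * t)^-1 *: y) = t^-1.
    rewrite enormZ ger0_norm ?invr_ge0 ?mulr_ge0 ?enorm_ge0// ?ltW//.
    by rewrite invfM mulrAC mulVf ?mul1r// gt_eqF.
  by apply/idP/idP => /set_mem h; apply/mem_set; move: h; rewrite /shell/= in_itv/= E.
by rewrite invfM !mulrA divff ?gt_eqF// mul1r.
Qed.

Let weight_ge0 t : 0 <= weight t.
Proof.
rewrite /weight; case: ifP => // t0; rewrite mulr_ge0 ?invr_ge0 ?(ltW t0)//.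
by rewrite mulr_ge0// exprn_ge0// invr_ge0 ltW.
Qed.

Let measurable_weight : measurable_fun setT weight.
Proof.
apply: measurable_fun_ifT => //; first exact: measurable_fun_ltr.
apply: measurable_funM; first exact: measurable_invr.
apply: measurable_funM.
  by apply: (@measurableT_comp _ _ _ _ _ _ (\1_`[1, 2]%classic : R -> R) _ (@GRing.inv R)) => //; exact: measurable_invr.
by apply: measurable_funX; exact: measurable_invr.
Qed.

(** The common value of the integrals of [amp] over the rays; it is equal to
    [(2 ^ n.+1 - 1) / n.+1]. *)
Definition polar_constant : \bar R := \int[lambda]_t (weight t)%:E.

Lemma polar_constant_gt0 : (0 < polar_constant)%E.
Proof.
apply: (@lt_le_trans _ _ (\int[lambda]_t (\1_`[2^-1, 1]%classic t)%:E)%E).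
  rewrite integral_indic// setIT -[X in (_ < X)%E]/(lambda `[2^-1, 1]%classic) lebesgue_measure_itv/= lte_fin ifT; last by lra.
  by rewrite -EFinB lte_fin; lra.
apply: ge0_le_integral => //.
- by apply/measurable_EFinP.
- by apply/measurable_EFinP.
move=> t _; rewrite lee_fin indicE; case: (boolP (_ \in _)) => [/set_mem/=|_]; last exact: weight_ge0.
rewrite in_itv/= => /andP[t1 t2].
have t0 : 0 < t by apply: lt_le_trans t1; rewrite invr_gt0.
have t3 : 1 <= t^-1 by rewrite invf_ge1.
rewrite /weight t0 indicE mem_set/=; last first.
  by rewrite in_itv/= t3/= -[2]invrK lef_pV2 ?posrE ?invr_gt0.
by rewrite mul1r -exprS exprn_ege1.
Qed.

Lemma polar_constant_fin : (polar_constant < +oo)%E.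
Proof.
apply: (@le_lt_trans _ _ (\int[lambda]_t ((2 ^+ n.+2)%:E * (\1_`[2^-1, 1]%classic t)%:E))%E).
  apply: ge0_le_integral => //.
  - by move=> t _; rewrite lee_fin.
  - by apply/measurable_EFinP.
  - by apply/measurable_EFinP; apply: measurable_funM.
  move=> t _; rewrite -EFinM lee_fin /weight; case: ifP => t0; last by rewrite mulr_ge0.
  rewrite indicE; case: (boolP (_ \in _)) => [/set_mem/=|_]; last by rewrite mul0r mulr0 mulr_ge0.
  rewrite in_itv/= => /andP[t1 t2].
  have h : 2^-1 <= t <= 1.
    by rewrite -[t]invrK lef_pV2 ?posrE ?invr_gt0// t2/= invf_le1 ?invr_gt0.
  rewrite indicE mem_set/=; last by rewrite in_itv.
  rewrite mulr1 mul1r -exprS; apply: lerXn2r; rewrite ?nnegrE ?invr_ge0// ltW//.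
rewrite ge0_integralZl//; last by apply/measurable_EFinP.
rewrite integral_indic// setIT -[X in (_ * X)%E]/(lambda `[2^-1, 1]%classic) lebesgue_measure_itv/= lte_fin ifT; last by lra.
by rewrite -EFinB -EFinM ltry.
Qed.

Variables (F : borelRn R n.+1 -> \bar R).
Hypotheses (mF : measurable_fun setT F) (F0 : forall x, (0 <= F x)%E).
Local Open Scope ereal_scope.

Let ray (x : borelRn R n.+1) := \int[lambda]_r (F (r *: (x : T))%R * (ppow n r)%:E).

Let mray2 : measurable_fun setT (fun p : borelRn R n.+1 * R => F (p.2 *: (p.1 : T))%R * (ppow n p.2)%:E).
Proof.
apply: emeasurable_funM.
  by apply: (measurableT_comp mF); apply: measurable_scale2.
by apply/measurable_EFinP; apply: (measurableT_comp (measurable_ppow n)).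
Qed.

Let ray_ge0 x : 0 <= ray x.
Proof. by apply: integral_ge0 => r _; rewrite mule_ge0// lee_fin ppow_ge0. Qed.

Let measurable_ray : measurable_fun setT ray.
Proof.
apply: (@measurable_fun_fubini_tonelli_F _ _ _ _ _ lambda (fun p : borelRn R n.+1 * R => F (p.2 *: (p.1 : T))%R * (ppow n p.2)%:E)) => //.
by move=> p; rewrite mule_ge0// lee_fin ppow_ge0.
Qed.

Let ray_radial (x : T) : x != 0%R -> ray (radial x) = (enorm x ^+ n.+1)%:E * ray x.
Proof.
move=> x0; have e0 : (0 < enorm x)%R by rewrite enorm_gt0.
have mr (y : T) : measurable_fun setT (fun r : R => F (r *: y)%R * (ppow n r)%:E).
  apply: emeasurable_funM; last by apply/measurable_EFinP; exact: measurable_ppow.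
  by apply: (measurableT_comp mF); apply: measurable_scale2.
have r0 (y : T) (r : R) : 0 <= F (r *: y)%R * (ppow n r)%:E.
  by rewrite mule_ge0// lee_fin ppow_ge0.
rewrite /ray (integral_lebesgue_scale e0)// -[RHS]ge0_integralZl//; last 2 first.
- exact: mr.
- by rewrite lee_fin exprn_ge0// ltW.
rewrite -[LHS]ge0_integralZl//; last 2 first.
- rewrite [X in measurable_fun _ X](_ : _ = (fun r : R => F (r *: x)%R * (ppow n (enorm x * r))%:E)).
    apply: emeasurable_funM.
      by apply: (measurableT_comp mF); apply: measurable_scale2.
    apply/measurable_EFinP; apply: (measurableT_comp (measurable_ppow n)).
    exact: mulrl_measurable.
  by apply/funext => r; rewrite /radial scalerA mulrAC divff ?mul1r// gt_eqF.
- by rewrite lee_fin enorm_ge0.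
apply: eq_integral => r _; rewrite /radial scalerA mulrAC divff ?gt_eqF// mul1r.
rewrite muleCA [RHS]muleCA; congr (_ * _); rewrite -!EFinM; congr EFin.
rewrite /ppow pmulr_rgt0//; case: ifP => _; last by rewrite !mulr0.
by rewrite exprMn mulrA -exprS.
Qed.

Let meas_b : measurable_fun setT (fun p : R * borelRn R n.+1 =>
  ((if (0 < p.1)%R then p.1^-1 * amp (p.1^-1 *: (p.2 : T)) else 0)%R)%:E * F p.2).
Proof.
apply: emeasurable_funM; last exact: (measurableT_comp mF).
apply/measurable_EFinP; apply: measurable_fun_ifT => //.
  by apply: measurable_fun_ltr => //; exact: measurable_fst.
have mi : measurable_fun setT (fun p : R * borelRn R n.+1 => (p.1^-1)%R).
  by apply: (measurableT_comp measurable_invr); exact: measurable_fst.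
apply: measurable_funM => //.
apply: (measurableT_comp measurable_amp).
by apply: measurable_scale2 => //; exact: measurable_snd.
Qed.

(** Polar coordinates by Tonelli's theorem alone.  On the left, insert the definition of
    the cone measure as an integral over the shell; scaling [x] for fixed [r], then
    integrating over [r] for a fixed [y = r *: x], leaves the same factor
    [polar_constant] for all [y]. *)
Theorem polar_integral :
  \int[sigma]_u \int[lambda]_r (F (r *: (u : T))%R * (ppow n r)%:E) =
  polar_constant * \int[leb]_x F x.
Proof.
rewrite integral_cone_measure//.
pose G (p : borelRn R n.+1 * R) := (amp p.1)%:E * (F (p.2 *: (p.1 : T))%R * (ppow n p.2)%:E).
have mG : measurable_fun setT G.
  apply: emeasurable_funM => //.
  by apply/measurable_EFinP; apply: (measurableT_comp measurable_amp); exact: measurable_fst.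
have G0 p : 0 <= G p.
  by rewrite mule_ge0 ?lee_fin ?amp_ge0// mule_ge0// lee_fin ppow_ge0.
pose B (p : R * borelRn R n.+1) :=
  ((if (0 < p.1)%R then p.1^-1 * amp (p.1^-1 *: (p.2 : T)) else 0)%R)%:E * F p.2.
have B0 p : 0 <= B p.
  rewrite mule_ge0// lee_fin; case: ifP => // p0.
  by rewrite mulr_ge0 ?amp_ge0// invr_ge0 ltW.
transitivity (\int[leb]_x \int[lambda]_r G (x, r)).
  apply: eq_integral => x _.
  rewrite /G/= ge0_integralZl//; last 3 first.
  - apply: emeasurable_funM; last by apply/measurable_EFinP; exact: measurable_ppow.
    by apply: (measurableT_comp mF); apply: measurable_scale2.
  - by move=> r _; rewrite mule_ge0// lee_fin ppow_ge0.
  - by rewrite lee_fin amp_ge0.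
  rewrite -/(ray (radial (x : T))) -/(ray x) /amp indicE.
  case: (boolP (x \in _)) => [/set_mem xs|_]; last by rewrite mul0r mule0 mul0e.
  by rewrite mule1 mul1r ray_radial//; exact: shell_neq0 xs.
rewrite [LHS](fubini_tonelli (m1 := leb) (m2 := lambda) G)//.
transitivity (\int[lambda]_r \int[leb]_y B (r, y)).
  apply: eq_integral => r _; rewrite /G /B/=.
  have [r0|r0] := ltP 0%R r; last first.
    rewrite !integral0_eq// => x _; first by rewrite mul0e.
    by rewrite /ppow ltNge r0/= !mule0.
  have mg : measurable_fun setT (fun y : borelRn R n.+1 => (amp (r^-1 *: (y : T))%R)%:E * F y).
    apply: emeasurable_funM => //; apply/measurable_EFinP; apply: (measurableT_comp measurable_amp).
    by apply: measurable_scale2.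
  have := integral_leb_scale r0 mg (fun y => mule_ge0 (amp_ge0 _ : 0 <= (amp _)%:E) (F0 y)).
  under eq_integral do rewrite scalerA mulVf ?gt_eqF// scale1r.
  under [in X in _ -> X = _]eq_integral do rewrite muleA muleC.
  rewrite ge0_integralZl//; last 3 first.
  - apply: emeasurable_funM; first by apply/measurable_EFinP.
    by apply: (measurableT_comp mF); apply: measurable_scale2.
  - by move=> x _; rewrite mule_ge0// lee_fin amp_ge0.
  - by rewrite lee_fin ppow_ge0.
  move=> ->.
  under [RHS]eq_integral do rewrite EFinM -muleA.
  rewrite [RHS]ge0_integralZl//; last 2 first.
  - by move=> x _; rewrite mule_ge0// lee_fin amp_ge0.
  - by rewrite lee_fin invr_ge0 ltW.
  rewrite muleA -EFinM; congr (_%:E * _).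
  by rewrite /ppow r0 exprS invfM mulrCA divff ?mulr1// expf_neq0// gt_eqF.
rewrite [LHS](fubini_tonelli (m1 := lambda) (m2 := leb) B)//.
transitivity (\int[leb]_y (polar_constant * F y)); last first.
  by rewrite ge0_integralZl// ltW// polar_constant_gt0.
apply: ge0_ae_eq_integral => //.
- by apply: (measurable_fun_fubini_tonelli_G (m1 := lambda) B).
- by apply: emeasurable_funM.
- by move=> y _; apply: integral_ge0.
- by move=> y _; rewrite mule_ge0// ltW// polar_constant_gt0.
exists [set (0%R : T)]; split; [|exact: leb_set0|].
  by apply: measurable_closedRn; apply: accessible_closed_set1; apply: hausdorff_accessible; exact: norm_hausdorff.
move=> y /= /not_implyP[_ H]; apply: contrapT => /eqP y0; apply: H.
have e0 : (0 < enorm (y : T))%R by rewrite enorm_gt0.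
rewrite /B/=; have mb : measurable_fun setT (fun r : R => (if (0 < r)%R then r^-1 * amp (r^-1 *: (y : T)) else 0)%R).
  apply: measurable_fun_ifT => //; first exact: measurable_fun_ltr.
  apply: measurable_funM; first exact: measurable_invr.
  apply: (measurableT_comp measurable_amp).
  by apply: measurable_scale2 => //; exact: measurable_invr.
have b0 (r : R) : (0 <= (if (0 < r)%R then r^-1 * amp (r^-1 *: (y : T)) else 0))%R.
  by case: ifP => // p0; rewrite mulr_ge0 ?amp_ge0// invr_ge0 ltW.
rewrite ge0_integralZr//; last 2 first.
- by apply/measurable_EFinP; exact: mb.
- by move=> r _; rewrite lee_fin.
congr (_ * _).
rewrite (integral_lebesgue_scale e0)//; last by apply/measurable_EFinP.
rewrite -ge0_integralZl//; last 3 first.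
- apply/measurable_EFinP; apply: (measurableT_comp mb).
  exact: mulrl_measurable.
- by move=> t _; rewrite lee_fin.
- by rewrite lee_fin enorm_ge0.
apply: eq_integral => t _; rewrite -EFinM; congr EFin.
rewrite pmulr_rgt0//; case: ifP => t0; first exact: ampZ.
by rewrite /weight t0 mulr0.
Qed.

End Polar.

(** * The radial law and a one-dimensional Poincare inequality *)

Section DeriveRules.
Context {R : realType}.
Implicit Types (f g : R -> R) (t a b k : R).

Lemma der_eq f t a b : is_derive t 1 f a -> a = b -> is_derive t 1 f b.
Proof. by move=> h <-. Qed.

Lemma der_cst k t : is_derive t 1 (fun _ : R => k) 0.
Proof. exact: is_derive_cst. Qed.

Lemma derD f g t a b : is_derive t 1 f a -> is_derive t 1 g b ->
  is_derive t 1 (fun s => f s + g s) (a + b).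
Proof. by move=> h1 h2; exact: is_deriveD. Qed.

Lemma derN f t a : is_derive t 1 f a -> is_derive t 1 (fun s => - f s) (- a).
Proof. by move=> h1; exact: is_deriveN. Qed.

Lemma derB f g t a b : is_derive t 1 f a -> is_derive t 1 g b ->
  is_derive t 1 (fun s => f s - g s) (a - b).
Proof. by move=> h1 h2; exact: is_deriveB. Qed.

Lemma derM f g t a b : is_derive t 1 f a -> is_derive t 1 g b ->
  is_derive t 1 (fun s => f s * g s) (a * g t + f t * b).
Proof.
move=> h1 h2; apply: der_eq (is_deriveM h1 h2) _.
by rewrite /GRing.scale/= addrC mulrC.
Qed.

Lemma derZ f k t a : is_derive t 1 f a -> is_derive t 1 (fun s => k * f s) (k * a).
Proof. by move=> h; apply: der_eq (derM (der_cst k t) h) _; rewrite mul0r add0r. Qed.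

Lemma derV f t a : f t != 0 -> is_derive t 1 f a ->
  is_derive t 1 (fun s => (f s)^-1) (- a / f t ^+ 2).
Proof.
move=> f0 h; apply: der_eq (is_deriveV f0 h) _.
by rewrite /GRing.scale/= mulNr mulrC mulNr.
Qed.

Lemma der_comp f g t a b : is_derive (g t) 1 f a -> is_derive t 1 g b ->
  is_derive t 1 (fun s => f (g s)) (a * b).
Proof. by move=> h1 h2; exact: is_derive1_comp h1 h2. Qed.

Lemma der_continuous f t a : is_derive t 1 f a -> {for t, continuous f}.
Proof.
by move=> [h _]; apply: differentiable_continuous; apply/derivable1_diffP.
Qed.

End DeriveRules.

Section OneDim.
Context {R : realType} (al : R).
Hypothesis al_gt1 : 1 < al.
Local Notation lambda := (@lebesgue_measure R).
Implicit Types (a b c s t : R).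

Let al_gt0 : 0 < al. Proof. exact: lt_trans al_gt1. Qed.

Lemma continuous_pos_within (f : R -> R) a b : 0 < a ->
  (forall t, 0 < t -> {for t, continuous f}) -> {within `[a, b], continuous f}.
Proof.
move=> a0 cf; apply: continuous_in_subspaceT => t; rewrite inE/= in_itv/= => /andP[ta _].
by apply: cf; exact: lt_le_trans ta.
Qed.

Lemma continuousZ_pos k (f : R -> R) : (forall t, 0 < t -> {for t, continuous f}) ->
  forall t, 0 < t -> {for t, continuous (fun s => k * f s)}.
Proof. by move=> cf t t0; apply: continuousM; [exact: cst_continuous|exact: cf]. Qed.

Lemma integrable_pos (f : R -> R) a b : 0 < a ->
  (forall t, 0 < t -> {for t, continuous f}) ->
  lambda.-integrable `[a, b] (EFin \o f).
Proof.
move=> a0 cf; apply: continuous_compact_integrable; first exact: segment_compact.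
exact: continuous_pos_within.
Qed.

Lemma integral_pos_primitive (g G : R -> R) a b : 0 < a -> a < b ->
  (forall t, 0 < t -> is_derive t 1 G (g t)) ->
  (forall t, 0 < t -> {for t, continuous g}) ->
  (\int[lambda]_(t in `[a, b]) (g t)%:E = (G b - G a)%:E)%E.
Proof.
move=> a0 ab dG cg; rewrite (@continuous_FTC2 _ g G)//; first exact: continuous_pos_within.
- have cG t : 0 < t -> {for t, continuous G}.
    move=> t0; apply: differentiable_continuous; apply/derivable1_diffP.
    by have [] := dG _ t0.
  split.
  + move=> t; rewrite in_itv/= => /andP[ta _].
    by have [] := dG _ (lt_trans a0 ta).
  + by apply: cvg_at_right_filter; exact: cG.
  + by apply: cvg_at_left_filter; apply: cG; exact: lt_trans ab.
- move=> t; rewrite in_itv/= => /andP[ta _]; rewrite derive1E.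
  by have [_ ->] := dG _ (lt_trans a0 ta).
Qed.

Definition gexp t : R := expR (- (al^-1 * t `^ al)).

(** Up to normalization, the radial law of [mu] is [gam n].  A power of [t] only
    shifts [c], so that all moments of that law are integrals of some [gam c]. *)
Definition gam c t : R := if 0 < t then t `^ (c - 1) * gexp t else 0.

Lemma gexp_gt0 t : 0 < gexp t. Proof. exact: expR_gt0. Qed.

Lemma gexp_le1 t : gexp t <= 1.
Proof. by rewrite -[leRHS]expR0 ler_expR oppr_le0 mulr_ge0 ?invr_ge0 ?powR_ge0// ltW. Qed.

Lemma gam_ge0 c t : 0 <= gam c t.
Proof. by rewrite /gam; case: ifP => // t0; rewrite mulr_ge0 ?powR_ge0// ltW// gexp_gt0. Qed.

Lemma gam_gt0 c t : 0 < t -> 0 < gam c t.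
Proof. by move=> t0; rewrite /gam t0 mulr_gt0 ?powR_gt0// gexp_gt0. Qed.

Lemma measurable_gexp : measurable_fun setT gexp.
Proof.
apply: measurableT_comp => //; apply: measurableT_comp => //.
by apply: measurable_funM => //; exact: measurable_powR.
Qed.

Lemma measurable_gam c : measurable_fun setT (gam c).
Proof.
apply: measurable_fun_ifT => //; first exact: measurable_fun_ltr.
by apply: measurable_funM; [exact: measurable_powR|exact: measurable_gexp].
Qed.

Lemma gamM c s t : 0 < t -> t `^ s * gam c t = gam (c + s) t.
Proof.
move=> t0; rewrite /gam t0 mulrA -powRD; last by rewrite (gt_eqF t0) implybT.
by congr (_ `^ _ * _); ring.
Qed.

Lemma is_derive_gexp t : 0 < t ->
  is_derive t 1 gexp (- (t `^ (al - 1)) * gexp t).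
Proof.
move=> t0.
have dp := is_derive1_powR al t0.
have d1 : is_derive t 1 (fun s => - (al^-1 * s `^ al)) (- t `^ (al - 1)).
  by apply: der_eq (derN (derZ al^-1 dp)) _; rewrite mulrA mulVf ?mul1r// gt_eqF.
by apply: der_eq (der_comp (is_derive_expR _) d1) _; rewrite mulrC.
Qed.

Lemma is_derive_powR_gexp c t : 0 < t ->
  is_derive t 1 (fun s => s `^ c * gexp s) (c * gam c t - gam (c + al) t).
Proof.
move=> t0; apply: der_eq (derM (is_derive1_powR c t0) (is_derive_gexp t0)) _.
rewrite /gam t0.
have -> : c + al - 1 = c + (al - 1) by ring.
rewrite [t `^ (c + (al - 1))]powRD; last by rewrite (gt_eqF t0) implybT.
by ring.
Qed.

Lemma continuous_gexp t : 0 < t -> {for t, continuous gexp}.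
Proof.
move=> t0; apply: differentiable_continuous; apply/derivable1_diffP.
by have [] := is_derive_gexp t0.
Qed.

Lemma continuous_powR c t : 0 < t -> {for t, continuous (fun s : R => s `^ c)}.
Proof.
move=> t0; apply: differentiable_continuous; apply/derivable1_diffP.
by have [] := is_derive1_powR c t0.
Qed.

Lemma continuous_gam c t : 0 < t -> {for t, continuous (gam c)}.
Proof.
move=> t0; rewrite /prop_for /continuous_at {2}/gam t0.
have H : (fun s => s `^ (c - 1) * gexp s) @ t --> t `^ (c - 1) * gexp t.
  by apply: cvgM; [exact: continuous_powR|exact: continuous_gexp].
apply: cvg_trans H; apply: near_eq_cvg; near=> s; rewrite /gam ifT//.
by near: s; exact: lt_nbhsr.
Unshelve. all: by end_near. Qed.

(** A power is bounded by a multiple of a term of the exponential series. *)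
Lemma powR_gexp_bounded s : 0 <= s -> exists2 K, 0 < K & forall t, 0 < t -> t `^ s * gexp t <= K.
Proof.
move=> s0; pose m := (Num.trunc s).+1.
have sm : s <= m%:R * al.
  apply: (@le_trans _ _ m%:R); first by apply/ltW; have /andP[] := truncn_itv s0.
  by rewrite ler_peMr ?ler0n// ltW.
pose K := 1 + al ^+ m * m`!%:R.
have K1 : 0 <= al ^+ m * m`!%:R by rewrite mulr_ge0 ?exprn_ge0 ?ler0n// ltW.
exists K => [|t t0]; first by rewrite /K; lra.
have [t1|t1] := leP t 1.
  apply: (@le_trans _ _ (1 * 1)); last by rewrite mul1r /K; lra.
  apply: ler_pM; rewrite ?powR_ge0 ?gexp_le1//; first exact/ltW/gexp_gt0.
  rewrite [leRHS](_ : 1 = 1 `^ s); last by rewrite powR1.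
  by apply: ge0_ler_powR; rewrite ?nnegrE// ltW.
pose y := al^-1 * t `^ al.
have y0 : 0 <= y by rewrite mulr_ge0 ?invr_ge0 ?powR_ge0// ltW.
have h := expR_ge1Dxn m.-1 y0; rewrite prednK// in h.
have tE : t `^ (m%:R * al) = al ^+ m * y ^+ m.
  rewrite mulrC powRrM powR_mulrn ?powR_ge0// -exprMn /y mulrA divff ?gt_eqF//.
  by rewrite mul1r.
have fm : 0 < m`!%:R :> R by rewrite ltr0n fact_gt0.
apply: (@le_trans _ _ (t `^ (m%:R * al) * gexp t)).
  apply: ler_wpM2r; first exact/ltW/gexp_gt0.
  by apply: ler_powR => //; exact: ltW.
rewrite tE /gexp expRN ler_pdivrMr ?expR_gt0// -/y.
apply: (@le_trans _ _ (al ^+ m * m`!%:R * expR y)); last first.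
  by rewrite ler_wpM2r ?expR_ge0// /K; lra.
rewrite -mulrA; apply: ler_wpM2l; first by rewrite exprn_ge0// ltW.
rewrite -ler_pdivrMl// mulrC; apply: le_trans h; lra.
Qed.

Lemma integral_exhaust (f : R -> \bar R) (C : \bar R) :
  measurable_fun setT f -> (forall t : R, 0 <= f t)%E -> (forall t : R, (t <= 0)%R -> f t = 0)%E ->
  (forall a b : R, 0 < a -> a < b -> (\int[lambda]_(t in `[a, b]) f t <= C)%E) ->
  (\int[lambda]_t f t <= C)%E.
Proof.
move=> mf f0 fN h.
pose I k : set (measurableTypeR R) := `[k.+2%:R^-1, k.+2%:R]%classic.
have I2 k : k.+2%:R^-1 < k.+2%:R :> R.
  by rewrite (@lt_trans _ _ 1)// ?invf_lt1// ltr1n.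
have -> : (\int[lambda]_t f t = \int[lambda]_(t in \bigcup_k I k) f t)%E.
  rewrite [LHS](integral_mkcond setT) [RHS]integral_mkcond; apply: eq_integral => t _.
  rewrite !patchE in_setT; case: ifPn => // /negP tI.
  have [t0|t0] := leP t 0; first by rewrite fN.
  exfalso; apply: tI; apply/mem_set.
  pose k := Num.trunc (Num.max t t^-1); exists k => //.
  have m0 : 0 <= Num.max t t^-1 by rewrite le_max ltW.
  have /andP[_ kt] := truncn_itv m0; rewrite -/k gt_max in kt.
  have /andP[k1 k2] := kt.
  have k3 : k.+1%:R <= k.+2%:R :> R by rewrite ler_nat.
  rewrite /I/= in_itv/= (le_trans (ltW k1))// andbT.
  rewrite -[t]invrK lef_pV2 ?posrE ?invr_gt0//.
  exact: le_trans (ltW k2) k3.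
have := @ge0_nondecreasing_set_cvg_integral _ (measurableTypeR R) R I f lambda.
move=> /(_ _ _ _ _)/cvg_lim <-//.
- apply: lime_le; last by near=> k; apply: h; rewrite ?invr_gt0.
  apply: ereal_nondecreasing_is_cvgn => i j ij.
  apply: ge0_subset_integral => //; rewrite /I.
  + exact: measurable_itv.
  + exact: measurable_itv.
  + exact: measurable_funTS.
  + apply: subset_itv; rewrite bnd_simp ?ler_nat// lef_pV2 ?posrE//.
    by rewrite ler_nat !ltnS.
- move=> i j ij; apply/subsetPset/subset_itv; rewrite bnd_simp ?ler_nat//.
  by rewrite lef_pV2 ?posrE// ler_nat !ltnS.
- by move=> i; exact: measurable_itv.
- by move=> i; exact: measurable_funTS.
Unshelve. all: by end_near. Qed.

(** The density is bounded by the derivative of a bounded function,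
    [- K / c / (1 + t ^ c)]. *)
Lemma gam_integral_fin c : 0 < c -> (\int[lambda]_t (gam c t)%:E < +oo)%E.
Proof.
move=> c0.
have [K1 K10 hK1] := powR_gexp_bounded (ltW c0).
have [K2 K20 hK2] := powR_gexp_bounded (mulr_ge0 (ler0n R 2) (ltW c0)).
pose K := 1 + 2 * K1 + K2.
have K0 : 0 < K by rewrite /K; lra.
pose G t := - ((K / c) * (1 + t `^ c)^-1).
pose g t := K * (t `^ (c - 1) * (1 + t `^ c) ^- 2).
have D0 t : 0 < 1 + t `^ c by rewrite ltr_pwDl// powR_ge0.
have dG t : 0 < t -> is_derive t 1 G (g t).
  move=> t0; have dp := is_derive1_powR c t0.
  have d1 : is_derive t 1 (fun s => 1 + s `^ c) (c * t `^ (c - 1)).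
    by apply: der_eq (derD (der_cst 1 t) dp) _; rewrite add0r.
  rewrite /G; apply: der_eq (derN (derZ (K / c) (@derV _ (fun s => 1 + s `^ c) t _ (lt0r_neq0 (D0 t)) d1))) _.
  by rewrite /g; field; rewrite !gt_eqF.
have cg t : 0 < t -> {for t, continuous g}.
  move=> t0; apply: continuousM; first exact: cst_continuous.
  apply: continuousM; first exact: continuous_powR.
  apply: continuousV; first by rewrite expf_neq0// gt_eqF.
  apply: (@continuous_comp _ _ _ (fun s => 1 + s `^ c) (fun s => s ^+ 2)); last exact: exprn_continuous.
  apply: continuousD; first exact: cst_continuous.
  exact: continuous_powR.
apply: (@le_lt_trans _ _ (K / c)%:E); last exact: ltry.
apply: integral_exhaust.
- by apply/measurable_EFinP; exact: measurable_gam.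
- by move=> t; rewrite lee_fin gam_ge0.
- by move=> t t0; rewrite /gam ltNge t0.
move=> a b a0 ab; apply: (@le_trans _ _ (\int[lambda]_(t in `[a, b]) (g t)%:E)%E).
  apply: ge0_le_integral => //.
  - by move=> t _; rewrite lee_fin gam_ge0.
  - by apply/measurable_EFinP; apply: measurable_funTS; exact: measurable_gam.
  - by have /integrableP[] := integrable_pos b a0 cg.
  move=> t /=; rewrite in_itv/= => /andP[ta _]; have t0 : 0 < t by exact: lt_le_trans ta.
  rewrite lee_fin /gam t0 /g mulrCA ler_wpM2l ?powR_ge0//.
  rewrite ler_pdivlMr ?exprn_gt0//.
  have := hK1 _ t0; have := hK2 _ t0; have := gexp_le1 t.
  rewrite [2 * c]mulrC powRrM powR_mulrn ?powR_ge0// /K.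
  by move: (t `^ c) (gexp t) => x y *; lra.
rewrite (integral_pos_primitive a0 ab dG cg) lee_fin /G.
have h1 : 0 <= K / c * (1 + b `^ c)^-1 by rewrite mulr_ge0 ?divr_ge0 ?invr_ge0// ?ltW.
have h2 : K / c * (1 + a `^ c)^-1 <= K / c * 1.
  apply: ler_wpM2l; first by apply: divr_ge0; exact: ltW.
    by rewrite invf_le1// lerDl powR_ge0.
lra.
Qed.

Lemma gam_integral_gt0 c : (0 < \int[lambda]_t (gam c t)%:E)%E.
Proof.
have cw : {within `[1, 2], continuous (gam c)}.
  by apply: continuous_pos_within => // t; exact: continuous_gam.
have [s /[!in_itv]/= /andP[s1 _] hs] := EVT_min (ler1n R 2) cw.
have g0 : 0 < gam c s by apply: gam_gt0; exact: lt_le_trans s1.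
apply: (@lt_le_trans _ _ (\int[lambda]_(t in `[1%R, 2%R]) (gam c s)%:E)%E).
  rewrite integral_cst// -[X in (_ * X)%E]/(lambda `[1%R, 2%R]%classic) lebesgue_measure_itv/= lte_fin ltr1n -EFinB -EFinM lte_fin.
  by rewrite mulr_gt0//; lra.
apply: (@le_trans _ _ (\int[lambda]_(t in `[1%R, 2%R]) (gam c t)%:E)%E).
  apply: ge0_le_integral => //.
  - by move=> t _; rewrite lee_fin ltW.
  - by apply/measurable_EFinP; apply: measurable_funTS; exact: measurable_gam.
apply: ge0_subset_integral => //.
- by apply/measurable_EFinP; exact: measurable_gam.
- by move=> t _; rewrite lee_fin gam_ge0.
Qed.

(** Integration by parts with the primitive [t ^ c * gexp t]. *)
Lemma integral_gam_recl c a b : 0 < a -> a < b ->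
  \int[lambda]_(t in `[a, b]) gam (c + al) t + (b `^ c * gexp b - a `^ c * gexp a) =
  c * \int[lambda]_(t in `[a, b]) gam c t.
Proof.
move=> a0 ab.
have ig k := integrable_pos b a0 (@continuous_gam k).
have cg t : 0 < t -> {for t, continuous (fun t => c * gam c t - gam (c + al) t)}.
  move=> t0; apply: continuousB; last exact: continuous_gam.
  by apply: continuousM; [exact: cst_continuous|exact: continuous_gam].
have := integral_pos_primitive a0 ab (@is_derive_powR_gexp c) cg.
move=> /(congr1 fine)/= <-; rewrite -/(Rintegral _ _ _) RintegralB//; last first.
  have h := integrable_pos b a0 (@continuousZ_pos c _ (@continuous_gam c)); exact: h.
by rewrite RintegralZl// addrC subrK.
Qed.

(** The limit of [integral_gam_recl]: the boundary term at 0 has the favourable sign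
    and the one at infinity vanishes. *)
Lemma moment_ineq c : 0 < c ->
  (c%:E * \int[lambda]_t (gam c t)%:E <= \int[lambda]_t (gam (c + al) t)%:E)%E.
Proof.
move=> c0.
have fi k : 0 < k -> (\int[lambda]_t (gam k t)%:E)%E \is a fin_num.
  move=> k0; rewrite ge0_fin_numE ?gam_integral_fin//.
  by apply: integral_ge0 => t _; rewrite lee_fin gam_ge0.
rewrite muleC -lee_pdivlMr//.
have [K K0 hK] := powR_gexp_bounded (addr_ge0 (ltW c0) (ler01 : 0 <= 1 :> R)).
apply: integral_exhaust => [| | |a b a0 ab].
- by apply/measurable_EFinP; exact: measurable_gam.
- by move=> t; rewrite lee_fin gam_ge0.
- by move=> t t0; rewrite /gam ltNge t0.
rewrite lee_pdivlMr// muleC.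
apply/lee_addgt0Pr => e e0.
pose m := Num.max b (K / e).
have bm : b <= m by rewrite le_max lexx.
have am := lt_le_trans ab bm; have m0 := lt_trans a0 am.
have ig k := integrable_pos m a0 (@continuous_gam k).
apply: (@le_trans _ _ (c%:E * \int[lambda]_(t in `[a, m]) (gam c t)%:E)%E).
  apply: lee_wpmul2l; first by rewrite lee_fin ltW.
  apply: ge0_subset_integral => //.
  - by apply/measurable_EFinP; apply: measurable_funTS; exact: measurable_gam.
  - by move=> t _; rewrite lee_fin gam_ge0.
  - by apply: subset_itv; rewrite bnd_simp.
have rE k : (\int[lambda]_(t in `[a, m]) (gam k t)%:E = (\int[lambda]_(t in `[a, m]) gam k t)%:E)%E.
  by rewrite /Rintegral fineK//; apply: integrable_fin_num => //; exact: ig.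
rewrite rE -EFinM -integral_gam_recl// EFinD; apply: leeD.
  rewrite -rE; apply: ge0_subset_integral => //.
  - by apply/measurable_EFinP; exact: measurable_gam.
  - by move=> t _; rewrite lee_fin gam_ge0.
rewrite lee_fin; apply: (@le_trans _ _ (m `^ c * gexp m)).
  by rewrite gerBl mulr_ge0 ?powR_ge0// ltW// gexp_gt0.
have := hK _ m0; rewrite powRD; last by rewrite (gt_eqF m0) implybT.
rewrite powRr1 ?(ltW m0)// => h.
have h2 : K <= m * e by rewrite -ler_pdivrMr// le_max lexx orbT.
have := le_trans h h2; rewrite mulrAC [m * e]mulrC ler_pM2r//; exact.
Qed.

Section Poincare.
Variables (k k' : R -> R) (N t0 : R).
Hypotheses (dk : forall t, is_derive t 1 k (k' t)) (ck' : continuous k')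
  (t0_gt0 : 0 < t0) (t0N : t0 `^ al = N).

Let ck : continuous k. Proof. by move=> t; exact: der_continuous (dk t). Qed.

Let D t := al^-1 * (k' t ^+ 2 * gam (N + (2 - al)) t) - (k t - k t0) ^+ 2 * gam N t.

Let cD1 t : 0 < t -> {for t, continuous (fun t => (k t - k t0) ^+ 2 * gam N t)}.
Proof.
move=> tp; apply: continuousM; last exact: continuous_gam.
apply: (@continuous_comp _ _ _ (fun s => k s - k t0) (fun s => s ^+ 2)); last exact: exprn_continuous.
by apply: continuousB; [exact: ck|exact: cst_continuous].
Qed.

Let cD2 t : 0 < t -> {for t, continuous (fun t => k' t ^+ 2 * gam (N + (2 - al)) t)}.
Proof.
move=> tp; apply: continuousM; last exact: continuous_gam.
by apply: (@continuous_comp _ _ _ k' (fun s => s ^+ 2)); [exact: ck'|exact: exprn_continuous].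
Qed.

Let cD t : 0 < t -> {for t, continuous D}.
Proof.
move=> tp; apply: continuousB; last exact: cD1.
by apply: continuousM; [exact: cst_continuous|exact: cD2].
Qed.

Let Q t := (k t - k t0) ^+ 2 / (t `^ al - N).
(** A primitive for the Poincare inequality: it vanishes at [t0], is nonpositive on the
    left and nonnegative on the right, and its derivative is at most the difference [D] of
    the two integrands.  For the extremal function [k = t ^ al - N] the derivative is
    equal to [D]. *)
Let Theta t := t `^ N * gexp t * Q t.

Let den_neq0 t : 0 < t -> t != t0 -> t `^ al - N != 0.
Proof.
move=> tp; apply: contra; rewrite subr_eq0 -t0N => /eqP e.
by apply/eqP; apply: (powR_injective al_gt0) => //; rewrite nnegrE ltW.
Qed.

Let dnum t : is_derive t 1 (fun s => (k s - k t0) ^+ 2) (2 * (k t - k t0) * k' t).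
Proof.
have h : is_derive t 1 (fun s => k s - k t0) (k' t).
  by apply: der_eq (derB (dk t) (der_cst (k t0) t)) _; rewrite subr0.
have -> : (fun s => (k s - k t0) ^+ 2) = (fun s => (k s - k t0) * (k s - k t0)).
  by apply/funext => s; rewrite expr2.
by apply: der_eq (derM h h) _; ring.
Qed.

Let dden t : 0 < t -> is_derive t 1 (fun s => s `^ al - N) (al * t `^ (al - 1)).
Proof.
by move=> tp; apply: der_eq (derB (is_derive1_powR al tp) (der_cst N t)) _; rewrite subr0.
Qed.

Let dQ t : 0 < t -> t != t0 -> is_derive t 1 Q
  (2 * (k t - k t0) * k' t / (t `^ al - N) -
   (k t - k t0) ^+ 2 * (al * t `^ (al - 1)) / (t `^ al - N) ^+ 2).
Proof.
move=> tp tt; have d0 := den_neq0 tp tt; rewrite /Q.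
by apply: der_eq (derM (dnum t) (@derV _ (fun s => s `^ al - N) t _ d0 (dden tp))) _; rewrite mulNr mulrN -!mulrA.
Qed.

(** The difference of the two sides is a square: this is where the weight
    [t ^ (2 - al) / al] of the derivative comes from. *)
Let dTheta t : 0 < t -> t != t0 -> exists2 d, is_derive t 1 Theta d & d <= D t.
Proof.
move=> tp tt; have d0 := den_neq0 tp tt.
have h := derM (is_derive_powR_gexp N tp) (dQ tp tt).
refine (ex_intro2 _ _ _ h _).
have e1 : gam (N + al) t = t `^ al * gam N t by rewrite gamM.
have e2 : gam (N + (2 - al)) t = t ^+ 2 / t `^ al * gam N t.
  rewrite -gamM// powRB; last by rewrite (gt_eqF tp) implybT.
  by rewrite (powR_mulrn 2) ?ltW.
have e3 : t `^ N * gexp t = t * gam N t.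
  by rewrite /gam tp mulrA mulr_powRB1 ?ltW// -t0N powR_gt0.
have e4 : t `^ (al - 1) = t `^ al / t.
  by rewrite powRB ?powRr1 ?ltW// (gt_eqF tp) implybT.
rewrite /D e1 e2 e3 e4 /Q.
have gp := gam_gt0 N tp; have pp : 0 < t `^ al by exact: powR_gt0.
move: (gam N t) (t `^ al) gp pp d0 => g p gp pp d0.
move: (k t - k t0) (k' t) => x y.
rewrite -subr_ge0.
set d := p - N in d0 *.
have -> : al^-1 * (y ^+ 2 * (t ^+ 2 / p * g)) - x ^+ 2 * g -
  ((N * g - p * g) * (x ^+ 2 / d) + t * g * (2 * x * y / d - x ^+ 2 * (al * (p / t)) / d ^+ 2))
  = g / (al * p) * (t * y - al * p * x / d) ^+ 2.
  have -> : N = p - d by rewrite /d; ring.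
  by field; rewrite d0 !gt_eqF.
by rewrite mulr_ge0 ?sqr_ge0// divr_ge0 ?ltW// mulr_gt0.
Qed.

Let cTheta_off t : 0 < t -> t != t0 -> {for t, continuous Theta}.
Proof. by move=> tp tt; have [d /der_continuous] := dTheta tp tt. Qed.

(** The numerator of [Q] vanishes to second order at [t0] and the denominator to
    first order. *)
Let cTheta0 : {for t0, continuous Theta}.
Proof.
apply: continuousM.
  by apply: der_continuous (is_derive_powR_gexp N t0_gt0).
have Q0 : Q t0 = 0 by rewrite /Q subrr expr0n mul0r.
have t02 : 0 < t0 / 2 by rewrite divr_gt0.
(* by l'Hopital's rule, as the derivative of the denominator is positive at [t0] *)
have lh : Q t @[t --> t0^'] --> 0.
  apply: (@lhopital _ (fun t => (k t - k t0) ^+ 2) (fun t => 2 * (k t - k t0) * k' t)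
    (fun t => t `^ al - N) (fun t => al * t `^ (al - 1)) (t0 / 2) (t0 + 1) t0).
  - by rewrite in_itv/=; lra.
  - by move=> t _; exact: dnum.
  - by move=> t /set_mem[/=]; rewrite in_itv/= => /andP[h _] _; apply: dden; exact: lt_trans h.
  - have := der_continuous (dnum t0); rewrite /prop_for /continuous_at subrr expr0n/=; exact.
  - have := der_continuous (dden t0_gt0); rewrite /prop_for /continuous_at t0N subrr; exact.
  - move=> t /set_mem[/=]; rewrite in_itv/= => /andP[h _] _.
    by rewrite mulf_neq0// gt_eqF// powR_gt0// (lt_trans _ h).
  have c : {for t0, continuous (fun t => 2 * (k t - k t0) * k' t / (al * t `^ (al - 1)))}.
    apply: continuousM.
      apply: continuousM; last exact: ck'.
      apply: continuousM; first exact: cst_continuous.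
      by apply: continuousB; [exact: ck|exact: cst_continuous].
    apply: continuousV; first by rewrite mulf_neq0// gt_eqF// powR_gt0.
    apply: continuousM; first exact: cst_continuous.
    exact: continuous_powR.
  by move: c; rewrite /prop_for /continuous_at subrr mulr0 !mul0r.
rewrite /prop_for /continuous_at Q0.
apply/cvgrPdist_lt => e e0.
have /cvgrPdist_lt/(_ e e0) := lh; rewrite /dnbhs !near_withinE.
apply: filterS => t /= h; have [->|tt] := eqVneq t t0; last exact: h.
by rewrite Q0 subrr normr0.
Qed.

Let cTheta t : 0 < t -> {for t, continuous Theta}.
Proof. by have [->|tt] := eqVneq t t0 => tp //; exact: cTheta_off. Qed.

(** Integrate [dTheta] on both sides of [t0]: [Theta] vanishes there, and its
    boundary values at [a] and [b] have the favourable signs. *)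
Lemma poincare_interval a b : 0 < a -> a < t0 -> t0 < b ->
  \int[lambda]_(t in `[a, b]) ((k t - k t0) ^+ 2 * gam N t) <=
  al^-1 * \int[lambda]_(t in `[a, b]) (k' t ^+ 2 * gam (N + (2 - al)) t).
Proof.
move=> a0 at0 t0b; have ab := lt_trans at0 t0b.
have i1 := integrable_pos b a0 cD1; have i2 := integrable_pos b a0 cD2.
have iD := integrable_pos b a0 cD.
rewrite -subr_ge0 -RintegralZl// -RintegralB//; last first.
  have h := integrable_pos b a0 (@continuousZ_pos al^-1 _ cD2); exact: h.
rewrite -/D.
pose J x := \int[lambda]_(t in `[a, x]) D t.
have cJ : {within `[a, b], continuous J}.
  exact: parameterized_integral_continuous (ltW ab) iD.
have dJ t : t \in `]a, b[%R -> is_derive t 1 J (D t).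
  rewrite in_itv/= => /andP[ta tb].
  have [h1 h2] := continuous_FTC1_closed tb iD ta (cD (lt_trans a0 ta)).
  by apply: DeriveDef => //; rewrite -derive1E.
(* [V] is monotone on both sides of [t0], where [Theta] need not be differentiable *)
pose V t := J t - Theta t.
have cV : {within `[a, b], continuous V}.
  move=> t; apply: continuousB; first exact: cJ.
  by apply: continuous_pos_within.
have dV t : t \in `]a, b[%R -> t != t0 -> exists2 d, is_derive t 1 V d & 0 <= d.
  move=> ti tt; have tp : 0 < t by move: ti; rewrite in_itv/= => /andP[h _]; exact: lt_trans h.
  have [d h1 h2] := dTheta tp tt.
  by exists (D t - d); [apply: derB => //; exact: dJ|rewrite subr_ge0].
have mono x y : a <= x -> x <= y -> y <= b -> (y <= t0 \/ t0 <= x) -> V x <= V y.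
  move=> ax xy yb xyt0.
  have sub t : t \in `]x, y[%R -> t \in `]a, b[%R /\ t != t0.
    rewrite !in_itv/= => /andP[h1 h2]; split.
      by rewrite (le_lt_trans ax h1) (lt_le_trans h2 yb).
    by case: xyt0 => h; [rewrite lt_eqF// (lt_le_trans h2)|rewrite gt_eqF// (le_lt_trans h)].
  apply: (@ger0_derive1_le_cc _ V x y) => //.
  - by move=> t /sub[t1 t2]; have [d [] ] := dV _ t1 t2.
  - by move=> t /sub[t1 t2]; have [d [_ h] hd] := dV _ t1 t2; rewrite derive1E h.
  - by apply: continuous_subspaceW cV; apply: subset_itv; rewrite bnd_simp.
  - by rewrite in_itv/= lexx.
  - by rewrite in_itv/= lexx xy.
have h1 := mono a t0 (lexx a) (ltW at0) (ltW t0b) (or_introl (lexx t0)).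
have h2 := mono t0 b (ltW at0) (ltW t0b) (lexx b) (or_intror (lexx t0)).
have := le_trans h1 h2; rewrite /V.
have -> : J a = 0 by rewrite /J set_itv1 Rintegral_set1.
have Ta : Theta a <= 0.
  apply: mulr_ge0_le0; first by rewrite mulr_ge0 ?powR_ge0// ltW// gexp_gt0.
  rewrite mulr_ge0_le0 ?sqr_ge0// invr_le0 subr_le0 -t0N.
  by apply: ge0_ler_powR; rewrite ?nnegrE ltW.
have Tb : 0 <= Theta b.
  apply: mulr_ge0; first by rewrite mulr_ge0 ?powR_ge0// ltW// gexp_gt0.
  rewrite mulr_ge0 ?sqr_ge0// invr_ge0 subr_ge0 -t0N.
  by apply: ge0_ler_powR; rewrite ?nnegrE ltW// (lt_trans a0).
by rewrite /J; lra.
Qed.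
End Poincare.

End OneDim.

(** * The two laws in polar coordinates *)

Section Generic.
Import HBNNSimple.
Local Open Scope ereal_scope.

Lemma fin_pos_EFin (R : realType) (x : \bar R) : 0 < x -> x < +oo ->
  exists2 r : R, (0 < r)%R & x = r%:E.
Proof. by case: x => [r| |]//= r0 _; exists r. Qed.

Lemma probability_ex d (T : measurableType d) (R : realType)
    (m : {measure set T -> \bar R}) : m setT = 1 ->
  exists P : probability T R, forall A, P A = m A.
Proof.
move=> m1.
pose p (A : set T) : \bar R := m A.
have p0 : p set0 = 0 by exact: measure0.
have pge A : 0 <= p A by exact: measure_ge0.
have ps : semi_sigma_additive p by exact: measure_semi_sigma_additive.
pose pM := isMeasure.Build _ T R p p0 pge ps.
pose P1 : {measure set T -> \bar R} := HB.pack p pM.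
pose pP := Measure_isProbability.Build _ T R P1 m1.
by exists (HB.pack_for (probability T R) p pM pP).
Qed.

(** An integral only evaluates its set function on measurable sets, so that [mu] and [nu]
    may be replaced by genuine probability measures. *)
Lemma integral_measurable_ext d (T : measurableType d) (R : realType)
    (m1 m2 : set T -> \bar R) (D : set T) (f : T -> \bar R) :
  (forall A, measurable A -> m1 A = m2 A) ->
  integral m1 D f = integral m2 D f.
Proof.
move=> mE.
have sE (h : {nnsfun T >-> R}) : sintegral m1 h = sintegral m2 h.
  by rewrite /sintegral; apply: eq_fsbigr => r _; rewrite mE.
rewrite /integral; congr (_ - _); congr ereal_sup; apply/seteqP; split=> x [h hg <-];
  by exists h => //; rewrite sE.
Qed.

End Generic.

Section DensityProbability.
Context d (T : measurableType d) (R : realType) (m : {measure set T -> \bar R}).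
Variables (w : T -> R) (k : R).
Hypotheses (mw : measurable_fun setT w) (w0 : forall x, 0 <= w x) (k0 : 0 < k)
  (kE : (\int[m]_x (w x)%:E = k%:E)%E).

Lemma density_probability : exists P : probability T R,
  (forall A, measurable A -> P A = (k^-1)%:E * \int[m]_(x in A) (w x)%:E)%E /\
  forall f, measurable_fun setT f -> (forall x, 0 <= f x)%E ->
    (\int[P]_x f x = (k^-1)%:E * \int[m]_x (f x * (w x)%:E))%E.
Proof.
have ki : 0 <= k^-1 by rewrite invr_ge0 ltW.
pose v x := k^-1 * w x.
have mv : measurable_fun setT v by exact: measurable_funM.
have v0 x : 0 <= v x by rewrite mulr_ge0.
have [m' m'E] := density_measure m mv v0.
have m'E2 A : measurable A -> (m' A = (k^-1)%:E * \int[m]_(x in A) (w x)%:E)%E.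
  move=> mA; rewrite m'E -ge0_integralZl//.
  - by apply/measurable_EFinP; exact: measurable_funTS.
  - by move=> x _; rewrite lee_fin.
have m'1 : m' setT = 1%E by rewrite m'E2// kE -EFinM mulVf// gt_eqF.
have [P PE] := probability_ex m'1.
exists P; split=> [A mA|f mf f0]; first by rewrite PE m'E2.
rewrite [LHS](eq_measure_integral m'); last by move=> A mA _; exact: PE.
rewrite (integral_density_measure mv v0 (fun A _ => m'E A))//.
rewrite -ge0_integralZl//; last 2 first.
- by apply: emeasurable_funM => //; apply/measurable_EFinP.
- by move=> x _; rewrite mule_ge0// lee_fin.
by apply: eq_integral => x _; rewrite /v EFinM muleCA.
Qed.
End DensityProbability.

Section SphereCompact.
Context {R : realType} (n : nat).
Local Notation S := (sphere R n.+1).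

Lemma closed_sphere : closed S.
Proof.
rewrite (_ : S = @enorm R n.+1 @^-1` [set 1]); last by [].
by apply: closed_comp => [x _|]; [exact: continuous_enorm|exact: closed_eq].
Qed.

Lemma compact_sphere : compact S.
Proof.
apply: bounded_closed_compact; last exact: closed_sphere.
exists 1; split; first exact: num_real.
move=> M M1 x Sx; rewrite /Num.Def.normr/= mx_normrE.
apply: bigmax_le => [|i _]; first by apply: ltW; exact: lt_trans M1.
rewrite (le_trans _ (ltW M1))// ord1 -[leRHS]Sx; exact: coord_le_enorm.
Qed.

Lemma sphere_nonempty : S !=set0.
Proof.
exists (radial (delta_mx 0 0)); apply: enorm_radial.
by apply/eqP => /matrixP/(_ 0 0); rewrite !mxE !eqxx => /eqP; rewrite oner_eq0.
Qed.

Lemma sphere_max (g : 'rV[R]_n.+1 -> R) : (forall u, S u -> {for u, continuous g}) ->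
  exists2 c, S c & forall u, S u -> g u <= g c.
Proof.
move=> cg; have [|c cS h] := EVT_max_rV (f := g) sphere_nonempty compact_sphere.
  by apply: continuous_in_subspaceT => u /set_mem; exact: cg.
by exists c => [|u Su]; [exact/set_mem|apply: h; exact/mem_set].
Qed.

End SphereCompact.

Section Laws.
Context {R : realType} (n : nat).
Hypothesis n_gt0 : (0 < n)%N.
Local Notation T := ('rV[R]_n.+1).
Local Notation S := (sphere R n.+1 : set (borelRn R n.+1)).
Local Notation leb := (@leb R n.+1).
Local Notation sigma := (@cone_measure R n).
Local Notation lambda := (@lebesgue_measure R).

(** The singleton of 0 is Borel, so that the value at 0 is irrelevant. *)
Lemma measurable_off0 d (Y : measurableType d) (f : borelRn R n.+1 -> Y) :
  measurable_fun ([set x : T | x != 0] : set (borelRn R n.+1)) f -> measurable_fun setT f.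
Proof.
move=> mf.
have m0 : measurable ([set 0] : set (borelRn R n.+1)).
  by apply: measurable_closedRn; apply: accessible_closed_set1; apply: hausdorff_accessible; exact: norm_hausdorff.
have E : [set x : T | x != 0] = ~` [set (0 : T)].
  by apply/seteqP; split=> x /= /eqP.
rewrite -(setUv ([set 0] : set T)); apply/measurable_funU => //.
  by apply: measurableC.
by split; [exact: measurable_fun_set1|rewrite -E].
Qed.

Lemma open_neq0 : open [set x : T | x != 0].
Proof.
rewrite (_ : [set _ | _] = ~` [set (0 : T)]); last by apply/seteqP; split=> x /= /eqP.
by apply: closed_openC; apply: accessible_closed_set1; apply: hausdorff_accessible; exact: norm_hausdorff.
Qed.

Lemma measurable_off0_continuous (f : T -> R) :
  (forall x, x != 0 -> {for x, continuous f}) ->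
  measurable_fun setT (f : borelRn R n.+1 -> R).
Proof.
by move=> cf; apply: measurable_off0; apply: continuous_measurableRn; [exact: open_neq0|].
Qed.

Variables (al : R) (phi : T -> R).
Hypothesis al_gt1 : 1 < al.
Hypothesis phi_gt0 : forall u, S u -> 0 < phi u.
Hypothesis cphi : forall x : T, x != 0 -> {for x, continuous (phi \o radial)}.
Let Phi (x : T) := al^-1 * enorm x `^ al * phi (radial x) `^ al.

Let al_gt0 : 0 < al. Proof. exact: lt_trans al_gt1. Qed.

(** The point where the ray through [u] meets the level set [{Phi = 1 / al}]. *)
Definition profile (u : T) : T := (phi (radial u))^-1 *: u.

Lemma measurable_phi_radial : measurable_fun setT (fun x : borelRn R n.+1 => phi (radial (x : T))).
Proof. exact: measurable_off0_continuous. Qed.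

Lemma measurable_profile : measurable_fun setT (profile : borelRn R n.+1 -> borelRn R n.+1).
Proof.
apply: (@measurable_scale2 _ n _ (borelRn R n.+1) (fun u => (phi (radial (u : T)))^-1) (fun u => u)).
  by apply: (measurableT_comp measurable_invr); exact: measurable_phi_radial.
exact: measurable_id.
Qed.

Let cphiS u : S u -> {for u, continuous (phi \o radial)}.
Proof. by move=> /sphere_neq0; exact: cphi. Qed.

Lemma phi_lower_bound : exists2 c, 0 < c & forall u, S u -> c <= phi u.
Proof.
have [u Su|c Sc h] := sphere_max (g := fun u => - phi (radial u)).
  by apply: continuousN; exact: cphiS.
exists (phi c); first exact: phi_gt0.
by move=> u Su; have := h u Su; rewrite lerN2 !radial_sphere.
Qed.

Let W0 (u : borelRn R n.+1) : R := \1_S u * phi (radial (u : T)) ^- n.+1.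

Let W0_ge0 u : 0 <= W0 u.
Proof.
rewrite /W0 indicE; case: (boolP (u \in _)) => [/set_mem uS|_]; last by rewrite mul0r.
by rewrite mul1r invr_ge0 exprn_ge0// radial_sphere// ltW// phi_gt0.
Qed.

Let measurable_W0 : measurable_fun setT W0.
Proof.
apply: measurable_funM; first by apply: measurable_indic; exact: measurable_sphere.
apply: (measurableT_comp measurable_invr); apply: measurable_funX.
exact: measurable_phi_radial.
Qed.

Let K0 : \bar R := (\int[sigma]_u (W0 u)%:E)%E.

Let sigma_sphere_gt0 : (0 < sigma S)%E.
Proof.
have [u Su] := sphere_nonempty (R := R) n.
apply: (lt_le_trans (cone_measure_eball_gt0 Su ltr01)).
have mb : measurable (eball u 1 : set (borelRn R n.+1)) by exact: measurable_eball.
rewrite -[leRHS]adde0 -(cone_measure_conull (R := R) n).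
rewrite -measureU//; last by rewrite setICr.
- by apply: le_measure; rewrite ?inE ?setUv.
- exact: measurable_sphere.
- by apply: measurableC; exact: measurable_sphere.
Qed.

Let K0_gt0 : (0 < K0)%E.
Proof.
have [u Su|c Sc h] := sphere_max (g := phi \o radial); first exact: cphiS.
have c0 : 0 < phi c ^- n.+1 by rewrite invr_gt0 exprn_gt0// phi_gt0.
apply: (@lt_le_trans _ _ ((phi c ^- n.+1)%:E * sigma S)%E).
  by rewrite mule_gt0// lte_fin.
rewrite -integral_cst; last exact: measurable_sphere.
rewrite integral_mkcond; apply: ge0_le_integral => //.
- by move=> x _; rewrite erestrict_ge0// => y _; rewrite lee_fin ltW.
- have ms := @measurable_sphere R n.
  by apply/(measurable_restrictT _ ms); exact: measurable_cst.
- by apply/measurable_EFinP; exact: measurable_W0.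
move=> x _; rewrite /W0 patchE indicE; case: (boolP (x \in _)) => [/set_mem xS|_]; last by rewrite mul0r.
rewrite mul1r lee_fin lef_pV2 ?posrE ?exprn_gt0 ?phi_gt0 ?radial_sphere//.
apply: lerXn2r; rewrite ?nnegrE; [exact/ltW/phi_gt0|exact/ltW/phi_gt0|].
have := h x xS; rewrite /= !radial_sphere//; exact.
Qed.

Let K0_fin : (K0 < +oo)%E.
Proof.
have [c c0 h] := phi_lower_bound.
apply: (@le_lt_trans _ _ ((c ^- n.+1)%:E * sigma setT)%E).
  rewrite -integral_cst//; apply: ge0_le_integral => //.
  - by move=> x _; rewrite lee_fin.
  - by apply/measurable_EFinP; exact: measurable_W0.
  move=> x _; rewrite /W0 indicE lee_fin; case: (boolP (x \in _)) => [/set_mem xS|_].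
    rewrite mul1r lef_pV2 ?posrE ?exprn_gt0 ?phi_gt0 ?radial_sphere//.
    by apply: lerXn2r; rewrite ?nnegrE ?h// ltW// phi_gt0.
  by rewrite mul0r invr_ge0 exprn_ge0// ltW.
by rewrite lte_mul_pinfty ?lee_fin ?invr_ge0 ?exprn_ge0 ?(ltW c0)//; exact: cone_measure_fin.
Qed.

Let Z : \bar R := (\int[lambda]_t (gam al n.+1%:R t)%:E)%E.

Let ppow_gexp t : ppow n t * gexp al t = gam al n.+1%:R t.
Proof.
rewrite /ppow /gam; case: ifP => t0; last by rewrite mul0r.
by rewrite -natr1 addrK powR_mulrn// ltW.
Qed.

Lemma Phi_ray (t : R) u : S u -> 0 < t -> Phi (t *: profile u) = al^-1 * t `^ al.
Proof.
move=> Su t0; have p0 := phi_gt0 Su; have s0 : 0 < t / phi u by rewrite divr_gt0.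
rewrite /Phi /profile radial_sphere// scalerA.
have -> : radial ((t / phi u) *: u) = u.
  by rewrite /radial enormZ ger0_norm ?ltW// Su mulr1 scalerA mulVf ?gt_eqF// scale1r.
rewrite enormZ ger0_norm ?(ltW s0)// Su mulr1 -mulrA -powRM ?(ltW s0) ?(ltW p0)//.
by rewrite divfK// gt_eqF.
Qed.

Lemma measurable_Phi : measurable_fun setT (Phi : borelRn R n.+1 -> R).
Proof.
apply: measurable_funM.
  apply: measurable_funM => //; apply: (measurableT_comp (measurable_powR al)).
  exact: measurable_enorm.
by apply: (measurableT_comp (measurable_powR al)); exact: measurable_phi_radial.
Qed.

Let polar_Phi (F : borelRn R n.+1 -> \bar R) :
  measurable_fun setT F -> (forall x, 0 <= F x)%E ->
  (polar_constant n * \int[leb]_x (F x * (expR (- Phi x))%:E) =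
   \int[sigma]_u (\int[lambda]_t (F (t *: profile u)%R * (gam al n.+1%:R t)%:E) * (W0 u)%:E))%E.
Proof.
move=> mF F0.
have mw : measurable_fun setT (fun x : borelRn R n.+1 => expR (- Phi x)).
  by apply: measurableT_comp => //; apply: measurableT_comp => //; exact: measurable_Phi.
have mFw : measurable_fun setT (fun x => F x * (expR (- Phi x))%:E)%E.
  by apply: emeasurable_funM => //; apply/measurable_EFinP.
have Fw0 x : (0 <= F x * (expR (- Phi x))%:E)%E by rewrite mule_ge0// lee_fin expR_ge0.
rewrite -polar_integral//.
have mg2 : measurable_fun setT (fun p : borelRn R n.+1 * R => F (p.2 *: (profile p.1))%R * (gam al n.+1%:R p.2)%:E)%E.
  apply: emeasurable_funM.
    apply: (measurableT_comp mF); apply: measurable_scale2 => //.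
    by apply: (measurableT_comp measurable_profile); exact: measurable_fst.
  by apply/measurable_EFinP; apply: (measurableT_comp (measurable_gam _ _)); exact: measurable_snd.
have g20 p : (0 <= F (p.2 *: (profile p.1))%R * (gam al n.+1%:R p.2)%:E)%E.
  by rewrite mule_ge0// lee_fin gam_ge0.
have mp2 : measurable_fun setT (fun p : borelRn R n.+1 * R =>
    F (p.2 *: (p.1 : T))%R * (expR (- Phi (p.2 *: (p.1 : T))))%:E * (ppow n p.2)%:E)%E.
  apply: emeasurable_funM.
    by apply: (measurableT_comp mFw); apply: measurable_scale2.
  by apply/measurable_EFinP; apply: (measurableT_comp (@measurable_ppow _ n)); exact: measurable_snd.
apply: ge0_ae_eq_integral => //.
- apply: (@measurable_fun_fubini_tonelli_F _ _ _ _ _ lambda (fun p : borelRn R n.+1 * R =>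
    F (p.2 *: (p.1 : T))%R * (expR (- Phi (p.2 *: (p.1 : T))))%:E * (ppow n p.2)%:E)%E) => // p.
  by rewrite mule_ge0// lee_fin ppow_ge0.
- apply: emeasurable_funM; last by apply/measurable_EFinP.
  by apply: (@measurable_fun_fubini_tonelli_F _ _ _ _ _ lambda (fun p : borelRn R n.+1 * R =>
    F (p.2 *: (profile p.1))%R * (gam al n.+1%:R p.2)%:E)%E).
- by move=> u _; apply: integral_ge0 => t _; rewrite mule_ge0// lee_fin ppow_ge0.
- move=> u _; apply: mule_ge0; last by rewrite lee_fin.
  by apply: integral_ge0 => t _; rewrite mule_ge0// lee_fin gam_ge0.
exists (~` S); split; [by apply: measurableC; exact: measurable_sphere|exact: cone_measure_conull|].
move=> u /= /not_implyP[_ H] Su; apply: H.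
have p0 := phi_gt0 Su; have c0 : 0 < (phi u)^-1 by rewrite invr_gt0.
rewrite (integral_lebesgue_scale c0); last 2 first.
- apply: emeasurable_funM.
    by apply: (measurableT_comp mFw); apply: measurable_scale2.
  by apply/measurable_EFinP; exact: measurable_ppow.
- by move=> t; rewrite mule_ge0// lee_fin ppow_ge0.
have -> : W0 u = (phi u)^-1 * (phi u)^-1 ^+ n.
  by rewrite /W0 indicE mem_set// mul1r radial_sphere// -exprS exprVn.
rewrite [RHS]muleC EFinM -muleA; congr (_ * _)%E.
rewrite -ge0_integralZl//; last 3 first.
- apply: emeasurable_funM.
    by apply: (measurableT_comp mF); apply: measurable_scale2.
  by apply/measurable_EFinP; exact: measurable_gam.
- by move=> t _; rewrite mule_ge0// lee_fin gam_ge0.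
- by rewrite lee_fin exprn_ge0// ltW.
apply: eq_integral => t _.
have -> : ((phi u)^-1 * t) *: (u : T) = t *: profile u.
  by rewrite /profile radial_sphere// scalerA mulrC.
have -> : ppow n ((phi u)^-1 * t) = (phi u)^-1 ^+ n * ppow n t.
  by rewrite /ppow pmulr_rgt0//; case: ifP => _; rewrite ?mulr0// exprMn.
have [t0|t0] := ltP 0 t; last first.
  by rewrite /ppow /gam ltNge t0/= !mulr0 !mule0.
rewrite Phi_ray// -/(gexp al t) -ppow_gexp -muleA -EFinM muleCA; congr (_ * _)%E.
by rewrite -EFinM; congr (_%:E); ring.
Qed.

(** The law of [x = t *: theta u] under [mu]: the density [exp (- Phi)] depends on [t]
    alone, and passing from the radius [r] to [t = r * phi u] turns the Jacobian
    [r ^ (n - 1) dr] into [phi u ^ (- n) * t ^ (n - 1) dt], whose first factor is the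
    density of [nu].  The normalizing constants cancel. *)
Theorem polar_law : exists (nuP muP : probability (borelRn R n.+1) R)
    (rhoP : probability (measurableTypeR R) R) (z : R),
  [/\ [/\ forall A, measurable A -> nu phi A = nuP A,
          forall A, measurable A -> mu Phi A = muP A &
          nuP (~` S) = 0%E],
      0 < z /\ (z%:E = \int[lambda]_t (gam al n.+1%:R t)%:E)%E,
      forall f : R -> \bar R, measurable_fun setT f -> (forall t, 0 <= f t)%E ->
      (\int[rhoP]_t f t = (z^-1)%:E * \int[lambda]_t (f t * (gam al n.+1%:R t)%:E))%E &
      forall F : borelRn R n.+1 -> \bar R, measurable_fun setT F -> (forall x, 0 <= F x)%E ->
      (\int[muP]_x F x = \int[nuP]_u \int[rhoP]_t F (t *: profile u)%R)%E].
Proof.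
have N0 : 0 < n.+1%:R :> R by rewrite ltr0n.
have [z z0 zE] := fin_pos_EFin (gam_integral_gt0 al_gt1 _) (gam_integral_fin al_gt1 N0).
have [k k0 kE] := fin_pos_EFin K0_gt0 K0_fin.
have [p p0 pE] := fin_pos_EFin (@polar_constant_gt0 R n) (@polar_constant_fin R n).
have mw : measurable_fun setT (fun x : borelRn R n.+1 => expR (- Phi x)).
  by apply: measurableT_comp => //; apply: measurableT_comp => //; exact: measurable_Phi.
have Z1E : (\int[leb]_x (expR (- Phi x))%:E = (k * z / p)%:E)%E.
  have := polar_Phi (F := cst 1%E) (@measurable_cst _ _ _ _ _ _) (fun _ => lee01).
  under eq_integral do rewrite /= mul1e.
  under [in X in _ = X -> _]eq_integral do under eq_integral do rewrite /= mul1e.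
  rewrite zE pE ge0_integralZl//; last 3 first.
  - by apply/measurable_EFinP; exact: measurable_W0.
  - by move=> x _; rewrite lee_fin.
  - by rewrite lee_fin ltW.
  rewrite -/K0 kE -EFinM => /(congr1 (fun z => (p^-1)%:E * z)%E).
  by rewrite muleA -!EFinM mulVf ?gt_eqF// mul1e => ->; congr (_%:E); ring.
have k1 : 0 < k * z / p by rewrite divr_gt0// mulr_gt0.
have [muP [muE muI]] := density_probability mw (fun x => expR_ge0 _) k1 Z1E.
have [nuP [nuE nuI]] := density_probability measurable_W0 W0_ge0 k0 kE.
have [rhoP [_ rhoI]] := @density_probability _ (measurableTypeR R) R lambda (gam al n.+1%:R) z (@measurable_gam R al n.+1%:R) (gam_ge0 _ _) z0 zE.
exists nuP, muP, rhoP, z; split => //.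
- split.
  + have [c c0 hc] := hausdorff_cone (R := R) n_gt0.
    have [m mE] := hausdorff_measure (R := R) n.+1 n_gt0.
    have hI A : measurable A -> (\int[hausdorff n]_(x in A `&` S) (phi x ^- n.+1)%:E =
        c%:E * \int[sigma]_(x in A) (W0 x)%:E)%E.
      move=> mA; have mAS : measurable (A `&` S) by apply: measurableI => //; exact: measurable_sphere.
      rewrite -mE.
      transitivity (\int[m]_(x in A `&` S) (W0 x)%:E)%E.
        apply: eq_integral => x /set_mem[_ Sx].
        by rewrite /W0 indicE mem_set// mul1r radial_sphere.
      transitivity (\int[mscale (NngNum (ltW c0)) sigma]_(x in A `&` S) (W0 x)%:E)%E.
        apply: eq_measure_integral => B mB BS.
        rewrite mE hc//; by move=> x /BS[].
      rewrite ge0_integral_mscale//; last 2 first.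
      - by apply/measurable_EFinP; apply: measurable_funTS; exact: measurable_W0.
      - by move=> x _; rewrite lee_fin.
      congr (_ * _)%E; rewrite [LHS]integral_mkcondr; apply: eq_integral => x _.
      rewrite patchE; case: ifPn => // /negP h; rewrite /W0 indicE.
      by case: (boolP (x \in _)) => // _; rewrite mul0r.
    move=> A mA; rewrite /nu /density_prob nuE// hI//.
    rewrite -[X in (_ / (\int[_]_(x in X) _))%E](setTI S) hI// -/K0 kE -EFinM inver.
    rewrite gt_eqF ?mulr_gt0// muleAC -EFinM; congr (_%:E * _)%E.
    by rewrite invfM mulrA mulfV ?mul1r// gt_eqF.
  + move=> A mA; rewrite /mu /density_prob muE// -lebE setIT Z1E inver gt_eqF//.
    by rewrite muleC.
  + rewrite nuE; last by apply: measurableC; exact: measurable_sphere.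
    rewrite (eq_integral (cst 0%E)) ?integral0 ?mule0// => x /set_mem h.
    by rewrite /W0 indicE memNset// mul0r.
- move=> F mF F0; rewrite muI//.
  have mg2 : measurable_fun setT (fun p : borelRn R n.+1 * R => F (p.2 *: (profile p.1))%R * (gam al n.+1%:R p.2)%:E)%E.
    apply: emeasurable_funM.
      apply: (measurableT_comp mF); apply: measurable_scale2 => //.
      by apply: (measurableT_comp measurable_profile); exact: measurable_fst.
    by apply/measurable_EFinP; apply: (measurableT_comp (measurable_gam _ _)); exact: measurable_snd.
  have mL : measurable_fun setT (fun u : borelRn R n.+1 => \int[lambda]_t (F (t *: profile u)%R * (gam al n.+1%:R t)%:E))%E.
    apply: (@measurable_fun_fubini_tonelli_F _ _ _ _ _ lambda (fun p : borelRn R n.+1 * R =>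
      F (p.2 *: (profile p.1))%R * (gam al n.+1%:R p.2)%:E)%E) => // q.
    by rewrite mule_ge0// lee_fin gam_ge0.
  have L0 u : (0 <= \int[lambda]_t (F (t *: profile u)%R * (gam al n.+1%:R t)%:E))%E.
    by apply: integral_ge0 => t _; rewrite mule_ge0// lee_fin gam_ge0.
  transitivity (\int[nuP]_u ((z^-1)%:E * \int[lambda]_t (F (t *: profile u)%R * (gam al n.+1%:R t)%:E)))%E; last first.
    apply: eq_integral => u _; rewrite rhoI//.
    by apply: (measurableT_comp mF); apply: measurable_scale2.
  rewrite ge0_integralZl//; last by rewrite lee_fin invr_ge0 ltW.
  rewrite nuI// -polar_Phi// pE !muleA -!EFinM; congr (_%:E * _)%E.
  by field; rewrite !gt_eqF.
Qed.
End Laws.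

(** * Gradients *)

Section Gradient.
Context {R : realType} (n : nat).
Local Notation T := ('rV[R]_n.+1).
Implicit Types (f k : T -> R) (x v g : T).

Lemma dot_suml m (F : 'I_m -> T) v : dot (\sum_i F i) v = \sum_i dot (F i) v.
Proof.
rewrite /dot exchange_big/=; apply: eq_bigr => j _.
by rewrite summxE mulr_suml.
Qed.

Lemma dot_delta g i : dot g (delta_mx 0 i) = g 0 i.
Proof.
rewrite /dot (bigD1 i)//= big1 ?addr0 => [|j ji]; rewrite mxE ?eqxx ?mulr1//.
by rewrite (negbTE ji) mulr0.
Qed.

(** Differentiability and the value of the gradient in a single statement, so
    that calculus rules compose without side conditions. *)
Definition has_grad f x g := is_diff x f (dot g).

Lemma dot_linear g : linear (dot g : T -> R).
Proof. by move=> a v w; rewrite dotDr dotZr. Qed.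

HB.instance Definition _ g := GRing.isLinear.Build R T R *%R (dot g) (dot_linear g).

Lemma continuous_dotl g : continuous (dot g : T -> R).
Proof.
by move=> v; apply: (@continuous_dot _ _ _ (cst g) id); [exact: cst_continuous|move=> ?].
Qed.

Lemma has_grad_eps f x g : (forall e, 0 < e -> \forall h \near (0 : T),
    `|f (h + x) - f x - dot g h| <= e * `|h|) -> has_grad f x g.
Proof.
move=> H.
have h : f \o shift x = cst (f x) + dot g +o_ (0 : T) id.
  apply/eqaddoP => e e0; near=> h; rewrite /= opprD addrA; near: h; exact: H.
have dE := diff_unique (@continuous_dotl g) h.
apply: DiffDef => //; apply/diff_locallyP; rewrite dE; split=> //.
exact: continuous_dotl.
Unshelve. all: by end_near. Qed.

Lemma has_gradP f x g : has_grad f x g -> forall e, 0 < e -> \forall h \near (0 : T),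
    `|f (h + x) - f x - dot g h| <= e * `|h|.
Proof.
move=> [/diff_locallyP[_ +] dE] e e0; rewrite dE => /eqaddoP/(_ e e0).
by apply: filterS => h; rewrite /= opprD addrA.
Qed.

Lemma partial_diff f x i : differentiable f x -> partial i f x = 'd f x (delta_mx 0 i).
Proof. exact: deriveE. Qed.

Lemma has_grad_grad f x : differentiable f x -> has_grad f x (grad f x).
Proof.
move=> df; apply: DiffDef => //; apply/funext => v.
rewrite {1}[v]row_sum_delta linear_sum /dot; apply: eq_bigr => i _.
by rewrite linearZ/= -partial_diff// mxE mulrC.
Qed.

Lemma has_gradE f x g : has_grad f x g -> grad f x = g.
Proof.
move=> [df dE]; apply/rowP => i; rewrite mxE partial_diff// dE.
exact: dot_delta.
Qed.

Lemma has_grad_diff f x g : has_grad f x g -> differentiable f x.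
Proof. by case. Qed.

Lemma has_grad_partial f x g i : has_grad f x g -> partial i f x = g 0 i.
Proof. by move=> /has_gradE <-; rewrite mxE. Qed.

Lemma near_shift0 x (P : T -> Prop) : (\forall y \near x, P y) -> \forall h \near (0 : T), P (h + x).
Proof.
move=> H; have c : {for (0 : T), continuous (fun h : T => h + x)}.
  by apply: continuousD; [move=> ?|exact: cst_continuous].
have := c P; rewrite /= add0r => /(_ H).
exact.
Qed.

Lemma has_grad_near f k x g : (\forall y \near x, f y = k y) -> has_grad f x g -> has_grad k x g.
Proof.
move=> fk /has_gradP H; apply: has_grad_eps => e e0.
have fkx := nbhs_singleton fk.
have := near_shift0 fk; have := H e e0; apply: filterS2 => h h1 h2.
by rewrite -h2 -fkx.
Qed.

Lemma has_grad_cst a x : has_grad (cst a) x 0.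
Proof.
apply: has_grad_eps => e e0; near=> h.
rewrite subrr sub0r normrN /dot big1 ?normr0 => [|i _]; first by rewrite mulr_ge0// ltW.
by rewrite mxE mul0r.
Unshelve. all: by end_near. Qed.

Lemma has_grad_dot v x : has_grad (dot v) x v.
Proof.
apply: has_grad_eps => e e0; near=> h.
by rewrite dotDr addrK subrr normr0 mulr_ge0// ltW.
Unshelve. all: by end_near. Qed.

Lemma has_grad_coord i x : has_grad (fun y => y 0 i) x (delta_mx 0 i).
Proof.
have <- : dot (delta_mx 0 i : T) = (fun y => y 0 i).
  by apply/funext => y; rewrite dotC dot_delta.
exact: has_grad_dot.
Qed.

Lemma has_gradD f k x g g' : has_grad f x g -> has_grad k x g' ->
  has_grad (fun y => f y + k y) x (g + g').
Proof.
move=> h1 h2; rewrite /has_grad (_ : dot (g + g') = dot g + dot g'); last first.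
  by apply/funext => v; rewrite dotDl.
exact: is_diffD.
Qed.

Lemma has_gradM f k x g g' : has_grad f x g -> has_grad k x g' ->
  has_grad (fun y => f y * k y) x (f x *: g' + k x *: g).
Proof.
move=> h1 h2; rewrite /has_grad (_ : dot _ = f x *: dot g' + k x *: dot g); last first.
  by apply/funext => v; rewrite dotDl !dotZl.
exact: is_diffM.
Qed.

Lemma has_gradZ f a x g : has_grad f x g -> has_grad (fun y => a * f y) x (a *: g).
Proof.
move=> h; have := has_gradM (has_grad_cst a x) h.
by rewrite scaler0 addr0.
Qed.

Lemma has_gradB f k x g g' : has_grad f x g -> has_grad k x g' ->
  has_grad (fun y => f y - k y) x (g - g').
Proof.
move=> h1 h2; have := has_gradD h1 (has_gradZ (-1) h2); rewrite scaleN1r.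
by congr has_grad; apply/funext => y; rewrite mulN1r.
Qed.

Lemma has_grad_sum m (F : 'I_m -> T -> R) x (g : 'I_m -> T) :
  (forall i, has_grad (F i) x (g i)) -> has_grad (fun y => \sum_i F i y) x (\sum_i g i).
Proof.
elim: m F g => [|m IH] F g h.
  rewrite big_ord0; have := has_grad_cst 0 x; congr has_grad.
  by apply/funext => y; rewrite big_ord0.
rewrite big_ord_recl; have := has_gradD (h ord0) (IH _ _ (fun i => h (lift ord0 i))).
by congr has_grad; apply/funext => y; rewrite big_ord_recl.
Qed.

Lemma has_grad_comp (a : R -> R) (a' : R) f x g : has_grad f x g ->
  is_derive (f x) 1 a a' -> has_grad (fun y => a (f y)) x (a' *: g).
Proof.
move=> h [da aE]; rewrite /has_grad (_ : dot _ = (fun y => y *: a') \o dot g); last first.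
  by apply/funext => v; rewrite dotZl mulrC.
apply: is_diff_comp => //; apply: DiffDef; first exact/derivable1_diffP.
by rewrite deriv1E// derive1E aE.
Qed.

Let is_diff_comb m (F : 'I_m -> T -> R) x (g w : 'I_m -> T) :
  (forall i, has_grad (F i) x (g i)) ->
  is_diff x (fun y => \sum_i F i y *: w i) (fun v => \sum_i dot (g i) v *: w i).
Proof.
elim: m F g w => [|m IH] F g w h.
  have -> : (fun y => \sum_i F i y *: w i) = cst 0 by apply/funext => y; rewrite big_ord0.
  have -> : (fun v => \sum_i dot (g i) v *: w i) = 0 by apply/funext => y; rewrite big_ord0.
  exact: is_diff_cst.
have -> : (fun y => \sum_i F i y *: w i) = (fun r => r *: w ord0) \o F ord0 +
    (fun y => \sum_i F (lift ord0 i) y *: w (lift ord0 i)).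
  by apply/funext => y; rewrite big_ord_recl.
have -> : (fun v => \sum_i dot (g i) v *: w i) = (fun r => r *: w ord0) \o dot (g ord0) +
    (fun v => \sum_i dot (g (lift ord0 i)) v *: w (lift ord0 i)).
  by apply/funext => y; rewrite big_ord_recl.
apply: is_diffD; last by apply: IH => i; exact: h.
exact: (@is_diff_comp _ _ _ _ _ _ _ _ _ (h ord0) (is_diff_scalel _ _)).
Qed.

Lemma has_grad_compv k x g (G : 'I_n.+1 -> T -> R) (Gg : 'I_n.+1 -> T) :
  (forall i, has_grad (G i) x (Gg i)) -> has_grad k (\row_i G i x) g ->
  has_grad (fun y => k (\row_i G i y)) x (\sum_i g 0 i *: Gg i).
Proof.
move=> hG hk.
have E y : \sum_i G i y *: delta_mx 0 i = \row_i G i y :> T.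
  by rewrite [RHS]row_sum_delta; apply: eq_bigr => i _; rewrite mxE.
have := is_diff_comb (fun i => delta_mx 0 i) hG.
have -> : (fun y => \sum_i G i y *: delta_mx 0 i) = (fun y => \row_i G i y) by exact/funext.
move=> dG; have := @is_diff_comp _ _ _ _ _ _ _ _ _ dG hk; rewrite /has_grad.
congr is_diff_def; apply/funext => v /=; rewrite linear_sum/= dot_suml.
by apply: eq_bigr => i _; rewrite linearZ/= dotZl dot_delta mulrC.
Qed.

(** With [s] the inverse of the gauge this differentiates a function of the
    projection onto a level set. *)
Lemma has_grad_scale (s : T -> R) k x sg g : has_grad s x sg -> has_grad k (s x *: x) g ->
  has_grad (fun y => k (s y *: y)) x (s x *: g + dot g x *: sg).
Proof.
move=> hs hk.
have E y : \row_i (s y * y 0 i) = s y *: y by apply/rowP => i; rewrite !mxE.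
have hG i := has_gradM hs (has_grad_coord i x).
have := has_grad_compv (G := fun i y => s y * y 0 i) (x := x) (k := k) (g := g) hG.
rewrite E => /(_ hk).
have -> : (fun y => k (\row_i (s y * y 0 i))) = (fun y => k (s y *: y)).
  by apply/funext => y; rewrite E.
congr has_grad; under eq_bigr do rewrite scalerDr !scalerA.
rewrite big_split/=; congr (_ + _).
  under eq_bigr do rewrite mulrC -scalerA.
  by rewrite -scaler_sumr -row_sum_delta.
by rewrite -scaler_suml.
Qed.

Lemma has_grad_dilate r k x g : has_grad k (r *: x) g -> has_grad (fun y => k (r *: y)) x (r *: g).
Proof. by move=> h; have := has_grad_scale (has_grad_cst r x) h; rewrite scaler0 addr0. Qed.

Lemma has_grad_line k x v g (t : R) : has_grad k (x + t *: v) g ->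
  is_derive t 1 (fun s => k (x + s *: v)) (dot g v).
Proof.
move=> hk; have hl : is_diff t (fun s : R => x + s *: v) (fun s => s *: v).
  have := @is_diffD _ _ _ (cst x) (fun s : R => s *: v) 0 (fun s => s *: v) t (is_diff_cst _ _) (is_diff_scalel _ _).
  by rewrite add0r.
have [d dE] := @is_diff_comp _ _ _ _ _ _ _ _ _ hl hk.
have d1 : derivable (fun s : R => k (x + s *: v)) t 1 by apply/derivable1_diffP.
by apply: DeriveDef => //; rewrite deriveE// dE/= scale1r.
Qed.

Lemma has_grad_continuous f x g : has_grad f x g -> {for x, continuous f}.
Proof. by move=> /has_grad_diff; exact: differentiable_continuous. Qed.

End Gradient.

Section Homogeneous.
Context {R : realType} (n : nat).
Local Notation T := ('rV[R]_n.+1).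
Implicit Types (f k : T -> R) (x v g : T).

Lemma near_neq0 x : x != 0 -> \forall y \near x, y != 0.
Proof. by move=> x0; exact: open_nbhs_nbhs (conj (@open_neq0 R n) x0). Qed.

Lemma grad_homogeneous f (d r : R) x : x != 0 -> 0 < r ->
  (forall y, y != 0 -> f (r *: y) = r `^ d * f y) ->
  (forall y, y != 0 -> differentiable f y) ->
  grad f (r *: x) = r `^ (d - 1) *: grad f x.
Proof.
move=> x0 r0 hf df.
have rx0 : r *: x != 0 by rewrite scaler_eq0 negb_or x0 gt_eqF.
have h1 := has_grad_dilate (has_grad_grad (df _ rx0)).
have h2 := has_gradZ (r `^ d) (has_grad_grad (df _ x0)).
have h3 : has_grad (fun y => f (r *: y)) x (r `^ d *: grad f x).
  by apply: has_grad_near h2; near=> y; rewrite hf//; near: y; exact: near_neq0.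
have := etrans (esym (has_gradE h1)) (has_gradE h3) => /(congr1 (fun z => r^-1 *: z)).
rewrite !scalerA mulVf ?gt_eqF// scale1r => ->; congr (_ *: _).
by rewrite powRB ?powRr1 ?ltW// ?(gt_eqF r0) ?implybT// mulrC.
Unshelve. all: by end_near. Qed.

(** Differentiate [f (r *: x) = r ^ d * f x] at [r = 1]. *)
Lemma euler f (d : R) x g : has_grad f x g ->
  (forall r, 0 < r -> f (r *: x) = r `^ d * f x) -> dot g x = d * f x.
Proof.
move=> h hf.
have h1 : is_derive (1 : R) 1 (fun s => f (0 + s *: x)) (dot g x).
  by apply: has_grad_line; rewrite add0r scale1r.
have h2 : is_derive (1 : R) 1 (fun s => s `^ d * f x) (d * f x).
  apply: der_eq (derM (is_derive1_powR d ltr01) (der_cst (f x) 1)) _.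
  by rewrite mulr0 addr0 powR1 mulr1.
have h3 : is_derive (1 : R) 1 (fun s => f (0 + s *: x)) (d * f x).
  apply: near_eq_is_derive h2; near=> s; rewrite add0r hf//.
  by near: s; exact: lt_nbhsr.
by have [_ <-] := h1; have [_ ->] := h3.
Unshelve. all: by end_near. Qed.

Lemma der_ge0_right (f : R -> R) (d : R) : is_derive (0 : R) 1 f d ->
  (\forall t \near 0^'+, f 0 <= f t) -> 0 <= d.
Proof.
move=> [df dE] H; rewrite -dE.
have c : h^-1 *: (f (h *: (1 : R) + 0) - f 0) @[h --> 0^'+] --> 'D_1 f 0.
  by apply: cvg_dnbhs_at_right; exact: df.
rewrite -(cvg_lim _ c)//; apply: limr_ge; first by apply: cvgP c.
near=> t.
have t0 : 0 < t by near: t; exact: nbhs_right_gt.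
rewrite /GRing.scale/= mulr1 addr0; apply: mulr_ge0; first by rewrite invr_ge0 ltW.
rewrite subr_ge0.
by near: t.
Unshelve. all: by end_near. Qed.

Section Convex.
Variable f : T -> R.
Hypothesis cf : strictly_convex f.

Lemma convex_tangent x y g : has_grad f x g -> dot g (y - x) <= f y - f x.
Proof.
move=> h.
have [->|xy] := eqVneq x y; first by rewrite !subrr /dot big1// => i _; rewrite mxE mulr0.
have h1 : is_derive (0 : R) 1 (fun s : R => f (x + s *: (y - x))) (dot g (y - x)).
  by apply: has_grad_line; rewrite scale0r addr0.
have h2 := derB (derM (der_cst (f y - f x) 0) (is_derive_id (0 : R) (1 : R))) h1.
rewrite mul0r add0r mulr1 in h2.
rewrite -subr_ge0; apply: (der_ge0_right h2).
rewrite mulr0 scale0r addr0 sub0r; near=> t.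
have t0 : 0 < t by near: t; exact: nbhs_right_gt.
have t1 : t < 1 by near: t; apply: nbhs_right_lt.
have tt : 0 < 1 - t < 1 by apply/andP; split; lra.
have := cf xy tt; have -> : 1 - (1 - t) = t by ring.
have -> : (1 - t) *: x + t *: y = x + t *: (y - x).
  by rewrite scalerBr scalerBl scale1r -addrA [- _ + _]addrC.
by move=> /ltW; rewrite -[(1 - t) * _]/((1 - t) * f x); lra.
Unshelve. all: by end_near. Qed.

(** Differentiate the gradient along the line of direction [v], where convexity makes
    its component on [v] monotone. *)
Lemma convex_hessian_ge0 x v :
  (\forall y \near x, differentiable f y) ->
  (forall i, has_grad (partial i f) x (grad (partial i f) x)) ->
  0 <= dot (v *m hess f x) v.
Proof.
move=> df d2f.
pose P (t : R) := \sum_i v 0 i * partial i f (x + t *: v).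
have dP : is_derive (0 : R) 1 P (\sum_i v 0 i * dot (grad (partial i f) x) v).
  have hg : has_grad (fun y => \sum_i v 0 i * partial i f y) (x + 0 *: v) (\sum_i v 0 i *: grad (partial i f) x).
    by rewrite scale0r addr0; apply: has_grad_sum => i; exact: has_gradZ.
  have := has_grad_line hg; congr is_derive.
  rewrite dot_suml; apply: eq_bigr => i _; exact: dotZl.
have -> : dot (v *m hess f x) v = \sum_i v 0 i * dot (grad (partial i f) x) v.
  rewrite {1}/dot; apply: eq_bigr => j _; rewrite mulrC mxE; congr (_ * _).
  by rewrite /dot; apply: eq_bigr => i _; rewrite !mxE mulrC.
have ct : (fun s : R => x + s *: v) @ (0 : R) --> x.
  have c0 : {for (0 : R), continuous (fun s : R => x + s *: v)}.
    by apply: continuousD; [exact: cst_continuous|exact: scalel_continuous].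
  by move: c0; rewrite /prop_for /continuous_at scale0r addr0.
apply: (der_ge0_right dP); near=> t.
have t0 : 0 < t by near: t; exact: nbhs_right_gt.
have PE s : differentiable f (x + s *: v) -> P s = dot (grad f (x + s *: v)) v.
  by move=> ds; rewrite /P /dot; apply: eq_bigr => i _; rewrite mxE mulrC.
have dt : differentiable f (x + t *: v).
  near: t; apply: cvg_within; exact: (ct _ df).
have d0 : differentiable f x by exact: nbhs_singleton df.
have d0' : differentiable f (x + (0 : R) *: v) by rewrite scale0r addr0.
rewrite !PE//.
have h1 := convex_tangent (x + t *: v) (has_grad_grad d0').
have h2 := convex_tangent (x + (0 : R) *: v) (has_grad_grad dt).
move: h1 h2; rewrite !scale0r !addr0 addrAC subrr add0r opprD addrA subrr add0r -scaleNr !dotZr => h1 h2.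
rewrite -(ler_pM2l t0); lra.
Unshelve. all: by end_near. Qed.
End Convex.

End Homogeneous.

(** * Inverse quadratic forms under a rank one correction *)

Section QuadraticForm.
Context {R : realType} (n : nat).
Local Notation T := ('rV[R]_n.+1).
Variables (H : 'M[R]_n.+1) (p u : T) (a c : R).
Hypotheses (a1 : a - 1 != 0) (Hu : H \in unitmx) (uH : u *m H = (a - 1) *: p)
  (Hut : H *m u^T = (a - 1) *: p^T) (pu : dot p u = c).

Lemma dot_mx (x y : T) : x *m y^T = (dot x y)%:M.
Proof. by apply/rowP => i; rewrite ord1 !mxE eqxx mulr1n; apply: eq_bigr => j _; rewrite mxE. Qed.

Lemma mx_dot (x y : T) : dot x y = (x *m y^T) 0 0.
Proof. by rewrite dot_mx mxE eqxx. Qed.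

Let pV : p *m invmx H = (a - 1)^-1 *: u.
Proof. by rewrite -[u in RHS](mulmxK Hu) uH -scalemxAl scalerA mulVf// scale1r. Qed.

Let Vp : invmx H *m p^T = (a - 1)^-1 *: u^T.
Proof. by rewrite -[u^T](mulKmx Hu) Hut -scalemxAr scalerA mulVf// scale1r. Qed.

Let dotVp (xi : T) : dot (xi *m invmx H) p = (a - 1)^-1 * dot xi u.
Proof. by rewrite !mx_dot -mulmxA Vp -scalemxAr mxE. Qed.

(** In the basis made of [p] and of the covectors vanishing on [u], the inverse of [H] is
    block diagonal because [H] maps [u] to a multiple of [p]. *)
Lemma inv_form_decomp (b : R) (xi : T) : dot xi u = 0 ->
  dot ((b *: p + xi) *m invmx H) (b *: p + xi) =
  b ^+ 2 * c / (a - 1) + dot (xi *m invmx H) xi.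
Proof.
move=> xu; rewrite mulmxDl -scalemxAl pV dotDl !dotDr !dotZl !dotZr dotVp.
by rewrite xu (dotC u xi) xu (dotC u p) pu; ring.
Qed.

Hypothesis su : sphere R n.+1 u.
Variables (k s : R).
Hypotheses (k0 : k != 0) (sc : s * c = a - 1).
Let A := k *: (H - s *: (p^T *m p)).

Let uu : u *m u^T = 1%:M. Proof. by rewrite dot_mx -enorm_sqr su expr1n. Qed.

Lemma hess_rank_one_row : u *m A = 0.
Proof.
rewrite /A -scalemxAr mulmxBr uH -scalemxAr mulmxA dot_mx (dotC u p) pu mul_scalar_mx.
by rewrite scalerA sc subrr scaler0.
Qed.

Lemma hess_rank_one_col : A *m u^T = 0.
Proof.
rewrite /A -scalemxAl mulmxBl Hut -scalemxAl -mulmxA dot_mx pu mul_mx_scalar.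
by rewrite scalerA sc subrr scaler0.
Qed.

(** A kernel vector is orthogonal to [u], as [A] annihilates [u^T]; on the other hand the
    rank one correction forces it to be a multiple of [u]. *)
Let unitA : A + u^T *m u \in unitmx.
Proof.
rewrite -row_free_unit -kermx_eq0; apply/rowV0P => w /sub_kermxP wA.
have wu : w *m u^T = 0.
  have := congr1 (mulmx^~ u^T) wA; rewrite mul0mx -mulmxA mulmxDl hess_rank_one_col add0r.
  by rewrite -mulmxA uu mulmx1.
have := wA; rewrite mulmxDr mulmxA wu mul0mx addr0 /A -scalemxAr => /eqP.
rewrite scaler_eq0 (negbTE k0)/= mulmxBr subr_eq0 => /eqP wH.
have wE : w = (s * dot w p / (a - 1)) *: u.
  rewrite -[LHS](mulmxK Hu) wH -scalemxAr mulmxA dot_mx mul_scalar_mx -!scalemxAl pV.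
  by rewrite !scalerA.
have := wu; rewrite {1}wE -scalemxAl uu => /matrixP/(_ 0 0); rewrite !mxE eqxx mulr1 => e.
by rewrite wE e scale0r.
Qed.

(** If [e] solves [e *m A = xi] with [e] orthogonal to [u], then the form of [tinv] at
    [xi] is [dot e xi].  Such an [e] is obtained from [xi *m invmx H] by adding a
    multiple of [u], because the rank one correction by [p] only sees the component of
    [xi *m invmx H] along [p], which vanishes. *)
Lemma tinv_form (xi : T) : dot xi u = 0 ->
  dot (xi *m tinv u A) xi = k^-1 * dot (xi *m invmx H) xi.
Proof.
move=> xu; pose e0 := xi *m invmx H.
have e0p : dot e0 p = 0 by rewrite dotVp xu mulr0.
pose e := k^-1 *: e0 - (k^-1 * dot e0 u) *: u.
have eE : e *m (A + u^T *m u) = xi.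
  have eu : e *m u^T = 0.
    rewrite dot_mx /e dotBl !dotZl (_ : dot u u = 1); last by rewrite -enorm_sqr su expr1n.
    by rewrite mulr1 subrr raddf0.
  rewrite mulmxDr mulmxA eu mul0mx addr0 /e mulmxBl -scalemxAl -[X in _ - X]scalemxAl.
  rewrite hess_rank_one_row scaler0 subr0 /A -scalemxAr scalerA mulVf// scale1r mulmxBr.
  by rewrite mulmxKV// -scalemxAr mulmxA dot_mx e0p raddf0 mul0mx scaler0 subr0.
have xV : xi *m invmx (A + u^T *m u) = e by rewrite -[in LHS]eE mulmxK.
rewrite /tinv mulmxBr mulmxA dot_mx xu raddf0 mul0mx subr0 xV /e dotBl !dotZl.
by rewrite (dotC u xi) xu mulr0 subr0.
Qed.
End QuadraticForm.

(** * The homogeneous potential and its gauge *)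

Section Potential.
Context {R : realType} (n : nat).
Local Notation T := ('rV[R]_n.+1).
Local Notation S := (sphere R n.+1).
Variables (al : R) (Phi phi : T -> R).
Hypothesis al_gt1 : 1 < al.
Hypothesis hconv : strictly_convex Phi.
Hypothesis phi_gt0 : forall u, S u -> 0 < phi u.
Hypothesis PhiE : forall x, Phi x = al^-1 * enorm x `^ al * phi (radial x) `^ al.
Hypothesis CPhi : Ck 2 [set x | x != 0] Phi.
Hypothesis hdet : forall x, x != 0 -> 0 < \det (hess Phi x).

Let al_gt0 : 0 < al. Proof. exact: lt_trans al_gt1. Qed.
Let al1 : 0 < al - 1. Proof. by rewrite subr_gt0. Qed.

Lemma radialZ (r : R) (x : T) : 0 < r -> radial (r *: x) = radial x.
Proof.
move=> r0; rewrite /radial enormZ gtr0_norm// scalerA invfM mulrAC mulVf ?mul1r//.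
by rewrite gt_eqF.
Qed.

Lemma radial_neq0 (x : T) : x != 0 -> radial x != 0.
Proof. by move=> x0; rewrite scaler_eq0 negb_or invr_eq0 enorm_eq0 x0. Qed.

Lemma Phi_homogeneous (r : R) (x : T) : 0 < r -> Phi (r *: x) = r `^ al * Phi x.
Proof.
move=> r0; rewrite !PhiE radialZ// enormZ gtr0_norm// powRM ?(ltW r0) ?enorm_ge0//.
by ring.
Qed.

Lemma phi_radial_gt0 x : x != 0 -> 0 < phi (radial x).
Proof. by move=> x0; apply: phi_gt0; exact: enorm_radial. Qed.

Lemma Phi_gt0 x : x != 0 -> 0 < Phi x.
Proof.
move=> x0; rewrite PhiE !mulr_gt0 ?invr_gt0 ?powR_gt0 ?enorm_gt0//.
exact: phi_radial_gt0.
Qed.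

Let aPhi_gt0 x : x != 0 -> 0 < al * Phi x.
Proof. by move=> x0; rewrite mulr_gt0 ?Phi_gt0. Qed.

Lemma aPhiE x : x != 0 -> al * Phi x = (enorm x * phi (radial x)) `^ al.
Proof.
move=> x0; rewrite PhiE 2!mulrA divff ?gt_eqF// mul1r powRM ?enorm_ge0//.
by rewrite ltW// phi_radial_gt0.
Qed.

(** The Minkowski functional of the convex body [{Phi <= 1 / al}]. *)
Definition gauge x := (al * Phi x) `^ al^-1.

Lemma gaugeE x : x != 0 -> gauge x = enorm x * phi (radial x).
Proof.
move=> x0; rewrite /gauge aPhiE// -powRrM divff ?gt_eqF// powRr1// ltW//.
by rewrite mulr_gt0 ?enorm_gt0// phi_radial_gt0.
Qed.

Lemma gauge_sphere u : S u -> gauge u = phi u.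
Proof. by move=> Su; rewrite gaugeE ?sphere_neq0// radial_sphere// Su mul1r. Qed.

Lemma gauge_gt0 x : x != 0 -> 0 < gauge x.
Proof. by move=> x0; rewrite powR_gt0// aPhi_gt0. Qed.

Lemma gauge_powR x : x != 0 -> gauge x `^ al = al * Phi x.
Proof. by move=> x0; rewrite /gauge -powRrM mulVf ?gt_eqF// powRr1// ltW// aPhi_gt0. Qed.

Lemma dPhi x : x != 0 -> has_grad Phi x (grad Phi x).
Proof. by move=> x0; apply: has_grad_grad; exact: (CPhi.1). Qed.

Lemma d2Phi i x : x != 0 -> has_grad (partial i Phi) x (grad (partial i Phi) x).
Proof. by move=> x0; apply: has_grad_grad; exact: ((CPhi.2 i).1). Qed.

Lemma grad_Phi_homogeneous (r : R) x : x != 0 -> 0 < r ->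
  grad Phi (r *: x) = r `^ (al - 1) *: grad Phi x.
Proof.
move=> x0 r0; apply: grad_homogeneous => // y y0; first exact: Phi_homogeneous.
exact: (CPhi.1).
Qed.

Lemma partial_Phi_homogeneous i (r : R) x : x != 0 -> 0 < r ->
  partial i Phi (r *: x) = r `^ (al - 1) * partial i Phi x.
Proof.
move=> x0 r0; have := grad_Phi_homogeneous x0 r0 => /(congr1 (fun v : T => v 0 i)).
by rewrite !mxE.
Qed.

Lemma hess_homogeneous (r : R) x : x != 0 -> 0 < r ->
  hess Phi (r *: x) = r `^ (al - 2) *: hess Phi x.
Proof.
move=> x0 r0; apply/matrixP => i j.
have /(congr1 (fun v : T => v 0 i)) := @grad_homogeneous _ _ (partial j Phi) (al - 1) r x x0 r0
  (fun y y0 => partial_Phi_homogeneous j y0 r0) (fun y y0 => (CPhi.2 j).1 y y0).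
by rewrite !mxE (_ : al - 1 - 1 = al - 2)//; ring.
Qed.

Lemma euler_Phi x : x != 0 -> dot (grad Phi x) x = al * Phi x.
Proof. by move=> x0; apply: euler (dPhi x0) _ => r r0; exact: Phi_homogeneous. Qed.

(** Euler's identity for the partial derivatives, which are homogeneous of degree
    [al - 1]. *)
Lemma hess_row x : x != 0 -> x *m hess Phi x = (al - 1) *: grad Phi x.
Proof.
move=> x0; apply/rowP => j; rewrite !mxE.
have := euler (d2Phi j x0) (fun r r0 => partial_Phi_homogeneous j x0 r0) => <-.
by apply: eq_bigr => i _; rewrite !mxE mulrC.
Qed.

(** Differentiate the identity [dot (grad Phi x) x = al * Phi x] in each coordinate. *)
Lemma hess_col x : x != 0 -> hess Phi x *m x^T = (al - 1) *: (grad Phi x)^T.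
Proof.
move=> x0.
have h1 : has_grad (fun y => \sum_i y 0 i * partial i Phi y) x
    (\sum_i (x 0 i *: grad (partial i Phi) x + partial i Phi x *: delta_mx 0 i)).
  apply: has_grad_sum => i; apply: has_gradM; first exact: has_grad_coord.
  exact: d2Phi.
have h2 : has_grad (fun y => \sum_i y 0 i * partial i Phi y) x (al *: grad Phi x).
  apply: has_grad_near (has_gradZ al (dPhi x0)); near=> y.
  have y0 : y != 0 by near: y; exact: near_neq0.
  by rewrite -euler_Phi//; apply: eq_bigr => i _; rewrite mxE mulrC.
have := etrans (esym (has_gradE h1)) (has_gradE h2).
rewrite big_split/= => /(congr1 trmx)/colP E; apply/colP => i; have := E i.
rewrite !mxE summxE (_ : (\sum_j partial j Phi x *: delta_mx 0 j) 0 i = partial i Phi x); last first.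
  rewrite summxE (bigD1 i)//= !mxE !eqxx mulr1 big1 ?addr0// => j ji.
  by rewrite !mxE eq_sym (negbTE ji) mulr0.
move=> e; rewrite mulrBl mul1r -e addrK.
by apply: eq_bigr => j _; rewrite !mxE mulrC.
Unshelve. all: by end_near. Qed.

Lemma hess_unit x : x != 0 -> hess Phi x \in unitmx.
Proof. by move=> x0; rewrite unitmxE unitfE gt_eqF// hdet. Qed.

Lemma hess_ge0 x v : x != 0 -> 0 <= dot (v *m hess Phi x) v.
Proof.
move=> x0; apply: (convex_hessian_ge0 hconv); last by move=> i; exact: d2Phi.
by apply: filterS (near_neq0 x0) => y; exact: (CPhi.1).
Qed.

(** The integrand of (A), as a quadratic form in the gradient. *)
Definition invhess x (xi : T) : R := dot (xi *m invmx (hess Phi x)) xi.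

Lemma invhess_ge0 x xi : x != 0 -> 0 <= invhess x xi.
Proof.
move=> x0; rewrite /invhess -{2}[xi](mulmxKV (hess_unit x0)) dotC.
exact: hess_ge0.
Qed.

Lemma invhessZ x (k : R) xi : invhess x (k *: xi) = k ^+ 2 * invhess x xi.
Proof. by rewrite /invhess -scalemxAl dotZl dotZr mulrA expr2. Qed.

Lemma invhess_homogeneous (r : R) x xi : x != 0 -> 0 < r ->
  invhess (r *: x) xi = r `^ (2 - al) * invhess x xi.
Proof.
move=> x0 r0; rewrite /invhess hess_homogeneous// invmxZ ?hess_unit//.
  by rewrite -scalemxAr dotZl -powRN opprB.
by rewrite unitmxZ ?hess_unit// unitfE gt_eqF// powR_gt0.
Qed.

Lemma invhess_decomp x (b : R) xi : x != 0 -> dot xi x = 0 ->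
  invhess x (b *: grad Phi x + xi) = b ^+ 2 * (al * Phi x) / (al - 1) + invhess x xi.
Proof.
move=> x0 xx; apply: inv_form_decomp (hess_unit x0) (hess_row x0) (hess_col x0) (euler_Phi x0) _ _ _ => //.
by rewrite gt_eqF.
Qed.

Let K x := (al * Phi x) `^ (al^-1 - 1).

Lemma has_grad_powPhi (b : R) x : x != 0 ->
  has_grad (fun y => (al * Phi y) `^ b) x ((b * (al * Phi x) `^ (b - 1)) *: (al *: grad Phi x)).
Proof.
move=> x0; apply: (has_grad_comp (a := fun s => s `^ b)); first exact/has_gradZ/dPhi.
by apply: is_derive1_powR; exact: aPhi_gt0.
Qed.

Lemma has_grad_gauge x : x != 0 -> has_grad gauge x (K x *: grad Phi x).
Proof.
move=> x0; have := has_grad_powPhi al^-1 x0; congr has_grad.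
by rewrite scalerA mulrAC mulVf ?mul1r// gt_eqF.
Qed.

Lemma grad_gauge x : x != 0 -> grad gauge x = K x *: grad Phi x.
Proof. by move=> x0; apply: has_gradE; exact: has_grad_gauge. Qed.

Lemma gauge_homogeneous (r : R) x : 0 < r -> gauge (r *: x) = r * gauge x.
Proof.
move=> r0; rewrite /gauge Phi_homogeneous// mulrCA [LHS]powRM ?powR_ge0//.
  by rewrite -powRrM divff ?gt_eqF// powRr1// ltW.
have [->|x0] := eqVneq x 0; last by rewrite ltW// aPhi_gt0.
by rewrite PhiE enorm0 powR0 ?gt_eqF// mulr0 mul0r mulr0.
Qed.

Lemma grad_gauge_radial x : x != 0 -> grad gauge (radial x) = grad gauge x.
Proof.
move=> x0; have e0 : 0 < (enorm x)^-1 by rewrite invr_gt0 enorm_gt0.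
rewrite /radial (@grad_homogeneous _ _ gauge 1)//.
- by rewrite subrr powRr0 scale1r.
- by move=> y _; rewrite gauge_homogeneous// powRr1// ltW.
- by move=> y /has_grad_gauge/has_grad_diff.
Qed.

(** Computed by the chain rule from [gauge = (al * Phi) ^ (1 / al)]. *)
Definition hess_gauge x : 'M[R]_n.+1 :=
  K x *: (hess Phi x - ((al - 1) / (al * Phi x)) *: ((grad Phi x)^T *m grad Phi x)).

Lemma has_grad_grad_gauge j x : x != 0 ->
  has_grad (fun y => grad gauge y 0 j) x (col j (hess_gauge x))^T.
Proof.
move=> x0; apply: (@has_grad_near _ _ (fun y => K y * partial j Phi y)).
  near=> y; have y0 : y != 0 by near: y; exact: near_neq0.
  by rewrite grad_gauge// !mxE.
have := has_gradM (has_grad_powPhi (al^-1 - 1) x0) (d2Phi j x0); congr has_grad.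
apply/rowP => i; rewrite !mxE big_ord1 !mxE -/(K x).
have aP := aPhi_gt0 x0.
have -> : (al * Phi x) `^ (al^-1 - 1 - 1) = K x / (al * Phi x).
  by rewrite /K powRB ?powRr1 ?(ltW aP)// ?(gt_eqF aP) ?implybT.
move: (partial i Phi x) (partial j Phi x) (K x) => a b k.
have := Phi_gt0 x0; move: (Phi x) => P P0.
by field; rewrite !gt_eqF.
Unshelve. all: by end_near. Qed.

Lemma has_grad_inv_enorm x : x != 0 ->
  has_grad (fun y : T => (enorm y)^-1) x (- ((enorm x)^-1 ^+ 3) *: x).
Proof.
move=> x0; have e0 : 0 < enorm x by rewrite enorm_gt0.
have d0 : 0 < dot x x by rewrite -enorm_sqr exprn_gt0.
have -> : (fun y : T => (enorm y)^-1) = (fun y => (dot y y) `^ (- 2^-1)).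
  by apply/funext => y; rewrite powRN powR12_sqrt ?dot_ge0.
have h : has_grad (fun y : T => dot y y) x (2 *: x).
  have := has_grad_sum (fun i => has_gradM (has_grad_coord i x) (has_grad_coord i x)).
  congr has_grad; under eq_bigr do rewrite -scalerDl -mulr2n.
  by rewrite [RHS](row_sum_delta) ; apply: eq_bigr => i _; rewrite mxE mulr_natl.
have := has_grad_comp h (is_derive1_powR (- 2^-1) d0); congr has_grad.
rewrite scalerA; congr (_ *: _).
have -> : (- 2^-1 - 1 : R) = - (2^-1 * 3%:R) by field.
rewrite powRN powRrM powR12_sqrt ?dot_ge0// powR_mulrn ?sqrtr_ge0// exprVn -/(enorm x).
by field; rewrite gt_eqF.
Qed.

Lemma has_grad_phi_radial x : x != 0 -> has_grad (phi \o radial) x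
  ((enorm x)^-1 *: grad gauge x - (gauge x * (enorm x)^-1 ^+ 3) *: x).
Proof.
move=> x0; apply: (@has_grad_near _ _ (fun y => gauge y * (enorm y)^-1)).
  near=> y; have y0 : y != 0 by near: y; exact: near_neq0.
  by rewrite gaugeE// mulrC mulKf// enorm_eq0.
have := has_gradM (has_grad_gauge x0) (has_grad_inv_enorm x0); congr has_grad.
by rewrite grad_gauge// addrC; congr (_ + _); rewrite scalerA mulrN scaleNr.
Unshelve. all: by end_near. Qed.

Lemma continuous_phi_radial x : x != 0 -> {for x, continuous (phi \o radial)}.
Proof. by move=> x0; exact: has_grad_continuous (has_grad_phi_radial x0). Qed.

Lemma sgrad_phi_radial x j : x != 0 ->
  sgrad phi (radial x) 0 j = grad gauge x 0 j - gauge x * x 0 j * (enorm x)^-1 ^+ 2.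
Proof.
move=> x0; rewrite /sgrad (has_gradE (has_grad_phi_radial (radial_neq0 x0))).
rewrite grad_gauge_radial// enorm_radial// invr1 expr1n scale1r mulr1.
rewrite {1}/radial gauge_homogeneous ?invr_gt0 ?enorm_gt0// !mxE.
by congr (_ - _); ring.
Qed.

(** The Hessian of the degree one extension of [phi] restricted to the tangent space:
    the tangential projections remove every term with a factor [u], and the gradient of
    the extension is homogeneous of degree 0, hence its derivative vanishes on [u]. *)
Lemma D2_gauge u : S u -> D2 phi u = hess_gauge u.
Proof.
move=> Su; have u0 := sphere_neq0 Su.
pose M := hess_gauge u - gauge u *: 1%:M - (grad gauge u)^T *m u + (2 * gauge u) *: (u^T *m u).
have ME : (\matrix_(i, j) partial i (fun x => sgrad phi (radial x) 0 j) u) = M.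
  apply/matrixP => i j; rewrite mxE.
  have h2 : has_grad (fun y : T => (enorm y)^-1 ^+ 2) u (- 2 *: u).
    have := has_gradM (has_grad_inv_enorm u0) (has_grad_inv_enorm u0).
    rewrite Su invr1 expr1n !scale1r => h; move: h; congr has_grad.
    by rewrite -mulr2n -scaler_nat scalerA mulrN mulr1.
  have := has_gradB (has_grad_grad_gauge j u0)
    (has_gradM (has_gradM (has_grad_gauge u0) (has_grad_coord j u)) h2).
  move=> h; have h3 : has_grad (fun x => sgrad phi (radial x) 0 j) u
      ((col j (hess_gauge u))^T - ((gauge u * u 0 j) *: (- 2 *: u) +
       ((enorm u)^-1 ^+ 2) *: (gauge u *: delta_mx 0 j + u 0 j *: (K u *: grad Phi u)))).
    apply: has_grad_near h; near=> y; have y0 : y != 0 by near: y; exact: near_neq0.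
    by rewrite sgrad_phi_radial.
  rewrite (has_grad_partial i h3) Su invr1 expr1n scale1r /M grad_gauge//.
  move: (hess_gauge u) (K u) (gauge u) => Hg k c.
  rewrite !mxE !big_ord1 !mxE eqxx/=.
  by move: (u 0 i) (u 0 j) ((i == j)%:R) (partial i Phi u) (Hg i j) => *; ring.
have uu : u *m u^T = 1%:M by rewrite dot_mx -enorm_sqr Su expr1n.
have up : u *m tproj u = 0 by rewrite /tproj mulmxBr mulmx1 mulmxA uu mul1mx subrr.
have pu : tproj u *m u^T = 0 by rewrite /tproj mulmxBl mul1mx -mulmxA uu mulmx1 subrr.
have pp : tproj u *m tproj u = tproj u.
  by rewrite {1}/tproj mulmxBl mul1mx -mulmxA up mulmx0 subr0.
have al10 : al - 1 != 0 by rewrite gt_eqF.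
have sc : (al - 1) / (al * Phi u) * (al * Phi u) = al - 1 by rewrite divfK// gt_eqF// aPhi_gt0.
have uG : u *m hess_gauge u = 0.
  exact: (hess_rank_one_row (hess_row u0) (euler_Phi u0) (K u) sc).
have Gu : hess_gauge u *m u^T = 0.
  exact: (hess_rank_one_col (hess_col u0) (euler_Phi u0) (K u) sc).
have pG : tproj u *m hess_gauge u = hess_gauge u.
  by rewrite /tproj mulmxBl mul1mx -mulmxA uG mulmx0 subr0.
have Gp : hess_gauge u *m tproj u = hess_gauge u.
  by rewrite /tproj mulmxBr mulmx1 mulmxA Gu mul0mx subr0.
rewrite /D2 /shess ME /M; move: (tproj u) up pu pp pG Gp => P up pu pp pG Gp.
rewrite mulmxDr !(mulmxBr P) pG -!scalemxAr mulmx1 !mulmxA pu mul0mx scaler0 addr0.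
by rewrite !mulmxBl Gp -scalemxAl pp -mulmxA up mulmx0 subr0 gauge_sphere// addrC subrK.
Unshelve. all: by end_near. Qed.

Lemma sgrad_tangent g u : S u -> differentiable (g \o radial) u -> dot (sgrad g u) u = 0.
Proof.
move=> Su dg; have := euler (d := 0) (has_grad_grad dg).
rewrite mul0r; apply => r r0; rewrite /= radialZ// powRr0 mul1r//.
Qed.

(** The inverse of [D2 phi u] on the tangent space is [phi u ^ (al - 1)] times the inverse
    Hessian of [Phi], and [phi u ^ al = al * Phi u]. *)
Lemma energy_sphere g u : S u -> differentiable (g \o radial) u ->
  phi u * dot (sgrad g u *m tinv u (D2 phi u)) (sgrad g u) =
  al * Phi u * invhess u (sgrad g u).
Proof.
move=> Su dg; have u0 := sphere_neq0 Su; rewrite D2_gauge//.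
have al10 : al - 1 != 0 by rewrite gt_eqF.
have aP := aPhi_gt0 u0.
have sc : (al - 1) / (al * Phi u) * (al * Phi u) = al - 1 by rewrite divfK// gt_eqF.
have K0 : K u != 0 by rewrite gt_eqF// powR_gt0.
rewrite (tinv_form al10 (hess_unit u0) (hess_row u0) (hess_col u0) (euler_Phi u0) Su K0 sc (sgrad_tangent Su dg)).
rewrite mulrA; congr (_ * _); rewrite -gauge_sphere// /gauge /K -powRN opprB.
rewrite -powRD; first by rewrite addrCA subrr addr0 powRr1// ltW.
by rewrite (gt_eqF aP) implybT.
Qed.

Let prof u : T := (phi (radial u))^-1 *: u.

Lemma sgrad_profile k u g : S u -> has_grad k (prof u) g ->
  has_grad ((fun v => k (prof v)) \o radial) u
    ((phi u)^-1 *: g - ((phi u)^-1 ^+ 2 * dot g u) *: (K u *: grad Phi u)).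
Proof.
move=> Su hk; have u0 := sphere_neq0 Su; have p0 := phi_gt0 Su.
have hs : has_grad (fun y => (gauge y)^-1) u (- (phi u)^-1 ^+ 2 *: (K u *: grad Phi u)).
  apply: (has_grad_comp (a := fun s => s^-1)) (has_grad_gauge u0) _.
  rewrite gauge_sphere//; apply: der_eq (derV (lt0r_neq0 p0) (is_derive_id _ _)) _.
  by rewrite exprVn mulNr mul1r.
have hk' : has_grad k ((gauge u)^-1 *: u) g.
  by move: hk; rewrite /prof radial_sphere// gauge_sphere.
apply: (@has_grad_near _ _ (fun y => k ((gauge y)^-1 *: y))).
  near=> y; have y0 : y != 0 by near: y; exact: near_neq0.
  rewrite /= /prof radial_sphere; last exact: enorm_radial.
  by rewrite /radial scalerA -invfM gaugeE// mulrC.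
have := has_grad_scale hs hk'; rewrite gauge_sphere//; congr has_grad.
by congr (_ + _); rewrite scalerA mulrN scaleNr [dot g u * _]mulrC.
Unshelve. all: by end_near. Qed.

(** Write the gradient [g] of [f] at [t *: theta u] as a multiple of the gradient of
    [Phi] plus a covector that vanishes on [u], apply [invhess_decomp], and use
    homogeneity to go back from [t *: theta u] to [u]. *)
Theorem energy_polar f t u g xi : S u -> 0 < t ->
  has_grad f (t *: prof u) g -> xi = sgrad (fun v => f (t *: prof v)) u ->
  invhess (t *: prof u) g =
  dot g (prof u) ^+ 2 * t `^ (2 - al) / (al - 1) +
  t `^ (- al) * (al * Phi u * invhess u xi).
Proof.
move=> Su t0 hf xiE; have u0 := sphere_neq0 Su; have p0 := phi_gt0 Su.
have hk := has_grad_dilate hf.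
have hx := sgrad_profile Su hk.
have {}xiE : xi = (phi u)^-1 *: (t *: g) - ((phi u)^-1 ^+ 2 * dot (t *: g) u) *: (K u *: grad Phi u).
  by rewrite xiE; exact: has_gradE hx.
have xu : dot xi u = 0.
  rewrite xiE dotBl !dotZl euler_Phi// /K.
  have -> : (al * Phi u) `^ (al^-1 - 1) * (al * Phi u) = phi u.
    rewrite -gauge_sphere// /gauge -[X in _ * X = _]powRr1 ?ltW ?aPhi_gt0// -powRD ?subrK//.
    by rewrite (gt_eqF (aPhi_gt0 u0)) implybT.
  by field; rewrite gt_eqF.
pose c := phi u; have c0 : 0 < c := p0.
pose Ft := dot g (prof u).
have FtE : Ft = dot g u / c by rewrite /Ft /prof radial_sphere// dotZr mulrC.
have gE : g = (Ft * K u) *: grad Phi u + (c / t) *: xi.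
  rewrite xiE FtE scalerBr !scalerA dotZl.
  rewrite (_ : c / t * c^-1 * t = 1); last by field; rewrite !gt_eqF.
  rewrite (_ : c / t * (c^-1 ^+ 2 * (t * dot g u)) * K u = dot g u / c * K u); last by field; rewrite !gt_eqF.
  by rewrite scale1r addrC subrK.
have pE : t *: prof u = (t / c) *: u by rewrite /prof radial_sphere// scalerA.
have tc0 : 0 < t / c by rewrite divr_gt0.
rewrite pE invhess_homogeneous// {1}gE invhess_decomp//; last by rewrite dotZl xu mulr0.
rewrite invhessZ mulrDr -/Ft; congr (_ + _).
  have K2 : K u ^+ 2 * (al * Phi u) = c `^ (2 - al).
    rewrite -gauge_powR// gauge_sphere// -/c /K -gauge_powR// gauge_sphere// -/c -powRrM.
    rewrite -powR_mulrn ?powR_ge0// -powRrM -powRD ?(gt_eqF c0) ?implybT//.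
    by congr (_ `^ _); field; rewrite gt_eqF.
  rewrite exprMn -[_ * _ * (al * Phi u)]mulrA K2 powRM ?invr_ge0 ?(ltW c0) ?(ltW t0)//.
  rewrite -powR_inv1 ?(ltW c0)// -powRrM.
  have e1 : c `^ (- 1 * (2 - al)) * c `^ (2 - al) = 1.
    by rewrite -powRD ?(gt_eqF c0) ?implybT// (_ : - 1 * (2 - al) + (2 - al) = 0) ?powRr0//; ring.
  rewrite (_ : t `^ (2 - al) * c `^ (- 1 * (2 - al)) * (Ft ^+ 2 * c `^ (2 - al) / (al - 1)) =
    (c `^ (- 1 * (2 - al)) * c `^ (2 - al)) * (Ft ^+ 2 * t `^ (2 - al) / (al - 1))); last by ring.
  by rewrite e1 mul1r.
rewrite mulrA [RHS]mulrA; congr (_ * _).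
rewrite -gauge_powR// gauge_sphere// -/c.
rewrite (_ : (c / t) ^+ 2 = (t / c) `^ (- 2%:R)); last first.
  by rewrite powRN powR_mulrn ?(ltW tc0)// -exprVn invf_div.
rewrite -powRD ?(gt_eqF tc0) ?implybT// (_ : 2 - al + - 2%:R = - al); last by ring.
rewrite powRM ?invr_ge0 ?(ltW c0) ?(ltW t0)//; congr (_ * _).
by rewrite -powR_inv1 ?(ltW c0)// -powRrM mulrN mulN1r opprK.
Qed.

End Potential.

(** * Averages along rays *)

(** Since the integration over radii takes place on a compact interval, estimates
    that hold near each radius hold uniformly. *)
Lemma compact_near (X : topologicalType) (V : topologicalType) (K : set X) (P : V -> X -> Prop) (y : V) :
  compact K -> (forall x, K x -> \forall p \near (x, y), P p.2 p.1) ->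
  \forall v \near y, forall x, K x -> P v x.
Proof.
move=> /compact_near_coveringP cK H.
have := cK V (nbhs y) P _; apply => x Kx; exact: H.
Qed.

Section StrictDifferentiability.
Context {R : realType} (n : nat).
Local Notation T := ('rV[R]_n.+1).
Variable f : T -> R.
Hypothesis Cf : Ck 1 setT f.

Let df x : has_grad f x (grad f x). Proof. by apply: has_grad_grad; exact: Cf.1. Qed.

Lemma dot_le_sup (x y : T) (e : R) : (forall i, `|x 0 i| <= e) -> `|dot x y| <= n.+1%:R * e * `|y|.
Proof.
move=> xe; apply: (le_trans (ler_norm_sum _ _ _)).
apply: (@le_trans _ _ (\sum_(i < n.+1) e * `|y|)); last first.
  by rewrite sumr_const card_ord -mulrA mulr_natl.
apply: ler_sum => i _; rewrite normrM ler_pM//.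
by rewrite [leRHS]/Num.norm/= mx_normrE; apply: (le_bigmax _ (fun i : 'I_1 * 'I_n.+1 => `|y i.1 i.2|) (0, i)).
Qed.

(** Continuous differentiability makes the first order expansion uniform in the base
    point; the mean value theorem on the segment reduces it to the continuity of the
    gradient. *)
Lemma strict_diff (x0 : T) (e : R) : 0 < e -> \forall p \near ((x0, x0) : T * T),
  `|f p.2 - f p.1 - dot (grad f p.1) (p.2 - p.1)| <= e * `|p.2 - p.1|.
Proof.
move=> e0; pose e' := e / (2 * n.+1%:R).
have e'0 : 0 < e' by rewrite divr_gt0// mulr_gt0.
have H : \forall x \near x0, forall i, `|partial i f x0 - partial i f x| < e'.
  have h i : \forall x \near x0, `|partial i f x0 - partial i f x| < e'.
    by have /cvgrPdist_lt/(_ e' e'0) := Cf.2 i x0 I.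
  by have := @filter_forall T 'I_n.+1 (fun i (x : T) => `|partial i f x0 - partial i f x| < e') (nbhs x0) (nbhs_filter x0) h.
have /nbhs_ballP[d /= d0 hd] := H.
have B p : ball x0 d p -> forall i, `|partial i f x0 - partial i f p| < e' := hd p.
near=> p.
have pd1 : ball x0 d p.1 by near: p; apply: cvg_fst; exact: nbhsx_ballx.
have pd2 : ball x0 d p.2 by near: p; apply: cvg_snd; exact: nbhsx_ballx.
move: p.1 p.2 pd1 pd2 => a b pa pb.
have hs (s : R) : is_derive s 1 (fun s : R => f (a + s *: (b - a))) (dot (grad f (a + s *: (b - a))) (b - a)).
  exact: has_grad_line.
have cs : {within `[0, 1], continuous (fun s : R => f (a + s *: (b - a)))}.
  by apply: continuous_subspaceT => s; exact: der_continuous (hs s).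
have [s /[!in_itv]/= /andP[s0 s1] E] := MVT (@ltr01 R) (fun s _ => hs s) cs.
move: E; rewrite scale1r scale0r addr0 subr0 mulr1 [a + _]addrC subrK => ->.
rewrite -dotBl; apply: (le_trans (@dot_le_sup _ _ (2 * e') _)); last first.
  rewrite /e'; have : (n.+1%:R : R) != 0 by rewrite pnatr_eq0.
  by move: (n.+1%:R : R) => N N0; rewrite (_ : N * _ = e)//; field.
move=> i; rewrite !mxE.
have pc : ball x0 d (a + s *: (b - a)).
  move: pa pb; rewrite -ball_normE/= => pa pb.
  have -> : x0 - (a + s *: (b - a)) = (1 - s) *: (x0 - a) + s *: (x0 - b).
    by apply/rowP => j; rewrite !mxE; ring.
  apply: (le_lt_trans (ler_normD _ _)); rewrite !normrZ !ger0_norm; [|lra..].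
  have h1 : (1 - s) * `|x0 - a| < (1 - s) * d by rewrite ltr_pM2l//; lra.
  have h2 : s * `|x0 - b| < s * d by rewrite ltr_pM2l.
  lra.
have h1 := B _ pc i; have h2 := B _ pa i.
move: h1 h2; move: (partial i f (a + _)) (partial i f a) (partial i f x0) => u v w.
by rewrite !ltr_norml ler_norml => /andP[h1 h2] /andP[h3 h4]; apply/andP; split; lra.
Unshelve. all: by end_near. Qed.

End StrictDifferentiability.

Section WeightedInterval.
Context {R : realType}.
Local Notation lambda := (@lebesgue_measure R).
Variables (al N z a b : R).
Hypotheses (al_gt1 : 1 < al) (z_gt0 : 0 < z) (a_gt0 : 0 < a) (ab : a < b).
Implicit Types (h k : R -> R).

Definition weight t := z^-1 * gam al N t.
(** Radii are positive, and powers of the radius are not continuous at 0. *)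
Definition cpos h := forall t, 0 < t -> {for t, continuous h}.
Definition wint h := \int[lambda]_(t in `[a, b]) (h t * weight t).

Lemma weight_gt0 t : 0 < t -> 0 < weight t.
Proof. by move=> t0; rewrite mulr_gt0 ?invr_gt0// gam_gt0. Qed.

Lemma cpos_weight : cpos weight.
Proof. by apply: continuousZ_pos => t; exact: continuous_gam. Qed.

Lemma cposM h k : cpos h -> cpos k -> cpos (fun t => h t * k t).
Proof. by move=> ch ck t t0; apply: continuousM; [exact: ch|exact: ck]. Qed.

Lemma cposD h k : cpos h -> cpos k -> cpos (fun t => h t + k t).
Proof. by move=> ch ck t t0; apply: continuousD; [exact: ch|exact: ck]. Qed.

Lemma cpos_cst c : cpos (fun=> c). Proof. by move=> t t0; exact: cst_continuous. Qed.

Lemma cposZ c h : cpos h -> cpos (fun t => c * h t).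
Proof. by move=> ch; apply: cposM => //; exact: cpos_cst. Qed.

Lemma cpos_sum m (F : 'I_m -> R -> R) : (forall i, cpos (F i)) -> cpos (fun t => \sum_i F i t).
Proof.
move=> cF t t0; rewrite /prop_for /continuous_at; apply: cvg_big => [|i _]; first exact: add_continuous.
exact: cF.
Qed.

Lemma wint_integrable h : cpos h -> lambda.-integrable `[a, b] (EFin \o (fun t => h t * weight t)).
Proof. by move=> ch; apply: integrable_pos => //; apply: cposM => //; exact: cpos_weight. Qed.

Lemma wint_EFin h : cpos h ->
  (\int[lambda]_(t in `[a, b]) (h t * weight t)%:E = (wint h)%:E)%E.
Proof.
move=> ch; rewrite /wint /Rintegral fineK//; apply: integrable_fin_num => //.
exact: wint_integrable.
Qed.

Lemma wintD h k : cpos h -> cpos k -> wint (fun t => h t + k t) = wint h + wint k.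
Proof.
move=> ch ck; rewrite /wint -RintegralD//; [|exact: wint_integrable..].
by apply: eq_Rintegral => t _; rewrite mulrDl.
Qed.

Lemma wintZ c h : cpos h -> wint (fun t => c * h t) = c * wint h.
Proof.
move=> ch; rewrite /wint -RintegralZl//; last exact: wint_integrable.
by apply: eq_Rintegral => t _; rewrite mulrA.
Qed.

Lemma eq_wint h k : (forall t, 0 < t -> h t = k t) -> wint h = wint k.
Proof.
move=> hk; apply: eq_Rintegral => t /set_mem/=; rewrite in_itv/= => /andP[at_ _].
by rewrite hk// (lt_le_trans a_gt0).
Qed.

Lemma le_wint h k : cpos h -> cpos k -> (forall t, a <= t <= b -> h t <= k t) -> wint h <= wint k.
Proof.
move=> ch ck hk; apply: le_Rintegral => //; [exact: wint_integrable..|].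
move=> t /=; rewrite in_itv/= => tab; apply: ler_wpM2r; last exact: hk.
by apply/ltW/weight_gt0; case/andP: tab => h1 _; exact: lt_le_trans h1.
Qed.

Lemma wint_ge0 h : (forall t, a <= t <= b -> 0 <= h t) -> 0 <= wint h.
Proof.
move=> h0; apply: Rintegral_ge0 => t /=; rewrite in_itv/= => tab; apply: mulr_ge0; first exact: h0.
by apply/ltW/weight_gt0; case/andP: tab => h1 _; exact: lt_le_trans h1.
Qed.

Lemma wint_sum m (F : 'I_m -> R -> R) : (forall i, cpos (F i)) ->
  wint (fun t => \sum_i F i t) = \sum_i wint (F i).
Proof.
elim: m F => [|m IH] F cF.
  rewrite big_ord0 /wint; under eq_Rintegral do rewrite big_ord0 mul0r.
  by rewrite Rintegral_cst// mul0r.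
rewrite big_ord_recl -IH; last by move=> i; exact: cF.
rewrite -wintD; [|exact: cF|by apply: cpos_sum => i; exact: cF].
by congr wint; apply/funext => t; rewrite big_ord_recl.
Qed.

Definition wmass := wint (fun=> 1).

Lemma wmass_gt0 : 0 < wmass.
Proof.
have cw : {within `[a, b], continuous weight} by apply: continuous_pos_within => //; exact: cpos_weight.
have [s /[!in_itv]/= /andP[s1 _] hs] := EVT_min (ltW ab) cw.
have g0 : 0 < weight s by apply: weight_gt0; exact: lt_le_trans s1.
apply: (@lt_le_trans _ _ (\int[lambda]_(t in `[a, b]) weight s)).
  rewrite Rintegral_cst// -[X in fine X]/(lambda `[a, b]%classic) lebesgue_measure_itv/= lte_fin ab -EFinB/=.
  by rewrite mulr_gt0// subr_gt0.
apply: le_Rintegral => //.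
- by apply: continuous_compact_integrable; [exact: segment_compact|apply: continuous_subspaceT => x; exact: cst_continuous].
- by have h := wint_integrable (@cpos_cst 1); exact: h.
- by move=> t ti; rewrite mul1r; exact: hs.
Qed.

Lemma norm_wint_le h (e : R) : cpos h -> (forall t, a <= t <= b -> `|h t| <= e) -> `|wint h| <= e * wmass.
Proof.
move=> ch he; rewrite /wmass -wintZ; last exact: cpos_cst.
rewrite ler_norml; apply/andP; split.
  rewrite -[leLHS]mulN1r -wintZ; last by apply: cposZ; exact: cpos_cst.
  apply: le_wint => //; first by do 2 apply: cposZ; exact: cpos_cst.
  by move=> t /he; rewrite ler_norml mulr1 mulN1r => /andP[].
apply: le_wint => //; first by apply: cposZ; exact: cpos_cst.
by move=> t /he; rewrite ler_norml mulr1 => /andP[].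
Qed.

(** Bounds the second moment by the square of the mean and the deviation from an
    arbitrary constant [c]: the mean is the constant of smallest deviation. *)
Lemma wint_variance h c : cpos h ->
  wint (fun t => h t ^+ 2) <= wmass * (wmass^-1 * wint h) ^+ 2 + wint (fun t => (h t - c) ^+ 2).
Proof.
move=> ch; have m0 := wmass_gt0.
have ch2 : cpos (fun t => h t * h t) by exact: cposM.
have E : wint (fun t => (h t - c) ^+ 2) = wint (fun t => h t ^+ 2) - 2 * c * wint h + c ^+ 2 * wmass.
  rewrite (@eq_wint _ (fun t => h t * h t + ((- (2 * c)) * h t + c ^+ 2 * 1))); last by move=> t _; ring.
  rewrite wintD//; last by apply: cposD; apply: cposZ => //; exact: cpos_cst.
  rewrite wintD; [|by apply: cposZ|by apply: cposZ; exact: cpos_cst].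
  rewrite !wintZ//; last exact: cpos_cst.
  rewrite (@eq_wint (fun t => h t * h t) (fun t => h t ^+ 2)); last by move=> t _; rewrite expr2.
  by rewrite -/wmass; ring.
rewrite E; move: (wint (fun t => h t ^+ 2)) (wint h) m0 => X Y; move: wmass => m m0.
have -> : m * (m^-1 * Y) ^+ 2 + (X - 2 * c * Y + c ^+ 2 * m) = X + m * (m^-1 * Y - c) ^+ 2.
  by field; rewrite gt_eqF.
by rewrite lerDl mulr_ge0 ?sqr_ge0// ltW.
Qed.

Section CauchySchwarz.
Variables (n : nat) (B : 'M[R]_n.+1) (y : R -> 'rV[R]_n.+1).
Hypotheses (B0 : forall v : 'rV[R]_n.+1, 0 <= dot (v *m B) v)
  (cy : forall i, cpos (fun t => y t 0 i)).

Let J : 'rV[R]_n.+1 := \row_i wint (fun t => y t 0 i).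
Let s := wint (fun t => t `^ al).

Let cpow c : cpos (fun t => t `^ c). Proof. by move=> t t0; exact: continuous_powR. Qed.

Let cdot c : cpos (fun t => dot (y t) c).
Proof. by apply: cpos_sum => i; apply: cposM => //; exact: cpos_cst. Qed.

Let wint_dot c : wint (fun t => dot (y t) c) = dot J c.
Proof.
rewrite wint_sum; last by move=> i; apply: cposM => //; exact: cpos_cst.
apply: eq_bigr => i _; rewrite mxE mulrC -wintZ//.
by congr wint; apply/funext => t; rewrite mulrC.
Qed.

Lemma cpos_form : cpos (fun t => dot (y t *m B) (y t)).
Proof.
apply: cpos_sum => j; apply: cposM => //.
rewrite (_ : (fun t => _) = fun t => \sum_i y t 0 i * B i j); last by apply/funext => t; rewrite mxE.
by apply: cpos_sum => i; apply: cposM => //; exact: cpos_cst.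
Qed.

(** Integrate [t ^ (- al)] times the form [B] at [y t - (t ^ al / s) *: J], which is
    nonnegative; here [J / s] is the mean of [t ^ (- al) *: y t] for the weight [t ^ al]. *)
Lemma wint_cauchy_schwarz :
  dot (J *m B) J <= s * wint (fun t => t `^ (- al) * dot (y t *m B) (y t)).
Proof.
have s0 : 0 < s.
  pose m0 := a `^ al; have m00 : 0 < m0 by exact: powR_gt0.
  apply: (@lt_le_trans _ _ (m0 * wmass)); first by rewrite mulr_gt0// wmass_gt0.
  rewrite /wmass -wintZ; last exact: cpos_cst.
  apply: le_wint => //; first by apply: cposZ; exact: cpos_cst.
  move=> t /andP[ta _]; rewrite mulr1; have t0' : 0 < t by exact: lt_le_trans ta.
  by apply: ge0_ler_powR => //; [exact: ltW (lt_trans ltr01 al_gt1)|exact: ltW a_gt0|exact: ltW t0'].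
pose G := dot (J *m B) J.
have H : 0 <= wint (fun t => t `^ (- al) * dot (y t *m B) (y t) +
    ((- s^-1) * dot (y t) (J *m B^T + J *m B) + (s ^- 2 * G) * t `^ al)).
  apply: wint_ge0 => t /andP[ta _]; have t0 : 0 < t by exact: lt_le_trans ta.
  have := B0 (y t - (t `^ al / s) *: J).
  have E1 : dot (y t *m B) J = dot (y t) (J *m B^T).
    by rewrite !mx_dot trmx_mul trmxK mulmxA.
  rewrite mulmxBl -scalemxAl dotBl !dotBr !dotZl !dotZr E1 (dotC (J *m B) (y t)) -/G => h.
  have p0 : 0 < t `^ (- al) by exact: powR_gt0.
  have := mulr_ge0 (ltW p0) h; rewrite dotDr powRN.
  have q0 : 0 < t `^ al by exact: powR_gt0.
  move: (dot (y t) (J *m B^T)) (dot (y t) (J *m B)) (dot (y t *m B) (y t)) (t `^ al) q0 => u v w p q0.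
  congr (0 <= _); field; by rewrite !gt_eqF.
move: H; rewrite wintD; [|by apply: cposM => //; exact: cpos_form|]; last first.
  by apply: cposD; apply: cposZ.
rewrite wintD; [|by apply: cposZ|by apply: cposZ].
rewrite !wintZ// wint_dot -/s dotDr.
have -> : dot J (J *m B^T) = G by rewrite /G !mx_dot trmx_mul trmxK mulmxA.
rewrite (dotC J (J *m B)) -/G.
move: (wint _) => X h; have := mulr_ge0 (ltW s0) h.
have -> : s * (X + (- s^-1 * (G + G) + s ^- 2 * G * s)) = s * X - G by field; rewrite gt_eqF.
by rewrite subr_ge0.
Qed.

End CauchySchwarz.

Section Average.
Variable n : nat.
Local Notation T := ('rV[R]_n.+1).

Lemma dilation_continuous (y : T) t : {for (t, y), continuous (fun p : R * T => p.1 *: p.2)}.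
Proof. exact: scale_continuous. Qed.

Lemma cpos_ray (f : T -> R) (y : T) : continuous f -> cpos (fun t => f (t *: y)).
Proof.
move=> cf t t0; apply: (@continuous_comp _ _ _ (fun t : R => t *: y) f); last exact: cf.
exact: scalel_continuous.
Qed.

Lemma continuous_average (psi : T -> R) (c : R -> R) : continuous psi -> continuous c ->
  continuous (fun y : T => wint (fun t => c t * psi (t *: y))).
Proof.
move=> cpsi cc y; apply/(@cvgrPdist_le R R T (nbhs y) _) => e e0.
have m0 := wmass_gt0; pose e' := e / wmass.
have e'0 : 0 < e' by rewrite divr_gt0.
have cF (v : T) : cpos (fun t => c t * psi (t *: v)).
  by apply: cposM; [move=> t _; exact: cc|exact: cpos_ray].
have H : \forall v \near y, forall t, `[a, b]%classic t -> `|c t * psi (t *: y) - c t * psi (t *: v)| <= e'.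
  apply: (@compact_near R T `[a, b]%classic (fun (v : T) (t : R) => `|c t * psi (t *: y) - c t * psi (t *: v)| <= e') y); first exact: segment_compact.
  move=> t _; pose D (p : R * T) := c p.1 * psi (p.1 *: y) - c p.1 * psi (p.1 *: p.2).
  have cD : {for (t, y), continuous D}.
    have c1 : {for (t, y), continuous (fun p : R * T => c p.1)}.
      by apply: continuous_comp; [exact: cvg_fst|exact: cc].
    apply: continuousB; apply: continuousM => //.
      apply: (@continuous_comp _ _ _ (fun p : R * T => p.1 *: y) psi); last exact: cpsi.
      by apply: (@continuous_comp _ _ _ fst (fun t : R => t *: y)); [exact: cvg_fst|exact: scalel_continuous].
    apply: (@continuous_comp _ _ _ (fun p : R * T => p.1 *: p.2) psi); last exact: cpsi.
    exact: dilation_continuous.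
  have D0 : D (t, y) = 0 by rewrite /D/= subrr.
  move: cD; rewrite /prop_for /continuous_at D0 => /cvgr0Pnorm_le/(_ e' e'0).
  by apply: filterS.
near=> v.
have hv : forall t, `[a, b]%classic t -> `|c t * psi (t *: y) - c t * psi (t *: v)| <= e' by near: v.
rewrite -mulN1r -wintZ// -wintD//; last exact: cposZ.
apply: (@le_trans _ _ (e' * wmass)); last by rewrite divfK// gt_eqF.
apply: norm_wint_le; first by apply: cposD => //; exact: cposZ.
by move=> t tab; rewrite mulN1r; apply: hv; rewrite /= in_itv.
Unshelve. all: by end_near. Qed.

(** By [strict_diff] the first order expansions of [f] at the points [t *: y] are
    uniform in [t], so that they may be integrated. *)
Lemma has_grad_average (f : T -> R) (y : T) : Ck 1 setT f ->
  has_grad (fun y : T => wint (fun t => f (t *: y))) y (\row_i wint (fun t => t * partial i f (t *: y))).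
Proof.
move=> Cf; have m0 := wmass_gt0.
have cf : continuous f by move=> x; exact: differentiable_continuous (Cf.1 x I).
have cF (v : T) : cpos (fun t => f (t *: v)) by exact: cpos_ray.
have cG (v : T) i : cpos (fun t => t * partial i f (t *: v)).
  apply: cposM; first by move=> t _.
  by apply: cpos_ray => x; exact: (Cf.2 i x I).
apply: has_grad_eps => e e0.
have b0 : 0 < b by exact: lt_trans ab.
pose e' := e / (wmass * b).
have e'0 : 0 < e' by rewrite divr_gt0// mulr_gt0.
have H : \forall h \near (0 : T), forall t, `[a, b]%classic t ->
    `|f (t *: (h + y)) - f (t *: y) - dot (grad f (t *: y)) (t *: (h + y) - t *: y)| <= e' * `|t *: (h + y) - t *: y|.
  apply: (@compact_near R T `[a, b]%classic (fun (h : T) (t : R) => `|f (t *: (h + y)) - f (t *: y) - dot (grad f (t *: y)) (t *: (h + y) - t *: y)| <= e' * `|t *: (h + y) - t *: y|) 0); first exact: segment_compact.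
  move=> t _; have S := strict_diff Cf (t *: y) e'0.
  pose W (p : R * T) : T * T := (p.1 *: y, p.1 *: (p.2 + y)).
  have c1 : {for ((t, 0) : R * T), continuous (fun p : R * T => p.1 *: y)}.
    by apply: (@continuous_comp _ _ _ fst (fun t : R => t *: y)); [exact: cvg_fst|exact: scalel_continuous].
  have c2 : {for ((t, 0) : R * T), continuous (fun p : R * T => p.2 + y)}.
    by apply: continuousD; [exact: cvg_snd|exact: cst_continuous].
  have c3 : {for ((t, 0) : R * T), continuous (fun p : R * T => (p.1, p.2 + y))}.
    have c0 : {for ((t, 0) : R * T), continuous (fun p : R * T => p.1)} by exact: cvg_fst.
    exact: (cvg_pair c0 c2).
  have c4 : {for ((t, 0) : R * T), continuous (fun p : R * T => p.1 *: (p.2 + y))}.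
    apply: (@continuous_comp _ _ _ (fun p : R * T => (p.1, p.2 + y)) (fun p : R * T => p.1 *: p.2) _ c3).
    exact: dilation_continuous.
  have cW : {for ((t, 0) : R * T), continuous W} by exact: (cvg_pair c1 c4).
  have E : W (t, 0) = (t *: y, t *: y) by rewrite /W/= add0r.
  move: cW; rewrite /prop_for /continuous_at E => cW.
  exact: (cW _ S).
near=> h.
have hh : forall t, `[a, b]%classic t -> `|f (t *: (h + y)) - f (t *: y) - dot (grad f (t *: y)) (t *: (h + y) - t *: y)| <= e' * `|t *: (h + y) - t *: y| by near: h.
have cd : cpos (fun t => \sum_i (h 0 i) * (t * partial i f (t *: y))).
  by apply: cpos_sum => i; exact: cposZ.
have -> : dot (\row_i wint (fun t => t * partial i f (t *: y))) h =
    wint (fun t => \sum_i (h 0 i) * (t * partial i f (t *: y))).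
  rewrite wint_sum; last by move=> i; exact: cposZ.
  by apply: eq_bigr => i _; rewrite mxE mulrC wintZ.
rewrite -[X in _ + X - _]mulN1r -[X in _ + _ + X]mulN1r -!wintZ//.
rewrite -wintD//; last exact: cposZ.
rewrite -wintD; [|by apply: cposD => //; exact: cposZ|exact: cposZ].
apply: (@le_trans _ _ (e' * (b * `|h|) * wmass)); last first.
  by rewrite /e' le_eqVlt; apply/orP; left; apply/eqP; field; rewrite !gt_eqF.
apply: norm_wint_le; first by apply: cposD; [apply: cposD => //; exact: cposZ|exact: cposZ].
move=> t tab; have ht : `[a, b]%classic t by rewrite /= in_itv.
have /andP[ta tb] := tab; have t0 : 0 < t by exact: lt_le_trans ta.
have := hh t ht; rewrite scalerDr addrK => hht.
rewrite !mulN1r (_ : \sum_i _ = dot (grad f (t *: y)) (t *: h)); last first.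
  by apply: eq_bigr => i _; rewrite !mxE; ring.
apply: (le_trans hht); apply: ler_wpM2l; first exact: ltW.
by rewrite normrZ gtr0_norm// ler_wpM2r.
Unshelve. all: by end_near. Qed.

End Average.

End WeightedInterval.

(** * A cutoff near the origin *)

Section MatrixMeasurable.
Context {R : realType} d (Y : measurableType d).

Lemma measurable_det n (A : Y -> 'M[R]_n) :
  (forall i j, measurable_fun setT (fun y => A y i j)) ->
  measurable_fun setT (fun y => \det (A y)).
Proof.
move=> mA; rewrite /determinant; apply: measurable_sum => s.
by apply: measurable_funM => //; apply: measurable_prod => i _.
Qed.

Lemma measurable_adj n (A : Y -> 'M[R]_n) i j :
  (forall i j, measurable_fun setT (fun y => A y i j)) ->
  measurable_fun setT (fun y => (\adj (A y)) i j).
Proof.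
move=> mA; under eq_fun do rewrite mxE.
rewrite /cofactor; apply: measurable_funM => //.
apply: measurable_det => k l.
rewrite (_ : (fun y => _) = fun y => A y (lift j k) (lift i l)); last by apply/funext => y; rewrite !mxE.
exact: mA.
Qed.

End MatrixMeasurable.

Lemma near_continuous (V : topologicalType) (R : realType) (F G : V -> R) (x : V) :
  (\forall y \near x, F y = G y) -> {for x, continuous F} -> {for x, continuous G}.
Proof.
move=> FG cF; rewrite /prop_for /continuous_at -(nbhs_singleton FG).
apply: cvg_trans cF; apply: near_eq_cvg; near=> y.
by rewrite (near FG y).
Unshelve. all: by end_near. Qed.

Section Cutoff.
Context {R : realType}.
Implicit Types (r s d : R).

Lemma is_derive_sqr_bound (f : R -> R) : (forall s, `|f s| <= s ^+ 2) -> is_derive (0 : R) 1 f 0.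
Proof.
move=> fb; have f0 : f 0 = 0 by apply/eqP; rewrite -normr_le0 (le_trans (fb 0))// expr0n.
have c : h^-1 *: (f (h *: (1 : R) + 0) - f 0) @[h --> (0:R)^'] --> (0 : R).
  apply/cvgr0Pnorm_le => e e0; near=> h.
  have h0 : h != 0 by near: h; exact: nbhs_dnbhs_neq.
  rewrite /GRing.scale/= mulr1 addr0 f0 subr0 normrM normfV ler_pdivrMl ?normr_gt0//.
  apply: (le_trans (fb h)); rewrite -[leLHS]ger0_norm ?sqr_ge0// normrX expr2 ler_wpM2l//.
  near: h; apply: dnbhs0_le => //.
by apply: DeriveDef; [apply/cvg_ex; exists 0|exact: cvg_lim].
Unshelve. all: by end_near. Qed.

Lemma is_derive_pos_sqr s : is_derive s 1 (fun s => Num.max s 0 ^+ 2) (2 * Num.max s 0).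
Proof.
have [s0|s0|->] := ltgtP s 0.
- have h := der_cst (0 : R) s; rewrite mulr0; apply: near_eq_is_derive h.
  near=> t; rewrite max_r ?expr0n//.
  by near: t; exact: lt_le_nbhsl.
- have h : is_derive s 1 (fun t => t * t) (2 * s).
    by apply: der_eq (derM (is_derive_id s 1) (is_derive_id s 1)) _; rewrite mul1r mulr1 -mulr2n mulr_natl.
  apply: near_eq_is_derive h; near=> t; rewrite max_l ?expr2//.
  by near: t; exact: lt_le_nbhsr.
- rewrite mulr0; apply: is_derive_sqr_bound => t.
  have [t0|t0] := leP t 0; first by rewrite expr0n normr0 sqr_ge0.
  by rewrite ger0_norm ?sqr_ge0.
Unshelve. all: by end_near. Qed.

(** [cutoff d r = (r - d)_+ ^ 2 / r] vanishes near 0, is continuously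
    differentiable with slope in [[0, 1]], and differs from [r] by at most [2 d]; being
    explicit, it makes the limit [d -> 0] elementary. *)
Definition cutoff d r := Num.max (r - d) 0 ^+ 2 / r.
Definition dcutoff d r := 2 * (Num.max (r - d) 0 / r) - (Num.max (r - d) 0 / r) ^+ 2.

Lemma is_derive_cutoff d r : 0 < r -> is_derive r 1 (cutoff d) (dcutoff d r).
Proof.
move=> r0.
have h : is_derive r 1 (fun s => s - d) 1.
  by apply: der_eq (derB (is_derive_id r 1) (der_cst d r)) _; rewrite subr0.
have h2 := @der_comp _ (fun s => Num.max s 0 ^+ 2) (fun s => s - d) r _ _ (is_derive_pos_sqr (r - d)) h.
apply: der_eq (derM h2 (@derV _ id r _ (lt0r_neq0 r0) (is_derive_id r 1))) _.
by rewrite /dcutoff; field; rewrite gt_eqF.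
Qed.

Lemma continuous_dcutoff d r : 0 < r -> {for r, continuous (dcutoff d)}.
Proof.
move=> r0.
have c : {for r, continuous (fun r => Num.max (r - d) 0 / r)}.
  apply: continuousM; last by apply: continuousV; [exact: lt0r_neq0|move=> ?].
  apply: continuous_max; last exact: cst_continuous.
  by apply: continuousB; [move=> ?|exact: cst_continuous].
apply: continuousB.
  by apply: continuousM; [exact: cst_continuous|exact: c].
by apply: (@continuous_comp _ _ _ _ (fun s => s ^+ 2)); [exact: c|exact: exprn_continuous].
Qed.

Let ratio d r : 0 < d -> 0 < r -> 0 <= Num.max (r - d) 0 / r <= 1.
Proof.
move=> d0 r0; rewrite divr_ge0 ?(ltW r0) ?le_max ?lexx ?orbT//= ler_pdivrMr// mul1r ge_max.
by rewrite (ltW r0) gerBl ltW.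
Qed.

Lemma dcutoff_bound d r : 0 < d -> 0 < r -> 0 <= dcutoff d r <= 1.
Proof.
move=> d0 r0; have := ratio d0 r0; rewrite /dcutoff; move: (_ / r) => y /andP[y0 y1].
by apply/andP; split; nra.
Qed.

Lemma cutoff0 d r : r <= d -> cutoff d r = 0.
Proof. by move=> rd; rewrite /cutoff max_r ?subr_le0// expr0n mul0r. Qed.

Lemma cutoff_bound d r : 0 < d -> 0 < r -> 0 <= cutoff d r <= r.
Proof.
move=> d0 r0; have := ratio d0 r0; rewrite /cutoff expr2 -mulrA => /andP[y0 y1].
rewrite mulr_ge0 ?le_max ?lexx ?orbT//=.
apply: (@le_trans _ _ (Num.max (r - d) 0 * 1)).
  by rewrite ler_wpM2l// le_max lexx orbT.
by rewrite mulr1 ge_max (ltW r0) gerBl ltW.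
Qed.

Lemma cutoff_sqr_ge d r : 0 < d -> 0 < r -> r ^+ 2 <= cutoff d r ^+ 2 + 4 * d * r.
Proof.
move=> d0 r0; have [rd|rd] := leP r (4 * d).
  by rewrite expr2 (le_trans (ler_wpM2r (ltW r0) rd))// lerDr sqr_ge0.
have h : r - 2 * d <= cutoff d r.
  rewrite /cutoff max_l; last by lra.
  by rewrite ler_pdivlMr//; nra.
have h0 : 0 <= r - 2 * d by lra.
have : (r - 2 * d) ^+ 2 <= cutoff d r ^+ 2 by apply: lerXn2r; rewrite ?nnegrE// (le_trans h0).
nra.
Qed.

Lemma measurable_cutoff d : measurable_fun setT (cutoff d).
Proof.
apply: measurable_funM; last exact: measurable_invr.
by apply: measurable_funX; apply: measurable_maxr => //; exact: measurable_funB.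
Qed.

End Cutoff.

(** * The comparison of the two inequalities *)

Section Comparison.
Context {R : realType} (n : nat).
Hypothesis n_gt0 : (0 < n)%N.
Local Notation T := ('rV[R]_n.+1).
Local Notation S := (sphere R n.+1 : set (borelRn R n.+1)).
Local Notation N := (n.+1%:R : R).
Local Notation lambda := (@lebesgue_measure R).
Variables (al : R) (Phi phi : T -> R).
Hypothesis al_gt1 : 1 < al.
Hypothesis hconv : strictly_convex Phi.
Hypothesis Phi_even : even Phi.
Hypothesis phi_gt0 : forall u, S u -> 0 < phi u.
Hypothesis PhiE : forall x, Phi x = al^-1 * enorm x `^ al * phi (radial x) `^ al.
Hypothesis CPhi : Ck 2 [set x | x != 0] Phi.
Hypothesis hdet : forall x, x != 0 -> 0 < \det (hess Phi x).
Variables (nuP muP : probability (borelRn R n.+1) R)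
  (rhoP : probability (measurableTypeR R) R) (z : R).
Hypotheses (nuE : forall A, measurable A -> nu phi A = nuP A)
  (muE : forall A, measurable A -> mu Phi A = muP A)
  (nuS : nuP (~` S) = 0%E) (z_gt0 : 0 < z)
  (rhoE : forall f : R -> \bar R, measurable_fun setT f -> (forall t, 0 <= f t)%E ->
      (\int[rhoP]_t f t = (z^-1)%:E * \int[lambda]_t (f t * (gam al N t)%:E))%E)
  (polar : forall F : borelRn R n.+1 -> \bar R, measurable_fun setT F -> (forall x, 0 <= F x)%E ->
      (\int[muP]_x F x = \int[nuP]_u \int[rhoP]_t F (t *: profile phi u)%R)%E).
Local Notation theta := (profile phi).
Local Notation Q := (invhess Phi).
Let al_gt0 : 0 < al. Proof. exact: lt_trans al_gt1. Qed.
Let cphi : forall x : T, x != 0 -> {for x, continuous (phi \o radial)}.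
Proof. by move=> x x0; exact: (continuous_phi_radial al_gt1 phi_gt0 PhiE CPhi x0). Qed.

Lemma measurable_sphere_fun (g : T -> R) : (forall x, x != 0 -> {for x, continuous (g \o radial)}) ->
  measurable_fun setT (fun u : borelRn R n.+1 => g (radial (u : T))).
Proof. exact: measurable_off0_continuous. Qed.

(** The entries of the inverse are quotients of a cofactor by the determinant, hence
    measurable. *)
Lemma measurable_invhess (xi : T -> T) :
  (forall i, measurable_fun setT (fun x : borelRn R n.+1 => xi x 0 i)) ->
  measurable_fun setT (fun x : borelRn R n.+1 => Q x (xi x)).
Proof.
move=> mxi; apply: measurable_off0.
have mh i j : measurable_fun setT (fun x : borelRn R n.+1 => hess Phi x i j).
  apply: measurable_off0_continuous => x x0.
  rewrite (_ : (fun x => hess Phi x i j) = partial i (partial j Phi)); last by apply/funext => y; rewrite mxE.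
  exact: ((CPhi.2 j).2 i).
apply: (eq_measurable_fun (fun x : borelRn R n.+1 =>
    \sum_j (\sum_i xi x 0 i * ((\det (hess Phi x))^-1 * (\adj (hess Phi x)) i j)) * xi x 0 j)).
  move=> x /set_mem/= x0; rewrite /invhess/dot; apply: eq_bigr => j _; congr (_ * _).
  rewrite mxE; apply: eq_bigr => i _; congr (_ * _).
  by rewrite /invmx (hess_unit hdet x0) [RHS]mxE.
apply: measurable_funTS; apply: measurable_sum => j; apply: measurable_funM => //.
apply: measurable_sum => i; apply: measurable_funM => //; apply: measurable_funM.
  by apply: (measurableT_comp measurable_invr); exact: measurable_det.
exact: measurable_adj.
Qed.

Lemma nu_sphere (h : borelRn R n.+1 -> \bar R) : measurable_fun setT h -> (forall u, 0 <= h u)%E ->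
  (\int[nuP]_u h u = \int[nuP]_(u in S) h u)%E.
Proof.
move=> mh h0; have mS := @measurable_sphere R n.
rewrite (@ge0_negligible_integral _ _ _ nuP setT (~` S))//; last exact: measurableC.
by rewrite setTD setCK.
Qed.

Lemma nuPS : nuP S = 1%E.
Proof.
have mS := @measurable_sphere R n.
have := probability_setT nuP; rewrite -(setUv S) measureU//; last 2 first.
- exact: measurableC.
- by rewrite setICr.
move=> h; rewrite -[RHS]h -[LHS]adde0; congr (_ + _)%E; exact: esym nuS.
Qed.

Lemma rho_le (f g : R -> \bar R) : measurable_fun setT f -> measurable_fun setT g ->
  (forall t, 0 <= f t)%E -> (forall t, 0 <= g t)%E -> (forall t : R, (0 < t)%R -> f t <= g t)%E ->
  (\int[rhoP]_t f t <= \int[rhoP]_t g t)%E.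
Proof.
move=> mf mg f0 g0 fg; rewrite !rhoE//; apply: lee_wpmul2l.
  by rewrite lee_fin invr_ge0 ltW.
have mgam : measurable_fun setT (EFin \o gam al N) by apply/measurable_EFinP; exact: measurable_gam.
have gam0 t : (0 <= (gam al N t)%:E)%E by rewrite lee_fin gam_ge0.
apply: ge0_le_integral => //.
- by move=> t _; rewrite mule_ge0.
- exact: emeasurable_funM.
- exact: emeasurable_funM.
- move=> t _; have [t0|t0] := ltP 0 t; first by rewrite lee_wpmul2r// fg.
  by rewrite /gam ltNge t0/= !mule0.
Qed.

Lemma rho_ext (f g : R -> \bar R) : measurable_fun setT f -> measurable_fun setT g ->
  (forall t, 0 <= f t)%E -> (forall t, 0 <= g t)%E -> (forall t : R, (0 < t)%R -> f t = g t)%E ->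
  (\int[rhoP]_t f t = \int[rhoP]_t g t)%E.
Proof.
by move=> mf mg f0 g0 fg; apply/eqP; rewrite eq_le !rho_le// => t t0; rewrite fg.
Qed.

Definition moment s : R := z^-1 * fine (\int[lambda]_t (gam al (N + s) t)%:E)%E.

Let gam_fin s : 0 < N + s -> (\int[lambda]_t (gam al (N + s) t)%:E)%E \is a fin_num.
Proof.
move=> s0; rewrite ge0_fin_numE ?gam_integral_fin//.
by apply: integral_ge0 => t _; rewrite lee_fin gam_ge0.
Qed.

Lemma momentE s : 0 < N + s -> (\int[rhoP]_t (t `^ s)%:E = (moment s)%:E)%E.
Proof.
move=> s0; rewrite rhoE//; last 2 first.
- by apply/measurable_EFinP; exact: measurable_powR.
- by move=> t; rewrite lee_fin powR_ge0.
rewrite /moment EFinM fineK ?gam_fin//; congr (_ * _)%E; apply: eq_integral => t _.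
have [t0|t0] := ltP 0 t; first by rewrite -EFinM gamM.
by rewrite /gam !ltNge t0/= mule0.
Qed.

Lemma moment_gt0 s : 0 < N + s -> 0 < moment s.
Proof.
move=> s0; rewrite mulr_gt0 ?invr_gt0//; apply: fine_gt0.
by rewrite gam_integral_gt0// gam_integral_fin.
Qed.

Lemma moment_recl s : 0 < N + s -> (N + s) * moment s <= moment (s + al).
Proof.
move=> s0; have s1 : 0 < N + (s + al) by rewrite addrA addr_gt0.
rewrite /moment mulrCA ler_wpM2l ?invr_ge0 ?(ltW z_gt0)//.
rewrite -lee_fin EFinM !fineK ?gam_fin// addrA.
exact: moment_ineq.
Qed.

Section Product.
Variables (F : borelRn R n.+1 -> \bar R) (a : R -> R) (b : T -> R).
Hypotheses (mF : measurable_fun setT F) (F0 : forall x, (0 <= F x)%E)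
  (ma : measurable_fun setT a) (a0 : forall t, 0 <= a t)
  (mb : measurable_fun setT (b : borelRn R n.+1 -> R)) (b0 : forall u, 0 <= b u).

Let mG : measurable_fun setT (fun u : borelRn R n.+1 => \int[rhoP]_t F (t *: theta u)%R)%E.
Proof.
apply: (@measurable_fun_fubini_tonelli_F _ _ _ _ _ rhoP (fun p : borelRn R n.+1 * R => F (p.2 *: theta p.1))) => //.
apply: (measurableT_comp mF); apply: measurable_scale2 => //.
by apply: (measurableT_comp (measurable_profile cphi)); exact: measurable_fst.
Qed.

Let mFt (u : T) : measurable_fun setT (fun t : R => F (t *: theta u)).
Proof. by apply: (measurableT_comp mF); apply: measurable_scale2. Qed.

Let mH : measurable_fun setT (fun u : borelRn R n.+1 => \int[rhoP]_t (a t)%:E * (b u)%:E)%E.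
Proof. by apply: emeasurable_funM => //; apply/measurable_EFinP. Qed.

Let ra0 : (0 <= \int[rhoP]_t (a t)%:E)%E.
Proof. by apply: integral_ge0 => t _; rewrite lee_fin. Qed.

Let prodE : (\int[nuP]_(u in S) (\int[rhoP]_t (a t)%:E * (b u)%:E) =
  \int[rhoP]_t (a t)%:E * \int[nuP]_(u in S) (b u)%:E)%E.
Proof.
rewrite ge0_integralZl//; first exact: measurable_sphere.
- by apply/measurable_EFinP; apply: measurable_funTS.
- by move=> u _; rewrite lee_fin.
Qed.

Let inner u : (\int[rhoP]_t ((a t)%:E * (b u)%:E) = \int[rhoP]_t (a t)%:E * (b u)%:E)%E.
Proof.
by rewrite ge0_integralZr//; [apply/measurable_EFinP|move=> t _; rewrite lee_fin|rewrite lee_fin].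
Qed.

Lemma polar_le : (forall u t, S u -> 0 < t -> (F (t *: theta u) <= (a t * b u)%:E)%E) ->
  (\int[muP]_x F x <= \int[rhoP]_t (a t)%:E * \int[nuP]_(u in S) (b u)%:E)%E.
Proof.
move=> h; rewrite polar// nu_sphere//; last by move=> u; exact: integral_ge0.
rewrite -prodE; apply: ge0_le_integral => //.
- exact: measurable_sphere.
- by move=> u _; exact: integral_ge0.
- exact: measurable_funTS.
- exact: measurable_funTS.
move=> u Su; rewrite -inner; apply: rho_le => //.
- by apply: emeasurable_funM => //; apply/measurable_EFinP.
- by move=> t; rewrite mule_ge0// lee_fin.
- by move=> t t0; rewrite -EFinM; exact: h.
Qed.

Lemma polar_prod : (forall u t, S u -> 0 < t -> F (t *: theta u) = (a t * b u)%:E) ->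
  (\int[muP]_x F x = \int[rhoP]_t (a t)%:E * \int[nuP]_(u in S) (b u)%:E)%E.
Proof.
move=> h; rewrite polar// nu_sphere//; last by move=> u; exact: integral_ge0.
rewrite -prodE; apply: eq_integral => u /set_mem Su; rewrite -inner; apply: rho_ext => //.
- by apply: emeasurable_funM => //; apply/measurable_EFinP.
- by move=> t; rewrite mule_ge0// lee_fin.
- by move=> t t0; rewrite -EFinM; exact: h.
Qed.

End Product.

(** The origin, where the Hessian of [Phi] is not controlled, is a null set of [mu]. *)
Lemma mu_off0 (F G : borelRn R n.+1 -> \bar R) : measurable_fun setT F -> measurable_fun setT G ->
  (forall x : T, x != 0%R -> F x = G x) -> (\int[muP]_x F x = \int[muP]_x G x)%E.
Proof.
move=> mF mG FG.
have m0 : measurable ([set (0 : T)] : set (borelRn R n.+1)).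
  by apply: measurable_closedRn; apply: accessible_closed_set1; apply: hausdorff_accessible; exact: norm_hausdorff.
have mu0 : muP [set (0 : T)] = 0%E.
  have E : (\int[muP]_x (\1_([set (0 : T)] : set T) x)%:E =
      \int[rhoP]_t (cst 0%R t)%:E * \int[nuP]_(u in S) (cst 0%R u)%:E)%E.
    apply: polar_prod => //.
    - by apply/measurable_EFinP; exact: measurable_indic.
    - move=> u t Su t0; rewrite mul0r indicE memNset// => /eqP.
      rewrite scaler_eq0 gt_eqF//= /profile scaler_eq0 (negbTE (sphere_neq0 Su)) orbF invr_eq0.
      by rewrite radial_sphere// gt_eqF// phi_gt0.
  by move: E; rewrite integral_indic// setIT integral0 mul0e.
apply: ae_eq_integral => //; exists [set (0 : T)]; split => // x /= /not_implyP[_ H].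
by apply: contrapT => /eqP x0; apply: H; exact: FG.
Qed.

(** The integrand of (B) in terms of the inverse Hessian of [Phi]; see
    [energy_sphere]. *)
Definition energy (g : T -> R) (u : T) : R := al * Phi u * Q u (sgrad g u).

Lemma Phi_ge0 x : 0 <= Phi x.
Proof. by rewrite PhiE !mulr_ge0 ?powR_ge0// invr_ge0 ltW. Qed.

Lemma energy_ge0 g u : S u -> 0 <= energy g u.
Proof.
move=> Su; apply: mulr_ge0; first by rewrite mulr_ge0 ?Phi_ge0// ltW.
apply: (invhess_ge0 hconv CPhi hdet).
exact: sphere_neq0.
Qed.

Lemma C1_measurable (g : T -> R) : C1_sphere g ->
  measurable_fun setT (fun u : borelRn R n.+1 => g (radial (u : T))).
Proof.
by move=> [dg _]; apply: measurable_sphere_fun => x x0; apply: differentiable_continuous; exact: dg.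
Qed.

Lemma measurable_Phi' : measurable_fun setT (Phi : borelRn R n.+1 -> R).
Proof.
rewrite (_ : Phi = fun x => al^-1 * enorm x `^ al * phi (radial x) `^ al); last exact/funext.
by apply: (measurable_Phi _ (phi := phi)).
Qed.

Lemma measurable_energy g : C1_sphere g -> measurable_fun setT (energy g : borelRn R n.+1 -> R).
Proof.
move=> [_ cg]; apply: measurable_funM.
  by apply: measurable_funM => //; exact: measurable_Phi'.
apply: measurable_invhess => i; apply: measurable_off0_continuous => x x0.
rewrite (_ : (fun x => sgrad g x 0 i) = partial i (g \o radial)); last by apply/funext => y; rewrite mxE.
exact: cg.
Qed.

Lemma ineqA_law C : ineqA Phi C <-> forall f : T -> R, even f -> Ck 1 setT f ->
  (\int[muP]_x (f x ^+ 2)%:E < +oo ->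
   \int[muP]_x (f x ^+ 2)%:E - (\int[muP]_x (f x)%:E) ^+ 2 <=
   C%:E * \int[muP]_x (Q x (grad f x))%:E)%E.
Proof.
have E D f : integral (mu Phi) D f = (\int[muP]_(x in D) f x)%E.
  exact: integral_measurable_ext.
by split=> H f fe cf; have := H f fe cf; rewrite /Var !E.
Qed.

Lemma ineqB_law C : ineqB phi C <-> forall g : T -> R, even_sphere g -> C1_sphere g ->
  (\int[nuP]_(u in S) (g u ^+ 2)%:E - (\int[nuP]_(u in S) (g u)%:E) ^+ 2 <=
   C%:E * \int[nuP]_(u in S) (energy g u)%:E)%E.
Proof.
have E D f : integral (nu phi) D f = (\int[nuP]_(x in D) f x)%E.
  exact: integral_measurable_ext.
have E2 g : C1_sphere g -> (\int[nuP]_(u in S)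
    (phi u * dot (sgrad g u *m tinv u (D2 phi u)) (sgrad g u))%:E = \int[nuP]_(u in S) (energy g u)%:E)%E.
  move=> [dg _]; apply: eq_integral => u /set_mem Su; congr (_%:E).
  by apply: energy_sphere => //; apply: dg; exact: sphere_neq0.
by split=> H g ge cg; have := H g ge cg; rewrite /Var !E E2.
Qed.

Lemma theta_neq0 u : S u -> theta u != 0.
Proof.
move=> Su; rewrite /profile scaler_eq0 negb_or sphere_neq0// andbT invr_eq0 radial_sphere//.
by rewrite gt_eqF// phi_gt0.
Qed.

Lemma t_theta_neq0 u t : S u -> 0 < t -> t *: theta u != 0.
Proof. by move=> Su t0; rewrite scaler_eq0 negb_or theta_neq0// gt_eqF. Qed.

Lemma radial_theta u t : S u -> 0 < t -> radial (t *: theta u) = u.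
Proof.
move=> Su t0; rewrite /profile !radialZ// ?radial_sphere//.
by rewrite invr_gt0 phi_gt0.
Qed.

Lemma aPhi_ray u t : S u -> 0 < t -> al * Phi (t *: theta u) = t `^ al.
Proof.
move=> Su t0; have := Phi_ray al phi_gt0 Su t0; rewrite /= -PhiE => ->.
by rewrite mulrA divff ?gt_eqF// mul1r.
Qed.

(** * From R^n to the sphere *)
Section Cone.
Variables (g : T -> R) (q d m : R).
Hypotheses (g_even : even_sphere g) (Cg : C1_sphere g) (q0 : 0 < q) (d0 : 0 < d).

Let W (x : T) := (al * Phi x) `^ (q / al).
Let k (x : T) := g (radial x) - m.

(** The homogeneous function [gauge ^ q * (g - m)], with its radial factor cut off near
    the origin, where [gauge ^ q] need not be differentiable. *)
Definition cone_fun x := cutoff d (W x) * k x.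
Local Notation f := cone_fun.
Let chi (t : R) : R := cutoff d (t `^ q).
Let dchi (t : R) : R := dcutoff d (t `^ q) * (q * t `^ (q - 1)).

Let Phi0 : Phi 0 = 0.
Proof. by rewrite PhiE enorm0 powR0 ?gt_eqF// mulr0 mul0r. Qed.

Let W0 : W 0 = 0.
Proof. by rewrite /W Phi0 mulr0 powR0// gt_eqF// divr_gt0. Qed.

Let aPhi_gt0 x : x != 0 -> 0 < al * Phi x.
Proof. by move=> x0; rewrite mulr_gt0// (Phi_gt0 al_gt1 phi_gt0 PhiE x0). Qed.

Let W_gt0 x : x != 0 -> 0 < W x.
Proof. by move=> x0; rewrite powR_gt0// aPhi_gt0. Qed.

Lemma cone_fun_even : even f.
Proof.
move=> x; rewrite /f /W Phi_even; congr (_ * _); rewrite /k.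
have [->|x0] := eqVneq x 0; first by rewrite oppr0.
have -> : radial (- x) = - radial x by rewrite /radial enormN scalerN.
by rewrite g_even//; exact: enorm_radial.
Qed.

Let kP x : x != 0 -> has_grad k x (sgrad g x).
Proof.
move=> x0; have := has_gradB (has_grad_grad (Cg.1 _ x0)) (has_grad_cst m x).
by rewrite subr0.
Qed.

Let W' x := (q / al * (al * Phi x) `^ (q / al - 1)) *: (al *: grad Phi x).
Let f' x := cutoff d (W x) *: sgrad g x + k x *: (dcutoff d (W x) *: W' x).

Let fP x : x != 0 -> has_grad f x (f' x).
Proof.
move=> x0; have hW : has_grad W x (W' x) by exact: (has_grad_powPhi al_gt1 phi_gt0 PhiE CPhi _ x0).
exact: has_gradM (has_grad_comp hW (is_derive_cutoff d (W_gt0 x0))) (kP x0).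
Qed.

(** The cutoff vanishes where the gauge is small, which contains a ball because
    [phi] is bounded on the sphere. *)
Let small : exists2 r, 0 < r & forall y : T, enorm y < r -> f y = 0.
Proof.
have [u Su|c Sc hc] := @sphere_max R n (phi \o radial); first by apply: cphi; exact: sphere_neq0.
have pc := phi_gt0 Sc.
exists (d `^ q^-1 / phi c); first by rewrite divr_gt0 ?powR_gt0.
move=> y yr; rewrite /f cutoff0 ?mul0r//.
have [->|y0] := eqVneq y 0; first by rewrite W0 ltW.
have gy : gauge al Phi y <= d `^ q^-1.
  rewrite (gaugeE al_gt1 phi_gt0 PhiE y0); apply: (@le_trans _ _ (enorm y * phi c)).
    rewrite ler_wpM2l ?enorm_ge0//.
    by have /= := hc _ (enorm_radial y0); rewrite (radial_sphere (enorm_radial y0)) (radial_sphere Sc).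
  by rewrite -ler_pdivlMr// ltW.
have -> : W y = gauge al Phi y `^ q by rewrite /W /gauge -powRrM [al^-1 * q]mulrC.
have -> : d = (d `^ q^-1) `^ q by rewrite -powRrM mulVf ?gt_eqF// powRr1// ltW.
by apply: ge0_ler_powR; rewrite ?nnegrE ?powR_ge0// ltW.
Qed.

Let f0P y : (exists2 r, 0 < r & forall x : T, enorm (y - x) < r -> f x = 0) -> has_grad f y 0.
Proof.
move=> [r r0 h]; apply: has_grad_near (has_grad_cst 0 y).
have oB := @open_eball R n.+1 y r.
have By : (eball y r : set T) y by rewrite /eball/= subrr enorm0.
by apply: filterS (open_nbhs_nbhs (conj oB By)) => x Bx; rewrite h.
Qed.

Lemma cone_fun_C1 : Ck 1 setT f.
Proof.
have [r r0 hr] := small.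
have h0 (y : T) : enorm y < r -> has_grad f y 0.
  move=> yr; apply: f0P; exists (r - enorm y); rewrite ?subr_gt0// => x xy.
  apply: hr; rewrite -[x](subrK y) (le_lt_trans (enormD _ _))// -ltrBrDr.
  by rewrite enormBC.
split=> [x _|i x _].
  have [->|x0] := eqVneq x 0; last exact: has_grad_diff (fP x0).
  by apply: has_grad_diff (h0 0 _); rewrite enorm0.
have [->|x0] := eqVneq x 0.
  apply: (@near_continuous _ _ (cst 0)); last exact: cst_continuous.
  have oB := @open_eball R n.+1 0 r.
  have By : (eball 0 r : set T) 0 by rewrite /eball/= subrr enorm0.
  apply: filterS (open_nbhs_nbhs (conj oB By)) => y; rewrite /eball/= sub0r enormN => yr.
  by rewrite (has_grad_partial i (h0 _ yr)) mxE.
apply: (@near_continuous _ _ (fun y : T => cutoff d (W y) * partial i (g \o radial) y +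
   k y * (dcutoff d (W y) * (q / al * (al * Phi y) `^ (q / al - 1) * (al * partial i Phi y))))).
  near=> y; have y0 : y != 0 by near: y; exact: near_neq0.
  by rewrite (has_grad_partial i (fP y0)) !mxE.
have caP : {for x, continuous (fun y => al * Phi y)}.
  apply: continuousM; first exact: cst_continuous.
  exact: has_grad_continuous (dPhi CPhi x0).
have cpow b : {for x, continuous (fun y => (al * Phi y) `^ b)}.
  apply: (@continuous_comp _ _ _ (fun y => al * Phi y) (fun s => s `^ b)) => //.
  by apply: continuous_powR; exact: aPhi_gt0.
apply: continuousD.
  apply: continuousM; last exact: (Cg.2 i).
  apply: (@continuous_comp _ _ _ W (cutoff d)); first exact: cpow.
  by apply: der_continuous (is_derive_cutoff d (W_gt0 x0)).
apply: continuousM; first exact: has_grad_continuous (kP x0).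
apply: continuousM.
  apply: (@continuous_comp _ _ _ W (dcutoff d)); first exact: cpow.
  exact: continuous_dcutoff (W_gt0 x0).
apply: continuousM.
  by apply: continuousM; [exact: cst_continuous|exact: cpow].
apply: continuousM; first exact: cst_continuous.
by have := (CPhi.2 i).1 _ x0; exact: differentiable_continuous.
Unshelve. all: by end_near. Qed.

Lemma cone_fun_ray u t : S u -> 0 < t -> f (t *: theta u) = chi t * (g u - m).
Proof.
move=> Su t0; rewrite /f /W /k aPhi_ray// radial_theta// -powRrM /chi.
have -> : al * (q / al) = q by field; rewrite gt_eqF.
by [].
Qed.

Let dchiP (t : R) : 0 < t -> is_derive t 1 chi (dchi t).
Proof.
move=> t0; apply: (@der_comp _ (cutoff d) (fun s => s `^ q)); last exact: is_derive1_powR.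
by apply: is_derive_cutoff; rewrite powR_gt0.
Qed.

(** The radial derivative of the cutoff is at most that of [t ^ q], and the cutoff itself
    at most [t ^ q], so that the energy is bounded by that of the homogeneous function. *)
Lemma cone_fun_energy u t : S u -> 0 < t ->
  Q (t *: theta u) (grad f (t *: theta u)) <=
  t `^ (2 * q - al) * (q ^+ 2 / (al - 1) * (g u - m) ^+ 2 + energy g u).
Proof.
move=> Su t0; have x0 := t_theta_neq0 Su t0.
have hf := has_grad_grad (has_grad_diff (fP x0)).
rewrite (energy_polar al_gt1 phi_gt0 PhiE CPhi hdet Su t0 hf erefl).
have -> : sgrad (fun v => f (t *: theta v)) u = chi t *: sgrad g u.
  apply: has_gradE.
  apply: has_grad_near (has_gradZ (chi t) (kP (sphere_neq0 Su))).
  near=> y; have y0 : y != 0 by near: y; apply: near_neq0; exact: sphere_neq0.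
  rewrite /= cone_fun_ray//; exact: enorm_radial.
have -> : dot (grad f (t *: theta u)) (theta u) = dchi t * (g u - m).
  have h1 : is_derive t 1 (fun s : R => f (0 + s *: theta u)) (dot (grad f (t *: theta u)) (theta u)).
    by apply: has_grad_line; rewrite add0r.
  have h2 : is_derive t 1 (fun s : R => chi s * (g u - m)) (dchi t * (g u - m)).
    by apply: der_eq (derM (dchiP t0) (der_cst (g u - m) t)) _; rewrite mulr0 addr0.
  have h3 : is_derive t 1 (fun s : R => f (0 + s *: theta u)) (dchi t * (g u - m)).
    apply: near_eq_is_derive h2; near=> s; rewrite add0r cone_fun_ray//.
    by near: s; exact: lt_nbhsr.
  by have [_ <-] := h1; have [_ ->] := h3.
rewrite invhessZ [leRHS]mulrDr; apply: lerD.
  have /andP[c0 c1] := dcutoff_bound d0 (powR_gt0 q t0).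
  have p2 : (t `^ (q - 1)) ^+ 2 * t `^ (2 - al) = t `^ (2 * q - al).
    rewrite -powR_mulrn ?powR_ge0// -powRrM -powRD ?(gt_eqF t0) ?implybT//.
    by congr (_ `^ _); ring.
  rewrite -p2 /dchi.
  have al1 : 0 < al - 1 by rewrite subr_gt0.
  move: (dcutoff _ _) c0 c1 => c c0 c1.
  have c2 : c ^+ 2 <= 1 by rewrite expr_le1.
  move: (t `^ (q - 1)) (t `^ (2 - al)) (powR_ge0 t (2 - al)) => y w w0.
  rewrite (_ : (_ * _) ^+ 2 * w / _ = c ^+ 2 * (y ^+ 2 * w * (q ^+ 2 / (al - 1) * (g u - m) ^+ 2))); last by ring.
  rewrite -[leRHS]mul1r; apply: ler_wpM2r => //; apply: mulr_ge0.
    by rewrite mulr_ge0// sqr_ge0.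
  by rewrite mulr_ge0 ?sqr_ge0// divr_ge0 ?sqr_ge0// ltW.
have -> : al * Phi u * (chi t ^+ 2 * Q u (sgrad g u)) = chi t ^+ 2 * energy g u by rewrite /energy; ring.
rewrite mulrA ler_wpM2r ?energy_ge0//.
have /andP[c0 c1] := cutoff_bound d0 (powR_gt0 q t0).
have -> : t `^ (2 * q - al) = t `^ (- al) * (t `^ q) ^+ 2.
  rewrite -powR_mulrn ?powR_ge0// -powRrM -powRD ?(gt_eqF t0) ?implybT//.
  by congr (_ `^ _); ring.
rewrite ler_wpM2l ?powR_ge0//; apply: lerXn2r; rewrite ?nnegrE ?powR_ge0//.
Unshelve. all: by end_near. Qed.

End Cone.

Let sphere_bounded (g : T -> R) : C1_sphere g -> exists M, forall u, S u -> `|g u| <= M.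
Proof.
move=> Cg; have [u Su|c Sc hc] := @sphere_max R n (fun u => `|g (radial u)|).
  have := Cg.1 _ (sphere_neq0 Su) => /differentiable_continuous; rewrite /prop_for => cg.
  by apply: (@continuous_comp _ _ _ (g \o radial) (fun s => `|s|)) => //; exact: norm_continuous.
by exists `|g c| => u Su; have := hc u Su; rewrite !radial_sphere.
Qed.

Let sphere_integrable (g : T -> R) : C1_sphere g -> nuP.-integrable S (EFin \o g).
Proof.
move=> Cg; have [M hM] := sphere_bounded Cg.
apply: measurable_bounded_integrable; first exact: measurable_sphere.
- by have h : (nuP S < +oo)%E; [rewrite nuPS ltry|exact: h].
- apply: (eq_measurable_fun (fun u : borelRn R n.+1 => g (radial (u : T)))).
    by move=> u /set_mem Su; rewrite radial_sphere.
  by apply: measurable_funTS; exact: C1_measurable.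
- exists M; split; first exact: num_real.
  by move=> x Mx u Su /=; rewrite (le_trans (hM u Su))// ltW.
Qed.

Let C1_sphereM (g : T -> R) : C1_sphere g -> C1_sphere (fun u : T => g u ^+ 2).
Proof.
move=> [dg cg]; have h x : x != 0 -> has_grad ((fun u => g u ^+ 2) \o radial) x ((g (radial x) + g (radial x)) *: sgrad g x).
  move=> x0; have hg := has_grad_grad (dg _ x0).
  have := has_gradM hg hg; rewrite -scalerDl; congr has_grad.
split=> [x x0|i x x0]; first exact: has_grad_diff (h x x0).
have c : {for x, continuous (fun y => (g (radial y) + g (radial y)) * partial i (g \o radial) y)}.
  apply: continuousM; last exact: cg.
  by apply: continuousD; exact: differentiable_continuous (dg _ x0).
apply: near_continuous c; near=> y.
have y0 : y != 0 by near: y; exact: near_neq0.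
by rewrite (has_grad_partial i (h y y0)) !mxE.
Unshelve. all: by end_near. Qed.

(** Functions on the sphere may thus be assumed to have mean 0. *)
Let variance_centred (g : T -> R) : C1_sphere g -> exists m V : R,
  [/\ 0 <= V, (\int[nuP]_(u in S) ((g u - m) ^+ 2)%:E = V%:E)%E,
   (\int[nuP]_(u in S) (g u - m)%:E = 0)%E &
   (\int[nuP]_(u in S) (g u ^+ 2)%:E - (\int[nuP]_(u in S) (g u)%:E) ^+ 2 = V%:E)%E].
Proof.
move=> Cg; have mS := @measurable_sphere R n.
have ig := sphere_integrable Cg; have ig2 := sphere_integrable (C1_sphereM Cg).
have RE h : nuP.-integrable S (EFin \o h) -> (\int[nuP]_(u in S) (h u)%:E = (\int[nuP]_(u in S) h u)%:E)%E.
  by move=> ih; rewrite /Rintegral fineK//; exact: integrable_fin_num ih.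
pose m := \int[nuP]_(u in S) g u.
pose V := \int[nuP]_(u in S) (g u ^+ 2) - m ^+ 2.
have ic (c : R) : nuP.-integrable S (EFin \o cst c).
  by apply: finite_measure_integrable_cst.
have igm : nuP.-integrable S (EFin \o (fun u => g u - m)).
  by have := integrableB mS ig (ic m); apply: eq_integrable.
have iZ : nuP.-integrable S (EFin \o (fun u => 2 * m * g u)).
  by have := integrableZl mS (2 * m) ig; apply: eq_integrable.
have iD : nuP.-integrable S (EFin \o (fun u => g u ^+ 2 - 2 * m * g u)).
  by have := integrableB mS ig2 iZ; apply: eq_integrable.
have nS : fine (nuP S) = 1 by have := nuPS; rewrite /= => ->.
have E : \int[nuP]_(u in S) ((g u - m) ^+ 2) = V.
  rewrite (@eq_Rintegral _ _ _ nuP _ (fun u => (g u ^+ 2 - 2 * m * g u) + m ^+ 2)); last by move=> u _; ring.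
  rewrite (@RintegralD _ _ _ nuP _ (fun u => g u ^+ 2 - 2 * m * g u) (cst (m ^+ 2)))// (@RintegralB _ _ _ nuP _ (fun u => g u ^+ 2) (fun u => 2 * m * g u))// RintegralZl// Rintegral_cst// nS mulr1 -/m /V.
  by ring.
have i2 : nuP.-integrable S (EFin \o (fun u => (g u - m) ^+ 2)).
  have := integrableD mS iD (ic (m ^+ 2)); apply: eq_integrable => // u _ /=.
  by rewrite -EFinD; congr (_%:E); ring.
exists m, V; split.
- by rewrite -E; apply: Rintegral_ge0 => u _; exact: sqr_ge0.
- by rewrite RE// E.
- by rewrite RE// (@RintegralB _ _ _ nuP _ g (cst m))// Rintegral_cst// nS mulr1 subrr.
- by rewrite !RE// -EFin_expe -EFinB.
Qed.

(** The inequality for [cone_fun] with [q = (al - 1) / C].  The cutoff costs at most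
    [4 d] times a moment in the variance and nothing in the energy, hence [d] may be sent
    to 0; then [moment_recl] replaces the moment of order [2 q] by that of order
    [2 q - al].  The bound [C <= 1] enters through [al - 1 <= q], which makes these
    moments finite. *)
Theorem ineqB_of_ineqA C : 1 - al^-1 <= C <= 1 -> ineqA Phi C ->
  ineqB phi (C ^+ 2 / ((N - al) * C + al - 1)).
Proof.
move=> /andP[C1 C2] /ineqA_law hA; apply/ineqB_law => g g_even Cg.
have al1 : 0 < al - 1 by rewrite subr_gt0.
have iC : 0 < 1 - al^-1 by rewrite subr_gt0 invf_lt1.
have C0 : 0 < C by exact: lt_le_trans C1.
have N2 : 2 <= N by rewrite ler_nat ltnS.
(* the exponent which minimizes the resulting constant *)
pose q := (al - 1) / C.
have qC : q * C = al - 1 by rewrite /q divfK// gt_eqF.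
have q1 : al - 1 <= q by rewrite /q ler_pdivlMr// ler_piMr// ltW.
have q0 : 0 < q by exact: lt_le_trans q1.
have D0 : 0 < N + q - al by lra.
have -> : (N - al) * C + al - 1 = (N + q - al) * C by rewrite [RHS]mulrBl [in RHS]mulrDl qC; ring.
have -> : C ^+ 2 / ((N + q - al) * C) = C / (N + q - al).
  by rewrite expr2 invfM mulrACA divff ?gt_eqF// mulr1.
have s1 : 0 < N + (2 * q - al) by lra.
have s2 : 0 < N + 2 * q by lra.
have s3 : 0 < N + q by lra.
have [m [V [V0 VE m0 ->]]] := variance_centred Cg.
have mg := C1_measurable Cg; have mS := @measurable_sphere R n.
have E0 : (0 <= \int[nuP]_(u in S) (energy g u)%:E)%E.
  by apply: integral_ge0 => u Su; rewrite lee_fin energy_ge0.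
have CD0 : 0 < C / (N + q - al) by rewrite divr_gt0.
move: E0; case eE : (\int[nuP]_(u in S) (energy g u)%:E)%E => [e| |] // e0; last first.
  by rewrite gt0_muley ?lte_fin// leey.
rewrite -EFinM lee_fin; rewrite lee_fin in e0.
have igm : nuP.-integrable S (EFin \o (fun u => g u - m)).
  have ic : nuP.-integrable S (EFin \o cst m) by apply: finite_measure_integrable_cst.
  by have := integrableB mS (sphere_integrable Cg) ic; apply: eq_integrable.
pose a0 := moment (2 * q); pose b0 := moment q; pose d0 := moment (2 * q - al).
have b00 : 0 < b0 := moment_gt0 s3.
have d00 : 0 < d0 := moment_gt0 s1.
have key d : 0 < d -> a0 * V <= C * (d0 * (q ^+ 2 / (al - 1) * V + e)) + 4 * d * b0 * V.
  move=> d_gt0; pose f := cone_fun g q d m.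
  have fe : even f by exact: cone_fun_even.
  have fC : Ck 1 setT f by exact: cone_fun_C1.
  have mf : measurable_fun setT (f : borelRn R n.+1 -> R).
    by apply: continuousT_measurableRn => x; exact: differentiable_continuous (fC.1 x I).
  pose chi (t : R) := cutoff d (t `^ q).
  have mchi : measurable_fun setT chi.
    by apply: (measurableT_comp (measurable_cutoff d)); exact: measurable_powR.
  have chib t : 0 < t -> 0 <= chi t <= t `^ q.
    by move=> t0; apply: cutoff_bound => //; exact: powR_gt0.
  have fray u t : S u -> 0 < t -> f (t *: theta u) = chi t * (g (radial u) - m).
    by move=> Su t0; rewrite radial_sphere//; exact: cone_fun_ray.
  have rS (h : R -> R) : (\int[nuP]_(u in S) (h (g (radial u) - m))%:E = \int[nuP]_(u in S) (h (g u - m))%:E)%E.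
    by apply: eq_integral => u /set_mem Su; rewrite radial_sphere.
  have mgm : measurable_fun setT (fun u : borelRn R n.+1 => g (radial (u : T)) - m).
    exact: measurable_funB.
  have f2E : (\int[muP]_x (f x ^+ 2)%:E = \int[rhoP]_t (chi t ^+ 2)%:E * V%:E)%E.
    rewrite (@polar_prod _ (fun t => chi t ^+ 2) (fun u => (g (radial u) - m) ^+ 2)).
    - by rewrite (rS (fun s => s ^+ 2)) VE.
    - by apply/measurable_EFinP; exact: measurable_funX.
    - by move=> x; rewrite lee_fin sqr_ge0.
    - exact: measurable_funX.
    - by move=> t; rewrite sqr_ge0.
    - exact: measurable_funX.
    - by move=> u; rewrite sqr_ge0.
    - by move=> u t Su t0; rewrite fray// exprMn.
  have A1 : (\int[rhoP]_t (chi t ^+ 2)%:E <= a0%:E)%E.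
    rewrite -momentE//; apply: rho_le => //.
    - by apply/measurable_EFinP; exact: measurable_funX.
    - by apply/measurable_EFinP; exact: measurable_powR.
    - by move=> t; rewrite lee_fin sqr_ge0.
    - by move=> t; rewrite lee_fin powR_ge0.
    move=> t t0; rewrite lee_fin mulrC powRrM powR_mulrn ?powR_ge0//.
    by have /andP[h1 h2] := chib t t0; apply: lerXn2r; rewrite ?nnegrE ?powR_ge0.
  have A0 : (0 <= \int[rhoP]_t (chi t ^+ 2)%:E)%E.
    by apply: integral_ge0 => t _; rewrite lee_fin sqr_ge0.
  have A2 : (a0%:E <= \int[rhoP]_t (chi t ^+ 2)%:E + (4 * d * b0)%:E)%E.
    rewrite -momentE// EFinM -(momentE s3) -ge0_integralZl//; last 3 first.
    - by apply/measurable_EFinP; exact: measurable_powR.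
    - by move=> t _; rewrite lee_fin powR_ge0.
    - by rewrite lee_fin mulr_ge0// ltW.
    rewrite -ge0_integralD//; last 4 first.
    - by move=> t _; rewrite lee_fin sqr_ge0.
    - by apply/measurable_EFinP; exact: measurable_funX.
    - by move=> t _; rewrite -EFinM lee_fin !mulr_ge0 ?powR_ge0// ltW.
    - by apply: emeasurable_funM => //; apply/measurable_EFinP; exact: measurable_powR.
    apply: rho_le => //.
    - by apply/measurable_EFinP; exact: measurable_powR.
    - apply: emeasurable_funD; first by apply/measurable_EFinP; exact: measurable_funX.
      by apply: emeasurable_funM => //; apply/measurable_EFinP; exact: measurable_powR.
    - by move=> t; rewrite lee_fin powR_ge0.
    - by move=> t; rewrite -EFinM -EFinD lee_fin addr_ge0 ?sqr_ge0// !mulr_ge0 ?powR_ge0// ltW.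
    move=> t t0; rewrite -EFinM -EFinD lee_fin mulrC powRrM powR_mulrn ?powR_ge0//.
    by apply: cutoff_sqr_ge => //; exact: powR_gt0.
  have f0 : (\int[muP]_x (f x)%:E = 0)%E.
    have part (s : R -> R) (h : R -> R) : measurable_fun setT h -> (forall r, 0 <= h r) ->
        (forall r c, 0 <= c -> h (c * r) = c * h r) ->
        (\int[muP]_x (h (f x))%:E = \int[rhoP]_t (`|chi t|)%:E * \int[nuP]_(u in S) (h (g u - m))%:E)%E.
      move=> mh h0 hZ.
      rewrite (@polar_prod _ (fun t => `|chi t|) (fun u => h (g (radial u) - m))).
      - by rewrite rS.
      - by apply/measurable_EFinP; exact: measurableT_comp.
      - by move=> x; rewrite lee_fin.
      - exact: measurableT_comp.
      - by move=> t.
      - exact: measurableT_comp.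
      - by move=> u.
      - move=> u t Su t0; have /andP[c0 _] := chib t t0.
        by rewrite fray// hZ// ger0_norm.
    have B1 : (\int[rhoP]_t (`|chi t|)%:E)%E \is a fin_num.
      rewrite ge0_fin_numE; last by apply: integral_ge0 => t _; rewrite lee_fin.
      apply: (@le_lt_trans _ _ b0%:E); last exact: ltry.
      rewrite -(momentE s3); apply: rho_le => //.
      - by apply/measurable_EFinP; exact: measurableT_comp.
      - by apply/measurable_EFinP; exact: measurable_powR.
      - by move=> t; rewrite lee_fin powR_ge0.
      by move=> t t0; have /andP[c0 c1] := chib t t0; rewrite lee_fin ger0_norm.
    rewrite integralE.
    have hp r c : 0 <= c -> Num.max (c * r) 0 = c * Num.max r 0 :> R.
      by move=> c0; rewrite maxr_pMr// mulr0.
    have hn r c : 0 <= c -> Num.max (- (c * r)) 0 = c * Num.max (- r) 0 :> R.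
      by move=> c0; rewrite maxr_pMr// mulr0 mulrN.
    have mp : measurable_fun setT (fun r : R => Num.max r 0) by exact: measurable_maxr.
    have mn : measurable_fun setT (fun r : R => Num.max (- r) 0).
      by apply: measurable_maxr => //; exact: measurableT_comp.
    have le0max (r : R) : 0 <= Num.max r 0 by rewrite le_max lexx orbT.
    have -> : (\int[muP]_x ((fun x => (f x)%:E) ^\+ x) = \int[muP]_x (Num.max (f x) 0)%:E)%E.
      by apply: eq_integral => x _; rewrite funeposE/= EFin_max.
    have -> : (\int[muP]_x ((fun x => (f x)%:E) ^\- x) = \int[muP]_x (Num.max (- f x) 0)%:E)%E.
      by apply: eq_integral => x _; rewrite funenegE/= EFin_max EFinN.
    rewrite (part id (fun r => Num.max r 0))// (part id (fun r => Num.max (- r) 0))//.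
    move: m0; rewrite integralE.
    have -> : (\int[nuP]_(u in S) ((fun u => (g u - m)%:E) ^\+ u) = \int[nuP]_(u in S) (Num.max (g u - m) 0)%:E)%E.
      by apply: eq_integral => x _; rewrite funeposE/= EFin_max.
    have -> : (\int[nuP]_(u in S) ((fun u => (g u - m)%:E) ^\- u) = \int[nuP]_(u in S) (Num.max (- (g u - m)) 0)%:E)%E.
      by apply: eq_integral => x _; rewrite funenegE/= EFin_max EFinN.
    have pf : (\int[nuP]_(u in S) (Num.max (g u - m) 0)%:E)%E \is a fin_num.
      have := integrable_fin_num mS (integrable_funepos mS igm).
      by congr (_ \is a fin_num); apply: eq_integral => x _; rewrite funeposE/= EFin_max.
    move=> /eqP; rewrite sube_eq// ?fin_num_adde_defr//.
    by rewrite add0e => /eqP <-; rewrite subee// fin_numM.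
  have QE : (\int[muP]_x (Q x (grad f x))%:E <= (d0 * (q ^+ 2 / (al - 1) * V + e))%:E)%E.
    have mQ : measurable_fun setT (fun x : borelRn R n.+1 => Q x (grad f x)).
      apply: measurable_invhess => i.
      rewrite (_ : (fun x => grad f x 0 i) = partial i f); last by apply/funext => y; rewrite mxE.
      by apply: continuousT_measurableRn => x; exact: (fC.2 i x I).
    rewrite (mu_off0 (G := fun x => (`|Q x (grad f x)|)%:E)); last 3 first.
    - exact/measurable_EFinP.
    - by apply/measurable_EFinP; exact: measurableT_comp.
    - by move=> x x0; rewrite ger0_norm// (invhess_ge0 hconv CPhi hdet).
    have mb2 : measurable_fun setT (fun u : borelRn R n.+1 => q ^+ 2 / (al - 1) * (g (radial (u : T)) - m) ^+ 2).
      by apply: measurable_funM => //; exact: measurable_funX.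
    have b20 u : 0 <= q ^+ 2 / (al - 1) * (g (radial u) - m) ^+ 2.
      by rewrite mulr_ge0 ?sqr_ge0// divr_ge0 ?sqr_ge0// ltW.
    have mE := measurable_energy Cg.
    apply: (le_trans (@polar_le _ (fun t => t `^ (2 * q - al))
      (fun u => q ^+ 2 / (al - 1) * (g (radial u) - m) ^+ 2 + `|energy g u|) _ _ _ _ _ _ _)).
    - by apply/measurable_EFinP; exact: measurableT_comp.
    - by move=> x; rewrite lee_fin.
    - exact: measurable_powR.
    - by move=> t; exact: powR_ge0.
    - by apply: measurable_funD => //; exact: measurableT_comp.
    - by move=> u; exact: addr_ge0.
    - move=> u t Su t0; rewrite lee_fin radial_sphere// [X in _ <= _ * (_ + X)]ger0_norm ?energy_ge0//.
      rewrite ger0_norm; first exact: cone_fun_energy.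
      by apply: (invhess_ge0 hconv CPhi hdet); exact: t_theta_neq0.
    rewrite momentE// -/d0.
    have -> : (\int[nuP]_(u in S) (q ^+ 2 / (al - 1) * (g (radial u) - m) ^+ 2 + `|energy g u|)%:E =
        (q ^+ 2 / (al - 1) * V + e)%:E)%E.
      under eq_integral do rewrite EFinD EFinM.
      rewrite ge0_integralD//; last 3 first.
      - by move=> u _; rewrite -EFinM lee_fin.
      - by apply: emeasurable_funM => //; apply/measurable_EFinP; apply: measurable_funTS; exact: measurable_funX.
      - by apply/measurable_EFinP; apply: measurable_funTS; exact: measurableT_comp.
      rewrite ge0_integralZl//; last 3 first.
      - by apply/measurable_EFinP; apply: measurable_funTS; exact: measurable_funX.
      - by move=> u _; rewrite lee_fin sqr_ge0.
      - by rewrite lee_fin divr_ge0 ?sqr_ge0// ltW.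
      rewrite (rS (fun s => s ^+ 2)) VE EFinD EFinM -eE; congr (_ + _)%E.
      by apply: eq_integral => u /set_mem Su; rewrite ger0_norm// energy_ge0.
    by rewrite -EFinM.
  move: A0 A1 A2 f2E; case: (\int[rhoP]_t (chi t ^+ 2)%:E)%E => [A| |]// A0 A1 A2 f2E.
  have := hA f fe fC; rewrite f2E -EFinM => /(_ (ltry _)).
  rewrite f0 expe2 mul0e sube0 => h.
  have {}h : A * V <= C * (d0 * (q ^+ 2 / (al - 1) * V + e)).
    rewrite -lee_fin; apply: (le_trans h); rewrite [leRHS]EFinM; apply: lee_wpmul2l => //.
    by rewrite lee_fin ltW.
  move: A2; rewrite -EFinD lee_fin => A2.
  apply: (le_trans (ler_wpM2r V0 A2)); rewrite mulrDl; lra.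
have key2 : a0 * V <= C * (d0 * (q ^+ 2 / (al - 1) * V + e)).
  apply/ler_addgt0Pr => r r0.
  have b1 : 0 <= 4 * b0 * V by rewrite mulr_ge0// mulr_ge0// ltW.
  have p0 : 0 < 4 * b0 * V + 1 by lra.
  apply: (le_trans (key (r / (4 * b0 * V + 1)) _)); first by rewrite divr_gt0.
  rewrite lerD2l (_ : 4 * (r / (4 * b0 * V + 1)) * b0 * V = r * ((4 * b0 * V) / (4 * b0 * V + 1))); last first.
    by field; rewrite gt_eqF.
  apply: ler_piMr; first exact: ltW.
  by rewrite ler_pdivrMr// mul1r lerDl.
have key3 := moment_recl s1; rewrite subrK -/d0 -/a0 in key3.
(* here [C * (q ^+ 2 / (al - 1)) = q] *)
have key4 : (N + (2 * q - al)) * V <= q * V + C * e.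
  rewrite -(ler_pM2l d00) mulrA [d0 * (N + _)]mulrC.
  apply: (le_trans (ler_wpM2r V0 key3)); apply: (le_trans key2).
  have q00 : q != 0 by rewrite gt_eqF.
  have C00 : C != 0 by rewrite gt_eqF.
  rewrite le_eqVlt; apply/orP; left; apply/eqP; rewrite -qC.
  by field; rewrite q00 C00.
rewrite mulrAC ler_pdivlMr// mulrC.
have -> : (N + q - al) * V = (N + (2 * q - al)) * V - q * V by ring.
by rewrite lerBlDl.
Qed.

(** * From the sphere to R^n *)
Lemma theta_scaled x : x != 0 -> theta (radial x) = (gauge al Phi x)^-1 *: x.
Proof.
move=> x0; rewrite /profile radial_sphere; last exact: enorm_radial.
by rewrite /radial scalerA -invfM (gaugeE al_gt1 phi_gt0 PhiE x0) mulrC.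
Qed.

Lemma thetaN u : S u -> theta (- u) = - theta u.
Proof.
move=> Su; have SNu : S (- u) by rewrite /sphere/= enormN.
have u0 := sphere_neq0 Su; have Nu0 := sphere_neq0 SNu.
rewrite -{1}(radial_sphere SNu) -{2}(radial_sphere Su) !theta_scaled//.
by rewrite /gauge Phi_even scalerN.
Qed.

Lemma gauge_ray u t : S u -> 0 < t -> gauge al Phi (t *: theta u) = t.
Proof. move=> Su t0; rewrite /gauge aPhi_ray// -powRrM (_ : al * al^-1 = 1); last by rewrite divff// gt_eqF.
exact: (powRr1 (ltW t0)). Qed.

Lemma measurable_gauge : measurable_fun setT (gauge al Phi : borelRn R n.+1 -> R).
Proof.
apply: (measurableT_comp (measurable_powR _)).
by apply: measurable_funM => //; exact: measurable_Phi'.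
Qed.

Section Window.
Variables (a b : R).

Definition window (x : T) : R := \1_(`[a, b]%classic) (gauge al Phi x).

Lemma window_ge0 x : 0 <= window x.
Proof. by rewrite /window indicE ler0n. Qed.

Lemma window_le1 x : window x <= 1.
Proof. by rewrite /window indicE lern1 leq_b1. Qed.

Lemma measurable_window : measurable_fun setT (window : borelRn R n.+1 -> R).
Proof. by apply: (measurableT_comp _ measurable_gauge); exact: measurable_indic. Qed.

Local Notation inner F u := (\int[lambda]_(t in `[a, b]) (F (t *: theta u)%R * (weight al N z t)%:E))%E.

Let measurable_weight : measurable_fun setT (weight al N z).
Proof. by apply: measurable_funM => //; exact: measurable_gam. Qed.

Let F_ray (F : borelRn R n.+1 -> \bar R) : measurable_fun setT F -> measurable_fun setT (fun p : borelRn R n.+1 * R => F (p.2 *: theta p.1)).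
Proof.
move=> mF; apply: (measurableT_comp mF); apply: measurable_scale2 => //.
by apply: (measurableT_comp (measurable_profile cphi)); exact: measurable_fst.
Qed.

Let F_ray1 (F : borelRn R n.+1 -> \bar R) (u : T) : measurable_fun setT F -> measurable_fun setT (fun t : R => F (t *: theta u)).
Proof. by move=> mF; apply: (measurableT_comp mF); apply: measurable_scale2. Qed.

Let inner_rho (F : borelRn R n.+1 -> \bar R) (u : T) : measurable_fun setT F -> (forall x, (0 <= F x)%E) ->
  (inner F u = \int[rhoP]_t (F (t *: theta u)%R * (\1_(`[a, b]%classic) t)%:E))%E.
Proof.
move=> mF F0.
have mi : measurable_fun setT (fun t : R => (\1_(`[a, b]%classic) t)%:E : \bar R).
  by apply/measurable_EFinP; exact: measurable_indic.
have i0 (t : R) : (0 <= (\1_(`[a, b]%classic) t : R)%:E)%E by rewrite lee_fin indicE ler0n.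
have mFt := @F_ray1 F u mF.
have mg : measurable_fun setT (fun t : R => (gam al N t)%:E) by apply/measurable_EFinP; exact: measurable_gam.
have g0 t : (0 <= (gam al N t)%:E)%E by rewrite lee_fin gam_ge0.
rewrite rhoE//; last 2 first.
- exact: emeasurable_funM.
- by move=> t; rewrite mule_ge0.
rewrite -ge0_integralZl//; last 3 first.
- by apply: emeasurable_funM => //; exact: emeasurable_funM.
- by move=> t _; rewrite !mule_ge0.
- by rewrite lee_fin invr_ge0 ltW.
rewrite [LHS]integral_mkcond; apply: eq_integral => t _; rewrite patchE indicE.
case: ifPn => ti; last by rewrite mule0 mul0e mule0.
by rewrite mule1 /weight EFinM muleCA.
Qed.

Lemma measurable_ray_integral (F : borelRn R n.+1 -> \bar R) : measurable_fun setT F -> (forall x, (0 <= F x)%E) ->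
  measurable_fun setT (fun u : borelRn R n.+1 => inner F u).
Proof.
move=> mF F0; rewrite (_ : (fun u : borelRn R n.+1 => inner F u) =
    fun u => \int[rhoP]_t (F (t *: theta u)%R * (\1_(`[a, b]%classic) t)%:E))%E; last first.
  by apply/funext => u; exact: inner_rho.
apply: (@measurable_fun_fubini_tonelli_F _ _ _ _ _ rhoP (fun p : borelRn R n.+1 * R =>
    (F (p.2 *: theta p.1)%R * (\1_(`[a, b]%classic) p.2)%:E)%E)).
- apply: emeasurable_funM; first exact: F_ray.
  by apply/measurable_EFinP; apply: measurableT_comp => //; exact: measurable_indic.
- by move=> p; rewrite mule_ge0// lee_fin indicE ler0n.
Qed.

(** On the ray through [u] the gauge is the radius, so that the indicator restricts
    the inner integral to [[a, b]]. *)
Lemma polar_window (F : borelRn R n.+1 -> \bar R) : measurable_fun setT F -> (forall x, (0 <= F x)%E) ->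
  (\int[muP]_x (F x * (window x)%:E) = \int[nuP]_(u in S) inner F u)%E.
Proof.
move=> mF F0.
have mw : measurable_fun setT (fun x : borelRn R n.+1 => (window x)%:E).
  by apply/measurable_EFinP; exact: measurable_window.
have w0 x : (0 <= (window x)%:E)%E by rewrite lee_fin window_ge0.
have mFw : measurable_fun setT (fun x : borelRn R n.+1 => F x * (window x)%:E)%E by exact: emeasurable_funM.
have Fw0 x : (0 <= F x * (window x)%:E)%E by rewrite mule_ge0.
have mi : measurable_fun setT (fun t : R => (\1_(`[a, b]%classic) t)%:E : \bar R).
  by apply/measurable_EFinP; exact: measurable_indic.
rewrite polar// nu_sphere//; last 2 first.
- apply: (@measurable_fun_fubini_tonelli_F _ _ _ _ _ rhoP (fun p : borelRn R n.+1 * R =>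
    (F (p.2 *: theta p.1)%R * (window (p.2 *: theta p.1))%:E)%E)) => //; exact: (F_ray mFw).
- by move=> u; apply: integral_ge0 => t _; exact: Fw0.
apply: eq_integral => u /set_mem Su; rewrite inner_rho//; apply: rho_ext => //.
- exact: (F_ray1 u mFw).
- by apply: emeasurable_funM => //; exact: F_ray1.
- by move=> t; rewrite mule_ge0// lee_fin indicE ler0n.
- by move=> t t0; rewrite /window gauge_ray.
Qed.

End Window.

Lemma continuous_sum (X : topologicalType) k (F : 'I_k -> X -> R) (x : X) :
  (forall i, {for x, continuous (F i)}) -> {for x, continuous (fun y => \sum_i F i y)}.
Proof.
by move=> cF; rewrite /prop_for /continuous_at; apply: cvg_big => [|i _]; [exact: add_continuous|exact: cF].
Qed.

Lemma continuous_scaling (X : topologicalType) (r : X -> R) (v : X -> T) (x : X) :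
  {for x, continuous r} -> {for x, continuous v} -> {for x, continuous (fun y => r y *: v y)}.
Proof.
move=> cr cv; have c : {for x, continuous (fun y => (r y, v y))} by exact: (cvg_pair cr cv).
apply: (@continuous_comp _ _ _ (fun y => (r y, v y)) (fun p : R * T => p.1 *: p.2) _ c).
exact: scale_continuous.
Qed.

Section Truncation.
Variables (f : T -> R) (a b t0 Cnu : R).
Hypotheses (f_even : even f) (Cf : Ck 1 setT f) (a_gt0 : 0 < a) (a_t0 : a < t0) (t0_b : t0 < b)
  (t0N : t0 `^ al = N) (ends : a `^ N * gexp al a <= b `^ N * gexp al b) (Cnu0 : 0 < Cnu).

Let ab : a < b. Proof. exact: lt_trans t0_b. Qed.
Let t0_gt0 : 0 < t0. Proof. exact: lt_trans a_t0. Qed.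
Local Notation RI := (wint al N z a b).
Local Notation m := (wmass al N z a b).
Let m0 : 0 < m. Proof. exact: wmass_gt0. Qed.
Let cf : continuous f. Proof. by move=> x; exact: differentiable_continuous (Cf.1 x I). Qed.
Let df x : has_grad f x (grad f x). Proof. by apply: has_grad_grad; exact: Cf.1. Qed.
Let cdf i : continuous (partial i f). Proof. by move=> x; exact: Cf.2. Qed.

(** Composed with [theta] this is the conditional mean of [f] given the direction,
    for radii restricted to [[a, b]].  It is defined on all vectors so that its
    differentiability at [theta u] can be derived from that of [f]. *)
Definition ray_average (y : T) : R := m^-1 * RI (fun t => f (t *: y)).
Definition ray_momentum (y : T) : T := \row_i RI (fun t => t * partial i f (t *: y)).
Local Notation g := (fun u => ray_average (theta u)).

Lemma has_grad_ray_average y : has_grad ray_average y (m^-1 *: ray_momentum y).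
Proof. by apply: has_gradZ; exact: has_grad_average. Qed.

Lemma ray_average_even : even_sphere g.
Proof.
move=> u Su /=; rewrite thetaN// /ray_average; congr (_ * _); congr RI.
by apply/funext => t; rewrite scalerN f_even.
Qed.

Let s (x : T) := (gauge al Phi x)^-1.
Let ds (x : T) := - s x ^+ 2 *: grad (gauge al Phi) x.
Let sP x : x != 0 -> has_grad s x (ds x).
Proof.
move=> x0; have g0 := gauge_gt0 al_gt1 phi_gt0 PhiE x0.
have hg := has_grad_grad (has_grad_diff (has_grad_gauge al_gt1 phi_gt0 PhiE CPhi x0)).
apply: (has_grad_comp (a := fun r => r^-1)) hg _.
apply: der_eq (derV (f := id) (lt0r_neq0 g0) (is_derive_id _ _)) _.
by rewrite /s exprVn mulNr mul1r.
Qed.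

Let dg (x : T) : T := s x *: (m^-1 *: ray_momentum (s x *: x)) + dot (m^-1 *: ray_momentum (s x *: x)) x *: ds x.
Let gP x : x != 0 -> has_grad (g \o radial) x (dg x).
Proof.
move=> x0; apply: has_grad_near (has_grad_scale (sP x0) (has_grad_ray_average _)).
near=> y; have y0 : y != 0 by near: y; exact: near_neq0.
by rewrite /= theta_scaled.
Unshelve. all: by end_near. Qed.

(** Through the projection [x |-> x / gauge x] onto the level set, the average is a
    composition of continuously differentiable functions. *)
Lemma ray_average_C1 : C1_sphere g.
Proof.
split=> [x x0|i x x0]; first exact: has_grad_diff (gP x0).
have cs : {for x, continuous s} by exact: has_grad_continuous (sP x0).
have cM j : {for x, continuous (fun y : T => ray_momentum (s y *: y) 0 j)}.
  rewrite (_ : (fun y : T => _) = (fun y : T => RI (fun t => t * partial j f (t *: y))) \o (fun y => s y *: y)); last first.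
    by apply/funext => y; rewrite /= mxE.
  have ci : continuous (@id R) by move=> r; exact: cvg_id.
  have ca := @continuous_average R al N z a b al_gt1 z_gt0 a_gt0 ab _ (partial j f) id (@cdf j) ci.
  apply: continuous_comp; last exact: ca.
  by apply: continuous_scaling => //; exact: cvg_id.
have cds j : {for x, continuous (fun y : T => ds y 0 j)}.
  have c1 : {for x, continuous (fun y => - s y ^+ 2 * (((al * Phi y) `^ (al^-1 - 1)) * partial j Phi y))}.
    apply: continuousM.
      apply: continuousN; rewrite (_ : (fun y => s y ^+ 2) = fun y => s y * s y); first exact: continuousM.
      by apply/funext => y; rewrite expr2.
    apply: continuousM; first exact: has_grad_continuous (has_grad_powPhi al_gt1 phi_gt0 PhiE CPhi _ x0).
    by apply: differentiable_continuous; exact: (CPhi.2 j).1.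
  apply: near_continuous c1; near=> y; have y0 : y != 0 by near: y; exact: near_neq0.
  by rewrite /ds (grad_gauge al_gt1 phi_gt0 PhiE CPhi y0) !mxE.
have ccoord j : {for x, continuous (fun y : T => y 0 j)} by exact: coord_continuous.
have c : {for x, continuous (fun y : T => s y * (m^-1 * ray_momentum (s y *: y) 0 i) +
    (\sum_j (m^-1 * ray_momentum (s y *: y) 0 j) * y 0 j) * ds y 0 i)}.
  have cZ j : {for x, continuous (fun y : T => m^-1 * ray_momentum (s y *: y) 0 j)}.
    by apply: continuousM => //; exact: cst_continuous.
  apply: continuousD; first exact: continuousM.
  apply: continuousM => //; apply: continuous_sum => j.
  exact: continuousM.
apply: near_continuous c; near=> y; have y0 : y != 0 by near: y; exact: near_neq0.
rewrite (has_grad_partial i (gP y0)) /dg !mxE; congr (_ + _ * _).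
by apply: eq_bigr => j _; rewrite !mxE.
Unshelve. all: by end_near. Qed.

Section OneRay.
Variable u : T.
Hypothesis Su : S u.
Let F (t : R) := f (t *: theta u).
Let F' (t : R) := dot (grad f (t *: theta u)) (theta u).
Let y (t : R) : T := t *: grad f (t *: theta u).
Let p : T := ((al * Phi u) `^ (al^-1 - 1)) *: grad Phi u.
Let L (v : T) : T := (phi u)^-1 *: v - ((phi u)^-1 ^+ 2 * dot v u) *: p.
(** The matrix of [L], the map from the gradient at [theta u] to the spherical gradient at
    [u] of [sgrad_profile]. *)
Let Lm : 'M[R]_n.+1 := (phi u)^-1%:M - (phi u)^-1 ^+ 2 *: (u^T *m p).
Let B : 'M[R]_n.+1 := (al * Phi u) *: (Lm *m invmx (hess Phi u) *m Lm^T).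

Let LE v : L v = v *m Lm.
Proof.
rewrite /L /Lm mulmxBr mul_mx_scalar -scalemxAr mulmxA dot_mx mul_scalar_mx.
by rewrite scalerA.
Qed.

Let BE v : dot (v *m B) v = al * Phi u * Q u (L v).
Proof.
rewrite /B -scalemxAr dotZl /invhess LE; congr (_ * _).
by rewrite !mulmxA [LHS]mx_dot [RHS]mx_dot trmx_mul !mulmxA.
Qed.

Let aPhi_ge0 : 0 <= al * Phi u. Proof. by rewrite mulr_ge0 ?Phi_ge0// ltW. Qed.

Let B0 v : 0 <= dot (v *m B) v.
Proof. by rewrite BE mulr_ge0// (invhess_ge0 hconv CPhi hdet)//; exact: sphere_neq0. Qed.

Let cy i : cpos (fun t => y t 0 i).
Proof.
move=> t t_gt0; rewrite (_ : (fun t => y t 0 i) = fun t => t * partial i f (t *: theta u)).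
  by apply: continuousM => //; exact: (@cpos_ray _ _ _ _ (@cdf i) t t_gt0).
by apply/funext => r; rewrite !mxE.
Qed.

Let dF (t : R) : is_derive t 1 F (F' t).
Proof.
have h : has_grad f (0 + t *: theta u) (grad f (t *: theta u)) by rewrite add0r.
have := has_grad_line h; congr is_derive.
by apply/funext => r; rewrite add0r.
Qed.

Let cF' : continuous F'.
Proof.
rewrite (_ : F' = fun t => \sum_i partial i f (t *: theta u) * theta u 0 i).
  move=> t; rewrite /continuous_at; apply: cvg_big => [|i _]; first exact: add_continuous.
  have c : {for t, continuous (fun t : R => partial i f (t *: theta u) * theta u 0 i)}; last exact: c.
  apply: continuousM; last exact: cst_continuous.
  by apply: (@continuous_comp _ _ _ (fun t : R => t *: theta u) (partial i f)); [exact: scalel_continuous|exact: cdf].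
by apply/funext => t; rewrite /F' /dot; apply: eq_bigr => i _; rewrite !mxE.
Qed.

Let radial_part t := F' t ^+ 2 * t `^ (2 - al).
Let angular_part t := t `^ (- al) * dot (y t *m B) (y t).

Let Q_ray t : 0 < t -> Q (t *: theta u) (grad f (t *: theta u)) =
  (al - 1)^-1 * radial_part t + angular_part t.
Proof.
move=> t_gt0; have hf := df (t *: theta u).
rewrite (energy_polar al_gt1 phi_gt0 PhiE CPhi hdet Su t_gt0 hf erefl).
congr (_ + _); first by rewrite mulrC.
rewrite /angular_part BE; congr (_ * (_ * Q u _)).
by rewrite /sgrad (has_gradE (sgrad_profile al_gt1 phi_gt0 PhiE CPhi Su (has_grad_dilate hf))).
Qed.

Let cradial : cpos radial_part.
Proof.
apply: cposM => [t _|t t_gt0]; last exact: continuous_powR.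
rewrite (_ : (fun t => F' t ^+ 2) = fun t => F' t * F' t); first by apply: continuousM; exact: cF'.
by apply/funext => r; rewrite expr2.
Qed.

Let cangular : cpos angular_part.
Proof. by apply: cposM => [t t_gt0|]; [exact: continuous_powR|exact: (@cpos_form _ _ _ _ (fun i => @cy i))]. Qed.

Let cF2 : cpos (fun t => F t ^+ 2).
Proof.
move=> t t_gt0; rewrite (_ : (fun t => F t ^+ 2) = fun t => F t * F t); last by apply/funext => r; rewrite expr2.
by apply: continuousM; exact: (@cpos_ray _ _ _ _ cf t t_gt0).
Qed.

(** For the full radial law this is an equality; on an interval the boundary terms of
    the integration by parts have the favourable sign by the choice of the end points. *)
Let second_moment : RI (fun t => t `^ al) <= N * m.
Proof.
have E : forall h : R -> R, cpos h -> RI h = z^-1 * \int[lambda]_(t in `[a, b]) (h t * gam al N t).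
  move=> h ch; rewrite /wint -RintegralZl//; last first.
    by apply: integrable_pos => //; apply: cposM => // t t_gt0; exact: continuous_gam.
  by apply: eq_Rintegral => t _; rewrite /weight mulrCA.
rewrite /wmass !E; [|exact: cpos_cst|by move=> t t_gt0; exact: continuous_powR].
rewrite mulrCA; apply: ler_wpM2l; first by rewrite invr_ge0 ltW.
under [X in _ <= _ * X]eq_Rintegral do rewrite mul1r.
rewrite -(integral_gam_recl al_gt1 N a_gt0 ab).
rewrite (_ : \int[lambda]_(x in `[a, b]) (x `^ al * gam al N x) = \int[lambda]_(x in `[a, b]) gam al (N + al) x).
  by rewrite lerDl subr_ge0.
apply: eq_Rintegral => t /set_mem/=; rewrite in_itv/= => /andP[at_ _].
by rewrite gamM// (lt_le_trans a_gt0).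
Qed.

Let poincare : RI (fun t => (F t - F t0) ^+ 2) <= al^-1 * RI radial_part.
Proof.
have := poincare_interval al_gt1 dF cF' t0_gt0 t0N a_gt0 a_t0 t0_b.
have E h : cpos h -> RI h = z^-1 * \int[lambda]_(t in `[a, b]) (h t * gam al N t).
  move=> ch; rewrite /wint -RintegralZl//; last first.
    by apply: integrable_pos => //; apply: cposM => // t t_gt0; exact: continuous_gam.
  by apply: eq_Rintegral => t _; rewrite /weight mulrCA.
move=> H; rewrite !E//; last first.
  move=> t t_gt0; rewrite (_ : (fun t => _) = fun t => (F t - F t0) * (F t - F t0)); last by apply/funext => r; rewrite expr2.
  by apply: continuousM; apply: continuousB; try exact: cst_continuous; exact: (@cpos_ray _ _ _ _ cf t t_gt0).
rewrite mulrCA; apply: ler_wpM2l; first by rewrite invr_ge0 ltW.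
apply: (le_trans H); rewrite le_eqVlt; apply/orP; left; apply/eqP; congr (_ * _).
apply: eq_Rintegral => t /set_mem/=; rewrite in_itv/= => /andP[at_ _].
by rewrite /radial_part -mulrA gamM// (lt_le_trans a_gt0).
Qed.

(** The spherical gradient of the average is a linear image of the integral of
    [y t = t *: grad f], so that [wint_cauchy_schwarz] applies with [B] the energy form
    pulled back by this linear map [L]. *)
Let energy_average : m * energy g u <= N * RI angular_part.
Proof.
have hg := sgrad_profile al_gt1 phi_gt0 PhiE CPhi Su (has_grad_ray_average (theta u)).
rewrite /energy /sgrad (has_gradE hg) -/p.
have -> : (phi u)^-1 *: (m^-1 *: ray_momentum (theta u)) -
    ((phi u)^-1 ^+ 2 * dot (m^-1 *: ray_momentum (theta u)) u) *: p = m^-1 *: L (ray_momentum (theta u)).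
  by rewrite /L dotZl scalerBr !scalerA; congr (_ *: _ - _ *: _); ring.
rewrite invhessZ.
have CS := wint_cauchy_schwarz N al_gt1 z_gt0 a_gt0 ab B0 (fun i => @cy i).
have JE : ray_momentum (theta u) = \row_i RI (fun t => y t 0 i).
  by apply/rowP => i; rewrite !mxE; congr RI; apply/funext => t; rewrite !mxE.
rewrite -JE BE -/(angular_part) in CS.
have A0 : 0 <= RI angular_part.
  by apply: wint_ge0 => // t _; rewrite mulr_ge0 ?powR_ge0// B0.
have {}CS := le_trans CS (ler_wpM2r A0 second_moment).
rewrite (_ : m * _ = m^-1 * (al * Phi u * Q u (L (ray_momentum (theta u))))); last by field; rewrite gt_eqF.
by rewrite [leLHS]mulrC ler_pdivrMr// [leRHS]mulrAC.
Qed.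

(** The radial part of the energy pays for the oscillation of [f] along the ray, by
    the Poincare inequality, and the angular part pays for the energy of the average. *)
Lemma ray_inequality C : 1 - al^-1 <= C -> N * Cnu <= C ->
  RI (fun t => f (t *: theta u) ^+ 2) + Cnu * (m * energy g u) <=
  m * ray_average (theta u) ^+ 2 + C * RI (fun t => Q (t *: theta u) (grad f (t *: theta u))).
Proof.
move=> C1 C2.
have al1 : 0 < al - 1 by rewrite subr_gt0.
have R0 : 0 <= RI radial_part.
  by apply: wint_ge0 => // t _; rewrite mulr_ge0 ?powR_ge0// sqr_ge0.
have A0 : 0 <= RI angular_part.
  by apply: wint_ge0 => // t _; rewrite mulr_ge0 ?powR_ge0// B0.
rewrite [X in _ <= _ + C * X](@eq_wint R al N z a b a_gt0 _ (fun t => (al - 1)^-1 * radial_part t + angular_part t)) => [|t t_gt0]; last exact: Q_ray.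
rewrite wintD//; last exact: (@cposZ _ _ _ cradial).
rewrite wintZ//.
have h1 := wint_variance N al_gt1 z_gt0 a_gt0 ab (F t0) (@cpos_ray _ _ _ (theta u) cf).
have h2 := poincare; have h3 := energy_average.
(* [1 / al = (1 - 1 / al) / (al - 1)] *)
have h4 : al^-1 * RI radial_part <= C * ((al - 1)^-1 * RI radial_part).
  rewrite mulrA ler_wpM2r// ler_pdivlMr//.
  by rewrite mulrBr mulVf ?mulr1// gt_eqF.
have h5 : Cnu * (m * energy g u) <= C * RI angular_part.
  apply: (le_trans (ler_wpM2l (ltW Cnu0) h3)); rewrite mulrA; apply: ler_wpM2r => //.
  by rewrite mulrC.
rewrite -/(ray_average _) in h1.
rewrite mulrDr; lra.
Qed.

Lemma wint_Q_fin : (\int[lambda]_(t in `[a, b])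
    ((Q (t *: theta u) (grad f (t *: theta u)))%:E * (weight al N z t)%:E) =
  (RI (fun t => Q (t *: theta u) (grad f (t *: theta u))))%:E)%E.
Proof.
have cq : cpos (fun t => (al - 1)^-1 * radial_part t + angular_part t).
  exact: (@cposD _ _ _ (@cposZ _ _ _ cradial) cangular).
rewrite (@eq_wint R al N z a b a_gt0 _ (fun t => (al - 1)^-1 * radial_part t + angular_part t)) => [|t t_gt0]; last exact: Q_ray.
rewrite -wint_EFin//; apply: eq_integral => t /set_mem/=; rewrite in_itv/= => /andP[at_ _].
by rewrite Q_ray ?EFinM// (lt_le_trans a_gt0).
Qed.

End OneRay.

Lemma window_sqr (k : T -> R) : continuous k ->
  (\int[muP]_x ((k x ^+ 2)%:E * (window a b x)%:E) =
   \int[nuP]_(u in S) (RI (fun t => k (t *: theta u) ^+ 2)%R)%:E)%E.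
Proof.
move=> ck; have mk : measurable_fun setT (k : borelRn R n.+1 -> R) by exact: continuousT_measurableRn.
rewrite (polar_window a b (F := fun x => (k x ^+ 2)%:E)).
- apply: eq_integral => u _; rewrite -wint_EFin//.
  by apply: (cpos_ray (f := fun x => k x ^+ 2)) => x; apply: (@continuousM _ _ k k); exact: ck.
- by apply/measurable_EFinP; exact: measurable_funX.
- by move=> x; rewrite lee_fin sqr_ge0.
Qed.

Lemma window_mass : (\int[muP]_x (window a b x)%:E = m%:E)%E.
Proof.
have c1 : continuous (fun _ : T => 1 : R) by move=> x; exact: cst_continuous.
have := window_sqr c1.
under eq_integral do rewrite expr1n mul1e.
move=> ->; rewrite (eq_integral (fun=> m%:E)) => [|u _]; last first.
  by congr (_%:E); apply: eq_wint => // t _; rewrite expr1n.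
have mS := @measurable_sphere R n.
rewrite integral_cst// -[RHS]mule1; congr (_ * _)%E; exact: nuPS.
Qed.

Let mf : measurable_fun setT (f : borelRn R n.+1 -> R).
Proof. exact: continuousT_measurableRn. Qed.

Let mQ : measurable_fun setT (fun x : borelRn R n.+1 => Q x (grad f x)).
Proof.
apply: measurable_invhess => i.
rewrite (_ : (fun x => grad f x 0 i) = partial i f); last by apply/funext => y; rewrite mxE.
by apply: continuousT_measurableRn => x; exact: cdf.
Qed.

Local Notation average := (\int[nuP]_(u in S) g u).
Local Notation dissipation :=
  (\int[muP]_x ((`|Q x (grad f x)|)%:E * (window a b x)%:E))%E.

Let RE (h : T -> R) : nuP.-integrable S (EFin \o h) ->
  (\int[nuP]_(u in S) (h u)%:E = (\int[nuP]_(u in S) h u)%:E)%E.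
Proof. have mS := @measurable_sphere R n.
by move=> ih; rewrite /Rintegral fineK//; exact: integrable_fin_num ih. Qed.

(** Integrate [ray_inequality] over the sphere and apply (B) to the average: the
    energies of the average cancel. *)
Lemma truncated_inequality C : 1 - al^-1 <= C -> N * Cnu <= C -> ineqB phi Cnu ->
  (\int[muP]_x ((f x ^+ 2)%:E * (window a b x)%:E) <=
   (m * average ^+ 2)%:E + C%:E * dissipation)%E.
Proof.
move=> C1 C2 /ineqB_law hB; have mS := @measurable_sphere R n.
have gC := ray_average_C1; have ge := ray_average_even.
have ig := sphere_integrable gC; have ig2 := sphere_integrable (C1_sphereM gC).
have C0 : 0 < C by apply: lt_le_trans C1; rewrite subr_gt0 invf_lt1.
pose AF u := (\int[lambda]_(t in `[a, b]) ((f (t *: theta u) ^+ 2)%:E * (weight al N z t)%:E))%E.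
pose AQ u := (\int[lambda]_(t in `[a, b]) ((`|Q (t *: theta u) (grad f (t *: theta u))|)%:E * (weight al N z t)%:E))%E.
have mF2 : measurable_fun setT (fun x : borelRn R n.+1 => (f x ^+ 2)%:E).
  by apply/measurable_EFinP; exact: measurable_funX.
have mQ2 : measurable_fun setT (fun x : borelRn R n.+1 => (`|Q x (grad f x)|)%:E).
  by apply/measurable_EFinP; exact: measurableT_comp.
have F20 (x : borelRn R n.+1) : (0 <= (f x ^+ 2)%:E)%E by rewrite lee_fin sqr_ge0.
have Q20 (x : borelRn R n.+1) : (0 <= (`|Q x (grad f x)|)%:E)%E by rewrite lee_fin.
have mAF : measurable_fun S (AF : borelRn R n.+1 -> \bar R).
  by apply: measurable_funTS; exact: (measurable_ray_integral a b mF2 F20).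
have mAQ : measurable_fun S (AQ : borelRn R n.+1 -> \bar R).
  by apply: measurable_funTS; exact: (measurable_ray_integral a b mQ2 Q20).
have w0 t : a <= t -> 0 <= weight al N z t.
  by move=> ta; apply/ltW/weight_gt0 => //; exact: lt_le_trans ta.
have AF0 u : (0 <= AF u)%E.
  apply: integral_ge0 => t /=; rewrite in_itv/= => /andP[ta _].
  by rewrite mule_ge0// lee_fin ?sqr_ge0// w0.
have AQ0 u : (0 <= AQ u)%E.
  apply: integral_ge0 => t /=; rewrite in_itv/= => /andP[ta _].
  by rewrite mule_ge0// lee_fin ?w0.
have m00 := ltW m0; have Cnu00 := ltW Cnu0; have C00 := ltW C0.
have mE : measurable_fun S (fun u : borelRn R n.+1 => (energy g u)%:E).
  by apply/measurable_EFinP; apply: measurable_funTS; exact: measurable_energy.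
have E0 u : S u -> (0 <= (energy g u)%:E)%E by move=> Su; rewrite lee_fin energy_ge0.
have mg2 : measurable_fun S (fun u : borelRn R n.+1 => (g u ^+ 2)%:E) by exact: measurable_int ig2.
have key : (\int[nuP]_(u in S) (AF u + (Cnu * m)%:E * (energy g u)%:E) <=
    \int[nuP]_(u in S) (m%:E * (g u ^+ 2)%:E + C%:E * AQ u))%E.
  apply: ge0_le_integral => //.
  - by move=> u Su; rewrite adde_ge0// mule_ge0 ?E0// lee_fin mulr_ge0.
  - by apply: emeasurable_funD => //; exact: emeasurable_funM.
  - by apply: emeasurable_funD => //; exact: emeasurable_funM.
  move=> u Su.
  have -> : AF u = (RI (fun t => f (t *: theta u) ^+ 2))%:E.
    rewrite -wint_EFin//.
    by apply: (cpos_ray (f := fun x => f x ^+ 2)) => x; apply: (@continuousM _ _ f f); exact: cf.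
  have -> : AQ u = (RI (fun t => Q (t *: theta u) (grad f (t *: theta u))))%:E.
    rewrite -(wint_Q_fin Su); apply: eq_integral => t /set_mem/=; rewrite in_itv/= => /andP[ta _].
    rewrite ger0_norm//; apply: (invhess_ge0 hconv CPhi hdet); apply: t_theta_neq0 => //.
    exact: lt_le_trans ta.
  rewrite -!EFinM -!EFinD lee_fin -mulrA; exact: ray_inequality.
move: key; rewrite ge0_integralD//; last 2 first.
- by move=> u Su; rewrite mule_ge0 ?E0// lee_fin mulr_ge0.
- exact: emeasurable_funM.
have -> : (\int[nuP]_(u in S) (m%:E * (g u ^+ 2)%:E + C%:E * AQ u) =
    m%:E * \int[nuP]_(u in S) (g u ^+ 2)%:E + C%:E * \int[nuP]_(u in S) AQ u)%E.
  rewrite ge0_integralD//; last 4 first.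
  - by move=> u Su; rewrite mule_ge0 ?lee_fin ?sqr_ge0.
  - exact: emeasurable_funM.
  - by move=> u Su; rewrite mule_ge0 ?lee_fin.
  - exact: emeasurable_funM.
  congr (_ + _)%E; rewrite ge0_integralZl//.
  by move=> u Su; rewrite lee_fin sqr_ge0.
rewrite ge0_integralZl//; last by rewrite lee_fin mulr_ge0.
have XE : (\int[muP]_x ((f x ^+ 2)%:E * (window a b x)%:E) = \int[nuP]_(u in S) AF u)%E.
  exact: polar_window.
have QE : (dissipation = \int[nuP]_(u in S) AQ u)%E by exact: polar_window.
rewrite XE QE; have := hB _ ge gC; rewrite (RE ig) (RE ig2) -EFin_expe -EFinB.
have E1 : (0 <= \int[nuP]_(u in S) (energy g u)%:E)%E by exact: integral_ge0.
have X1 : (0 <= \int[nuP]_(u in S) AF u)%E by apply: integral_ge0 => u _.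
have Q1 : (0 <= \int[nuP]_(u in S) AQ u)%E by apply: integral_ge0 => u _.
move: E1 X1 Q1; move: (\int[nuP]_(u in S) AF u)%E (\int[nuP]_(u in S) AQ u)%E => X q.
case: (\int[nuP]_(u in S) (energy g u)%:E)%E => [e| |]// e0 X0.
  case: q => [q| |]// q0; last by move=> _ _; rewrite gt0_muley ?lte_fin// addey// leey.
  case: X X0 => [X| |]// X0.
  rewrite -!EFinM -!EFinD !lee_fin => h1 h2.
  move: (ler_wpM2l m00 h1); lra.
have Cm : 0 < Cnu * m by rewrite mulr_gt0.
case: q => [q| |]// q0; last by move=> _ _; rewrite gt0_muley ?lte_fin// addey// leey.
by move=> _; rewrite gt0_muley ?lte_fin// addey ?leye_eq//; case: X X0.
Qed.

(** Comparing the second moments of [f + 1] and [f] yields the first moment of [f]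
    from formulas for nonnegative functions. *)
Lemma window_average : muP.-integrable setT (EFin \o f) ->
  muP.-integrable setT (EFin \o (fun x => f x ^+ 2)) ->
  (\int[muP]_x (f x * window a b x)%:E = (m * average)%:E)%E.
Proof.
move=> if1 if2; have mS := @measurable_sphere R n.
have gC := ray_average_C1; have ig := sphere_integrable gC.
have mw := measurable_window a b.
have w01 x : `|window a b x| <= 1 by rewrite ger0_norm ?window_ge0 ?window_le1.
have iw (h : T -> R) : muP.-integrable setT (EFin \o h) ->
    muP.-integrable setT (EFin \o (fun x => h x * window a b x)).
  move=> ih; have mh : measurable_fun setT (h : borelRn R n.+1 -> R) by apply/measurable_EFinP; exact: measurable_int ih.
  apply: (le_integrable _ _ _ ih) => //.
    by apply/measurable_EFinP; exact: measurable_funM.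
  by move=> x _; rewrite /= lee_fin normrM ler_piMr.
have iW : muP.-integrable setT (EFin \o window a b).
  have i1 : muP.-integrable setT (EFin \o cst (1 : R)) by apply: finite_measure_integrable_cst.
  have := iw _ i1; apply: eq_integrable => // x _ /=.
  by rewrite mul1r.
have muE' (h : T -> R) : muP.-integrable setT (EFin \o h) ->
  (\int[muP]_x (h x)%:E = (\int[muP]_x h x)%:E)%E.
  by move=> ih; rewrite /Rintegral fineK//; exact: integrable_fin_num ih.
have mE : \int[muP]_x window a b x = m.
  by have := window_mass; rewrite muE'// => -[].
pose A u := RI (fun t => f (t *: theta u) ^+ 2).
have h1 := window_sqr cf.
have c1 : continuous (fun x : T => f x + 1).
  by move=> x; apply: continuousD; [exact: cf|exact: cst_continuous].
have h2 := @window_sqr (fun x => f x + 1) c1.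
have i2 := iw _ if2; have i1 := iw _ if1.
have iA : nuP.-integrable S (EFin \o A).
  apply/integrableP; split.
    apply: (eq_measurable_fun (fun u : borelRn R n.+1 =>
      \int[lambda]_(t in `[a, b]) ((f (t *: theta u) ^+ 2)%:E * (weight al N z t)%:E))%E).
      move=> u _; rewrite /A/= -wint_EFin//.
      by apply: (cpos_ray (f := fun x => f x ^+ 2)) => x; apply: (@continuousM _ _ f f); exact: cf.
    apply: measurable_funTS; apply: (measurable_ray_integral a b (F := fun x => (f x ^+ 2)%:E)).
      by apply/measurable_EFinP; exact: measurable_funX.
    by move=> x; rewrite lee_fin sqr_ge0.
  have -> : (\int[nuP]_(u in S) `|(EFin \o A) u| = \int[nuP]_(u in S) (A u)%:E)%E.
    apply: eq_integral => u _; rewrite /= ger0_norm//.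
    by apply: wint_ge0 => // t _; exact: sqr_ge0.
  rewrite -h1; under eq_integral do rewrite -EFinM.
  by rewrite muE'// ltry.
have AE : \int[nuP]_(u in S) A u = \int[muP]_x (f x ^+ 2 * window a b x).
  move: h1; under eq_integral do rewrite -EFinM.
  by rewrite muE'// RE// => -[].
have L : (\int[muP]_x (((f x + 1) ^+ 2)%:E * (window a b x)%:E) =
   (\int[muP]_x (f x ^+ 2 * window a b x) + 2 * (\int[muP]_x (f x * window a b x)) + m)%:E)%E.
  have iZ : muP.-integrable setT (EFin \o (fun x => 2 * (f x * window a b x))).
    by have := integrableZl measurableT 2 i1; apply: eq_integrable.
  have iD : muP.-integrable setT (EFin \o (fun x => f x ^+ 2 * window a b x + 2 * (f x * window a b x))).
    by have := integrableD measurableT i2 iZ; apply: eq_integrable.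
  rewrite -mE -RintegralZl// -RintegralD// -RintegralD// -muE'; last first.
    by have := integrableD measurableT iD iW; apply: eq_integrable.
  by apply: eq_integral => x _; rewrite -EFinM; congr (_%:E); ring.
have ic (c : R) : nuP.-integrable S (EFin \o cst c) by apply: finite_measure_integrable_cst.
have Rr : (\int[nuP]_(u in S) (RI (fun t => (f (t *: theta u) + 1) ^+ 2))%:E =
   (\int[nuP]_(u in S) A u + 2 * (m * average) + m)%:E)%E.
  have iZ : nuP.-integrable S (EFin \o (fun u => (2 * m) * g u)).
    by have := integrableZl mS (2 * m) ig; apply: eq_integrable.
  have iD : nuP.-integrable S (EFin \o (fun u => A u + (2 * m) * g u)).
    by have := integrableD mS iA iZ; apply: eq_integrable.
  have nS : fine (nuP S) = 1 by have := nuPS; rewrite /= => ->.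
  have Em : m = \int[nuP]_(u in S) (cst m u) by rewrite Rintegral_cst// nS mulr1.
  rewrite [X in EFin (_ + X)]Em mulrA -(RintegralZl _ mS ig) -(RintegralD mS iA iZ) -(RintegralD mS iD (ic m)) -RE; last first.
    by have := integrableD mS iD (ic m); apply: eq_integrable.
  apply: eq_integral => u _; congr (_%:E); rewrite /A /ray_average.
  have cr : cpos (fun t => f (t *: theta u)) by exact: cpos_ray.
  have c2 : cpos (fun t => f (t *: theta u) ^+ 2).
    by apply: (cpos_ray (f := fun x => f x ^+ 2)) => x; apply: (@continuousM _ _ f f); exact: cf.
  have cc : cpos (fun t => 2 * f (t *: theta u)) by exact: (@cposZ _ _ _ cr).
  rewrite [LHS](@eq_wint R al N z a b a_gt0 _ (fun t => (f (t *: theta u) ^+ 2 + 2 * f (t *: theta u)) + 1)) => [|t _]; last by ring.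
  rewrite wintD//; [|exact: (@cposD _ _ _ c2 cc)|exact: cpos_cst].
  rewrite wintD// wintZ// -/(wmass _ _ _ _ _); congr (_ + _ + _).
  by field; rewrite gt_eqF.
rewrite muE'//; congr (_%:E).
by move: h2; rewrite L Rr AE => -[] h; lra.
Qed.

Lemma truncated_variance C d : 1 - al^-1 <= C -> N * Cnu <= C -> ineqB phi Cnu ->
  muP.-integrable setT (EFin \o f) -> muP.-integrable setT (EFin \o (fun x => f x ^+ 2)) ->
  (\int[muP]_x (`|Q x (grad f x)|)%:E = d%:E)%E ->
  (\int[muP]_x window a b x) * (\int[muP]_x (f x ^+ 2 * window a b x)) <=
  (\int[muP]_x (f x * window a b x)) ^+ 2 + C * d.
Proof.
move=> C1 C2 hB if1 if2 dE.
have C0 : 0 < C by apply: lt_le_trans C1; rewrite subr_gt0 invf_lt1.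
have Q0 (x : borelRn R n.+1) : (0 <= (`|Q x (grad f x)|)%:E)%E by rewrite lee_fin.
have mQ2 : measurable_fun setT (fun x : borelRn R n.+1 => (`|Q x (grad f x)|)%:E).
  by apply/measurable_EFinP; exact: measurableT_comp.
have mw : measurable_fun setT (fun x : borelRn R n.+1 => (window a b x)%:E).
  by apply/measurable_EFinP; exact: measurable_window.
have w0 x : (0 <= (window a b x)%:E)%E by rewrite lee_fin window_ge0.
have w1 x : ((window a b x)%:E <= 1)%E by rewrite lee_fin window_le1.
(* multiplying [truncated_inequality] by [m] only decreases the energy term *)
have m1 : m <= 1.
  rewrite -lee_fin -window_mass -[leRHS](probability_setT muP) -[leRHS]mul1e -integral_cst//.
  by apply: ge0_le_integral.
have Dd : (dissipation <= d%:E)%E.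
  rewrite -dE; apply: ge0_le_integral => //.
  - by move=> x _; rewrite mule_ge0.
  - exact: emeasurable_funM.
  - by move=> x _; rewrite -[leRHS]mule1; exact: lee_wpmul2l.
have hM : \int[muP]_x window a b x = m by rewrite /Rintegral window_mass.
have hJ : \int[muP]_x (f x * window a b x) = m * average by rewrite /Rintegral window_average.
rewrite hM hJ; have := truncated_inequality C1 C2 hB.
rewrite /Rintegral; under [X in fine X]eq_integral do rewrite EFinM.
have X0 : (0 <= \int[muP]_x ((f x ^+ 2)%:E * (window a b x)%:E))%E.
  by apply: integral_ge0 => x _; rewrite mule_ge0// lee_fin sqr_ge0.
have D0 : (0 <= dissipation)%E by apply: integral_ge0 => x _; exact: mule_ge0.
move: X0 D0 Dd; case: (\int[muP]_x ((f x ^+ 2)%:E * (window a b x)%:E))%E => [X| |]// X0.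
  case: dissipation => [D| |]//; rewrite -?EFinM -?EFinD !lee_fin -/(average) => D0 Dd h.
  have h1 := ler_wpM2l (ltW m0) h.
  have h2 : m * D <= d by apply: le_trans Dd; rewrite ler_piMl.
  have := ler_wpM2l (ltW C0) h2.
  by rewrite /= exprMn; move: h1; lra.
by case: dissipation => [D| |]// _ _ _; rewrite /= mulr0 addr_ge0 ?sqr_ge0 ?mulr_ge0 ?(ltW C0)// -lee_fin -dE; apply: integral_ge0.
Qed.

End Truncation.

Section Exhaustion.
Variables (lb ub : R^nat).
Hypotheses (lb_gt0 : forall k, 0 < lb k) (lb_le : forall k, lb k <= (ub k)^-1)
  (ub_ge : forall k, k%:R <= ub k).

Let window_near x : x != 0 -> \forall k \near \oo, window (lb k) (ub k) x = 1.
Proof.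
move=> x0; have g0 := gauge_gt0 al_gt1 phi_gt0 PhiE x0; set G := gauge al Phi x in g0 *.
near=> k; have k1 : G <= k%:R by near: k; exact: nbhs_infty_ger.
have k2 : G^-1 <= k%:R by near: k; exact: nbhs_infty_ger.
rewrite /window indicE mem_set//= in_itv/= -/G (le_trans k1 (ub_ge k)) andbT.
have u0 : 0 < ub k by apply: lt_le_trans (le_trans k1 (ub_ge k)).
apply: (le_trans (lb_le k)); rewrite -[leRHS]invrK lef_pV2 ?posrE ?invr_gt0//.
exact: le_trans (ub_ge k).
Unshelve. all: by end_near. Qed.

Let window0 k : window (lb k) (ub k) 0 = 0.
Proof.
rewrite /window indicE memNset//= in_itv/= => /andP[h _].
have : gauge al Phi 0 = 0.
  by rewrite /gauge PhiE enorm0 powR0 ?gt_eqF// mulr0 mul0r mulr0 powR0// gt_eqF// invr_gt0.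
by move=> g0; move: h; rewrite g0 leNgt lb_gt0.
Qed.

(** Dominated convergence; the windows exhaust the complement of the origin. *)
Lemma cvg_window (h : T -> R) : muP.-integrable setT (EFin \o h) ->
  (\int[muP]_x (h x * window (lb k) (ub k) x)) @[k --> \oo] --> \int[muP]_x h x.
Proof.
move=> ih; have mh : measurable_fun setT (h : borelRn R n.+1 -> R) by apply/measurable_EFinP; exact: measurable_int ih.
have mF k : measurable_fun setT (fun x : borelRn R n.+1 => (h x * window (lb k) (ub k) x)%:E).
  by apply/measurable_EFinP; apply: measurable_funM => //; exact: measurable_window.
pose l (x : T) : \bar R := (h x * (x != 0)%:R)%:E.
have cv (x : borelRn R n.+1) : setT x -> (h x * window (lb k) (ub k) x)%:E @[k --> \oo] --> l x.
  move=> _; have [x0|x0] := eqVneq (x : T) 0.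
    by apply: cvg_near_cst; apply: nearW => k; rewrite /l x0 eqxx window0.
  by apply: cvg_near_cst; have := window_near x0; apply: filterS => k ->; rewrite /l x0.
have fn (x : borelRn R n.+1) : setT x -> (`|h x|)%:E \is a fin_num by [].
have ina : muP.-integrable setT (fun x => (`|h x|)%:E).
  by have := integrable_abse ih; apply: eq_integrable.
have dom k (x : borelRn R n.+1) : setT x -> (`|(h x * window (lb k) (ub k) x)%:E| <= (`|h x|)%:E)%E.
  by move=> _; rewrite /= lee_fin normrM ler_piMr// ger0_norm ?window_ge0 ?window_le1.
have := @dominated_cvg _ _ _ muP setT measurableT _ l _ mF cv fn ina dom.
have -> : (\int[muP]_x l x = (\int[muP]_x h x)%:E)%E.
  rewrite /Rintegral fineK; last by exact: integrable_fin_num ih.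
  apply: mu_off0.
  - apply: (emeasurable_fun_cvg _ _ mF) => x _; exact: cv.
  - exact: measurable_int ih.
  - by move=> x x0; rewrite /l x0 mulr1.
by move=> /fine_cvg.
Qed.

End Exhaustion.

(** The limit of [truncated_variance] along windows [[lb k, ub k]] which satisfy the
    condition on end points of [second_moment]: with [ub] tending to infinity, take [lb]
    as small as [gexp (ub) / ub]. *)
Theorem ineqA_of_ineqB Cnu : 0 < Cnu -> ineqB phi Cnu ->
  ineqA Phi (Num.max (1 - al^-1) (N * Cnu)).
Proof.
move=> Cnu0 hB; apply/ineqA_law => f fe Cf f2.
set C := Num.max _ _; have C1 : 1 - al^-1 <= C by rewrite le_max lexx.
have C2 : N * Cnu <= C by rewrite le_max lexx orbT.
have C0 : 0 < C by apply: lt_le_trans C1; rewrite subr_gt0 invf_lt1.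
have cf : continuous f by move=> x; exact: differentiable_continuous (Cf.1 x I).
have mf : measurable_fun setT (f : borelRn R n.+1 -> R) by exact: continuousT_measurableRn.
have mQ : measurable_fun setT (fun x : borelRn R n.+1 => Q x (grad f x)).
  apply: measurable_invhess => i.
  rewrite (_ : (fun x => grad f x 0 i) = partial i f); last by apply/funext => y; rewrite mxE.
  by apply: continuousT_measurableRn => x; exact: (Cf.2 i x I).
rewrite (mu_off0 (F := fun x => (Q x (grad f x))%:E) (G := fun x => (`|Q x (grad f x)|)%:E)); last 3 first.
- exact/measurable_EFinP.
- by apply/measurable_EFinP; exact: measurableT_comp.
- by move=> x x0; rewrite ger0_norm// (invhess_ge0 hconv CPhi hdet).
have D0 : (0 <= \int[muP]_x (`|Q x (grad f x)|)%:E)%E by apply: integral_ge0 => x _; rewrite lee_fin.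
move: D0; case dE : (\int[muP]_x (`|Q x (grad f x)|)%:E)%E => [d| |]// d0; last first.
  by rewrite gt0_muley ?lte_fin// leey.
have if2 : muP.-integrable setT (EFin \o (fun x => f x ^+ 2)).
  apply/integrableP; split; first by apply/measurable_EFinP; exact: measurable_funX.
  by apply: le_lt_trans f2; rewrite le_eqVlt; apply/orP; left; apply/eqP; apply: eq_integral => x _; rewrite /= ger0_norm// sqr_ge0.
have i1 : muP.-integrable setT (EFin \o cst (1 : R)) by apply: finite_measure_integrable_cst.
have if1 : muP.-integrable setT (EFin \o f).
  have i3 := integrableD measurableT if2 i1.
  apply: (le_integrable _ _ _ i3) => //; first exact/measurable_EFinP.
  move=> x _; rewrite /= lee_fin [leRHS]ger0_norm ?addr_ge0 ?sqr_ge0//.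
  have := sqr_ge0 (`|f x| - 1); rewrite -[X in _ <= X + _]real_normK ?num_real//.
  move: (normr_ge0 (f x)); move: `|f x| => v v0; nra.
have muE' (h : T -> R) : muP.-integrable setT (EFin \o h) ->
  (\int[muP]_x (h x)%:E = (\int[muP]_x h x)%:E)%E.
  by move=> ih; rewrite /Rintegral fineK//; exact: integrable_fin_num ih.
rewrite !muE'// -EFin_expe -EFinB -EFinM lee_fin lerBlDl.
have N1 : 1 < N by rewrite ltr1n ltnS.
pose t0 : R := N `^ al^-1.
have t0N : t0 `^ al = N by rewrite /t0 -powRrM mulVf ?gt_eqF// powRr1// ltW// (lt_trans ltr01).
have t01 : 1 < t0.
  rewrite ltNge; apply/negP => t1; move: N1; rewrite -t0N ltNge => /negP; apply.
  have e1 : (1 : R) `^ al = 1 by rewrite powR1.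
  rewrite -[leRHS]e1; apply: ge0_ler_powR; rewrite ?nnegrE ?powR_ge0 ?(ltW al_gt0)//.
(* beyond [t0] and 1, so that both [gexp] and [lb] are controlled by [ub] *)
pose ub (k : nat) : R := t0 + 1 + k%:R.
pose lb (k : nat) : R := gexp al (ub k) / ub k.
have ub1 k : 1 < ub k by rewrite /ub; have := ler0n R k; lra.
have ub0 k : 0 < ub k by exact: lt_trans (ub1 k).
have lb0 k : 0 < lb k by rewrite divr_gt0 ?gexp_gt0.
have lbV k : lb k <= (ub k)^-1.
  by rewrite /lb ler_piMl ?invr_ge0 ?(ltW (ub0 k))// gexp_le1.
have lb1 k : lb k < 1 by apply: (le_lt_trans (lbV k)); rewrite invf_lt1.
have ubk k : k%:R <= ub k by rewrite /ub lerDr; lra.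
have t0ub k : t0 < ub k by rewrite /ub; have := ler0n R k; lra.
have ends k : lb k `^ N * gexp al (lb k) <= ub k `^ N * gexp al (ub k).
  apply: (@le_trans _ _ (lb k)).
    rewrite -[leRHS]mulr1; apply: ler_pM; rewrite ?powR_ge0 ?gexp_le1 ?(ltW (gexp_gt0 _ _))//.
    by apply: ge1r_powR; rewrite ?lb0 ?ltW.
  apply: (@le_trans _ _ (gexp al (ub k))).
    by rewrite /lb ler_piMr ?(ltW (gexp_gt0 _ _))// invf_le1// ltW.
  rewrite ler_peMl ?(ltW (gexp_gt0 _ _))//.
  by rewrite -[leLHS](powRr0 (ub k)); apply: ler_powR; rewrite ltW.
have key k := @truncated_variance f (lb k) (ub k) t0 Cnu fe Cf (lb0 k) (lt_trans (lb1 k) t01) (t0ub k)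
  t0N (ends k) Cnu0 C d C1 C2 hB if1 if2 dE.
have cM := cvg_window lb0 lbV ubk i1.
have cX := cvg_window lb0 lbV ubk if2.
have cJ := cvg_window lb0 lbV ubk if1.
have M1 : \int[muP]_x cst 1 x = 1.
  rewrite Rintegral_cst// mul1r; have h : fine (muP setT) = 1 by rewrite probability_setT.
  exact: h.
rewrite -[leLHS]mul1r -{1}M1.
apply: ler_cvg_to (cvgM cM cX) (cvgD (cvgM cJ cJ) (cvg_cst (C * d))) _.
apply: nearW => k; have := key k.
rewrite (_ : \int[muP]_x window (lb k) (ub k) x = \int[muP]_x (cst 1 x * window (lb k) (ub k) x)).
  by rewrite expr2.
by apply: eq_Rintegral => x _; rewrite mul1r.
Qed.

(** For [C = 1 - 1 / al] the constant of the first part is [C / n], and for this value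
    the two terms of the maximum in the second part agree. *)
Theorem ineqA_iff_ineqB : ineqA Phi (1 - al^-1) <-> ineqB phi (N^-1 * (1 - al^-1)).
Proof.
have al0 : al != 0 by rewrite gt_eqF.
have N0 : N != 0 by rewrite pnatr_eq0.
have C0 : 0 < 1 - al^-1 by rewrite subr_gt0 invf_lt1.
split=> h.
  have C1 : 1 - al^-1 <= 1 - al^-1 <= 1 by rewrite lexx/= gerBl invr_ge0 ltW.
  have := ineqB_of_ineqA C1 h; congr (ineqB phi _).
  have -> : (N - al) * (1 - al^-1) + al - 1 = N * (1 - al^-1) by rewrite mulrBl mulrBr [al * (1 - _)]mulrBr mulr1 divff//; ring.
  by rewrite expr2 invfM mulrACA divff ?gt_eqF// mulr1 mulrC.
have := ineqA_of_ineqB (mulr_gt0 _ C0) h; rewrite mulrA divff// mul1r maxxx; apply.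
by rewrite invr_gt0 ltr0n.
Qed.

End Comparison.

(** * The theorem *)
Lemma Ck_pred (R : realType) (n k : nat) (U : set 'rV[R]_n.+1) (f : 'rV[R]_n.+1 -> R) :
  Ck k.+1 U f -> Ck k U f.
Proof.
elim: k f => [f [df _] x Ux|k IH f [df cf]]; first exact: differentiable_continuous (df x Ux).
by split=> // i; apply: IH; exact: cf.
Qed.

Theorem theorem1p4 (R : realType) (n : nat) (alpha : R)
    (Phi phi : 'rV[R]_n -> R)
    (hn : (2 <= n)%N) (halpha : 1 < alpha)
    (hconv : strictly_convex Phi) (heven : even Phi)
    (hphi : forall u, sphere R n u -> 0 < phi u)
    (hPhi : forall x, Phi x =
      alpha^-1 * enorm x `^ alpha * phi (radial x) `^ alpha)
    (hC3 : Ck 3 [set x | x != 0] Phi)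
    (hdet : forall x, x != 0 -> 0 < \det (hess Phi x)) :
  (forall Calpha : R,
     1 - alpha^-1 <= Calpha <= 1 -> ineqA Phi Calpha ->
     ineqB phi (Calpha ^+ 2 / ((n%:R - alpha) * Calpha + alpha - 1))) /\
  (forall Cnu : R, 0 < Cnu -> ineqB phi Cnu ->
     ineqA Phi (Num.max (1 - alpha^-1) (n%:R * Cnu))) /\
  (ineqA Phi (1 - alpha^-1) <-> ineqB phi (n%:R^-1 * (1 - alpha^-1))).
Proof.
case: n Phi phi hn hconv heven hphi hPhi hC3 hdet => [//|n'] Phi phi hn hconv heven hphi hPhi hC3 hdet.
have n_gt0 : (0 < n')%N by [].
have C2 := Ck_pred hC3.
have cphi x : x != 0 -> {for x, continuous (phi \o radial)}.
  exact: (continuous_phi_radial halpha hphi hPhi C2).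
have [nuP [muP [rhoP [z [[nuE muE nuS] [z0 _] rhoE polar]]]]] := polar_law n_gt0 halpha hphi cphi.
have {}muE A : measurable A -> mu Phi A = muP A.
  have PhiE : Phi = fun x => alpha^-1 * enorm x `^ alpha * phi (radial x) `^ alpha by exact/funext.
  by move=> mA; rewrite PhiE; exact: muE.
split=> [C hC hA|].
  exact: (ineqB_of_ineqA n_gt0 halpha hconv heven hphi hPhi C2 hdet nuE muE nuS z0 rhoE polar hC hA).
split=> [C C0 hB|].
  exact: (ineqA_of_ineqB n_gt0 halpha hconv heven hphi hPhi C2 hdet nuE muE nuS z0 rhoE polar C0 hB).
exact: (ineqA_iff_ineqB n_gt0 halpha hconv heven hphi hPhi C2 hdet nuE muE nuS z0 rhoE polar).
Qed.
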